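(* Let $X_1,\ldots,X_n$ be i.i.d. $N_p(0,\Sigma)$ with $\Sigma$ a $p\times p$ positive definite matrix, where $p=p_n$ may grow with $n$. Put on $\Sigma$ the prior $$\pi(\Sigma)=\frac{\pi^u(\Sigma)\,I(\Sigma\in\mathcal{U}(\tau))}{\pi^u(\Sigma\in\mathcal{U}(\tau))},$$ where $\pi^u$ is the unconstrained prior on symmetric matrices under which, independently, for $1\le j<k\le p$: $\sigma_{jk}=\sigma_{kj}$, $\sigma_{jk}\mid\rho_{jk}\sim N\big(0,\frac{\rho_{jk}}{1-\rho_{jk}}\tau_1^2\big)$, $\rho_{jk}\sim \mathrm{Beta}(a,b)$, and for $j=1,\ldots,p$: $\sigma_{jj}\sim\mathrm{Gamma}(1,\lambda/2)$ (shape $1$, rate $\lambda/2$); and $\mathcal{U}(\tau)=\{\Sigma\in\mathcal{C}_p:\tau^{-1}\le\lambda_{\min}(\Sigma)\le\lambda_{\max}(\Sigma)\le\tau\}$. Assume: (A1) the true covariance $\Sigma_0$ belongs to $\mathcal{U}(s_0,\tau_0)=\{\Sigma\in\mathcal{C}_p: |s(\Sigma)|\le s_0,\ \tau_0^{-1}\le\lambda_{\min}(\Sigma)\le\lambda_{\max}(\Sigma)\le\tau_0\}$ for some integer $0<s_0<p(p-1)$ and constant $\tau_0>1$; (A2) $p\asymp n^{\beta}$ for some $0<\beta<1$; (A3) $\tau\ge\max(3,\tau_0)$, $\tau=O(1)$, $\lambda=O(1)$, $a=b=1/2$ and $\tau_1^2\asymp 1/(np^4)$. If $(p+s_0)\log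 p=o(n)$, then for some sufficiently large constant $M>0$, $$\pi\Big(\|\Sigma-\Sigma_0\|_F^2\ge M\frac{(p+s_0)\log p}{n}\ \Big|\ X_1,\ldots,X_n\Big)\longrightarrow 0$$ in $\mathbb{P}_0$-probability as $n\to\infty$, where $\mathbb{P}_0$ is the law of the data under $\Sigma_0$.
   Context: $\mathcal{C}_p$ denotes the set of $p\times p$ positive definite matrices; $\lambda_{\min},\lambda_{\max}$ denote minimal and maximal eigenvalues; $\|A\|_F=(\sum_{i,j}a_{ij}^2)^{1/2}$. $|s(\Sigma)|$ is the number of nonzero off-diagonal entries of $\Sigma$. For positive sequences, $a_n\asymp b_n$ means $a_n/b_n$ and $b_n/a_n$ are both bounded, $a_n=O(b_n)$ means $a_n/b_n$ is bounded, and $a_n=o(b_n)$ means $a_n/b_n\to0$. The quantities $p,s_0,\tau_1$ (and possibly $\tau,\lambda$) may depend on $n$; all asymptotics are as $n\to\infty$. *)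

(* Defs.v *)
From HB Require Import structures.
From mathcomp Require Import all_boot all_order all_algebra.
From mathcomp Require Import all_classical all_reals all_analysis.
Set Implicit Arguments. Unset Strict Implicit. Unset Printing Implicit Defensive.
Import Order.TTheory GRing.Theory Num.Theory.
Import numFieldNormedType.Exports.
Local Open Scope classical_set_scope.
Local Open Scope ring_scope.

(* Points of R^d are encoded as v : nat -> R, only v 0 .. v (d-1) matter.
   The integral is the iterated Lebesgue integral (= the integral against the
   d-fold product Lebesgue measure for nonnegative measurable f, by Tonelli). *)
Definition vcons (R : Type) (x : R) (v : nat -> R) : nat -> R :=
  fun k => if k is k'.+1 then v k' else x.

Fixpoint intRn (R : realType) (d : nat) (f : (nat -> R) -> \bar R) : \bar R :=
  match d with
  | 0 => f (fun _ => 0)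
  | d'.+1 => (\int[@lebesgue_measure R]_x intRn d' (fun v => f (vcons x v)))%E
  end.

Definition eprod (R : realType) (s : seq (\bar R)) : \bar R := foldr (fun x y => x * y)%E 1%E s.

Definition posdef (R : realType) (p : nat) (S : 'M[R]_p) : Prop :=
  S^T = S /\ forall x : 'cV[R]_p, x != 0 -> 0 < (x^T *m S *m x) ord0 ord0.

(* all (real) eigenvalues lie in [lo, hi]; for symmetric S this is
   lo <= lambda_min(S) <= lambda_max(S) <= hi *)
Definition eig_between (R : realType) (p : nat) (S : 'M[R]_p) (lo hi : R) : Prop :=
  forall a : R, eigenvalue S a -> lo <= a <= hi.

Definition nsupp (R : realType) (p : nat) (S : 'M[R]_p) : nat :=
  #|[set ij : 'I_p * 'I_p | (ij.1 != ij.2) && (S ij.1 ij.2 != 0)]|.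

Definition Ubound (R : realType) (p : nat) (tau : R) : set 'M[R]_p :=
  [set S | posdef S /\ eig_between S tau^-1 tau].

Definition Usparse (R : realType) (p : nat) (s0 : nat) (tau0 : R) : set 'M[R]_p :=
  [set S | posdef S /\ (nsupp S <= s0)%N /\ eig_between S tau0^-1 tau0].

Arguments Ubound {R} p tau _.
Arguments Usparse {R} p s0 tau0 _.

Definition frob2 (R : realType) (p : nat) (A : 'M[R]_p) : R :=
  \sum_(i < p) \sum_(j < p) A i j ^+ 2.

Definition normpdf (R : realType) (v x : R) : R :=
  expR (- (x ^+ 2) / (2 * v)) / Num.sqrt (2 * pi * v).

Definition betaB (R : realType) (a b : R) : R :=
  fine (\int[@lebesgue_measure R]_(r in `]0%R, 1%R[) ((r `^ (a - 1)) * ((1 - r) `^ (b - 1)))%:E)%E.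

Definition betapdf (R : realType) (a b r : R) : R :=
  if (0 < r) && (r < 1) then (r `^ (a - 1)) * ((1 - r) `^ (b - 1)) / betaB a b else 0.

Definition gamma1pdf (R : realType) (rate x : R) : R :=
  if 0 < x then rate * expR (- rate * x) else 0.

(* marginal density of sigma_jk: sigma | rho ~ N(0, rho/(1-rho) tau1^2),
   rho ~ Beta(a,b) *)
Definition offpdf (R : realType) (a b tau1 s : R) : \bar R :=
  (\int[@lebesgue_measure R]_(r in `]0%R, 1%R[)
     (normpdf (r / (1 - r) * tau1 ^+ 2) s * betapdf a b r)%:E)%E.

(* unconstrained prior density pi^u of a symmetric matrix (w.r.t. Lebesgue
   measure on its free entries sigma_jk, j <= k) *)
Definition prior_u (R : realType) (p : nat) (a b tau1 lam : R) (S : 'M[R]_p) : \bar R :=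
  (eprod [seq (gamma1pdf (lam / 2) (S j j))%:E | j <- enum 'I_p] *
   eprod [seq offpdf a b tau1 (S jk.1 jk.2) |
           jk <- enum [set jk : 'I_p * 'I_p | (jk.1 < jk.2)%N]])%E.

(* coordinates of symmetric p x p matrices: free entries (j <= k) indexed by
   k(k+1)/2 + j, a bijection onto [0, p(p+1)/2) *)
Definition symidx (j k : nat) : nat := (k * k.+1)./2 + j.
Definition symdim (p : nat) : nat := (p * p.+1)./2.
Definition mxsym (R : realType) (p : nat) (th : nat -> R) : 'M[R]_p :=
  \matrix_(i, j) th (symidx (minn i j) (maxn i j)).

Definition mvnpdf (R : realType) (p : nat) (S : 'M[R]_p) (x : 'cV[R]_p) : R :=
  expR (- ((x^T *m invmx S *m x) ord0 ord0) / 2) / Num.sqrt ((2 * pi) ^+ p * \det S).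

Definition lik (R : realType) (n p : nat) (S : 'M[R]_p) (X : 'I_n -> 'cV[R]_p) : R :=
  \prod_(i < n) mvnpdf S (X i).

Definition prior (R : realType) (p : nat) (a b tau1 lam tau : R) (th : nat -> R) : \bar R :=
  let Z := intRn (symdim p) (fun t => ((\1_(Ubound p tau) (mxsym p t))%:E
                                       * prior_u a b tau1 lam (mxsym p t))%E) in
  ((\1_(Ubound p tau) (mxsym p th))%:E * prior_u a b tau1 lam (mxsym p th)
     * ((fine Z)^-1)%:E)%E.

Definition posterior (R : realType) (n p : nat) (a b tau1 lam tau : R)
    (X : 'I_n -> 'cV[R]_p) (A : set 'M[R]_p) : R :=
  let w := fun th : nat -> R =>
    (prior p a b tau1 lam tau th * (lik (mxsym p th) X)%:E)%E in
  fine (intRn (symdim p) (fun th => ((\1_A (mxsym p th))%:E * w th)%E))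
  / fine (intRn (symdim p) w).

Definition dataof (R : realType) (n p : nat) (v : nat -> R) : 'I_n -> 'cV[R]_p :=
  fun i => \col_(j < p) v (i * p + j)%N.

Arguments dataof {R} n p v.

Definition P0 (R : realType) (n p : nat) (S0 : 'M[R]_p) (E : set ('I_n -> 'cV[R]_p)) : \bar R :=
  intRn (n * p) (fun v => ((\1_E (dataof n p v)) * lik S0 (dataof n p v))%:E).

Arguments P0 {R} n {p} S0 E.

Definition seq_bigO (R : realType) (u v : nat -> R) : Prop :=
  exists C : R, 0 < C /\ \forall n \near \oo, u n <= C * v n.
Definition seq_asymp (R : realType) (u v : nat -> R) : Prop := seq_bigO u v /\ seq_bigO v u.

(* Main.v *)
(* Write l(S) for the likelihood at S, W = (p + s0) ln p and n r^2 = M W. If the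
   posterior gives mass at least eps to A = {S : |S - Sigma0|_F >= r}, one of
   the following holds, for a ball B of prior mass b around (almost) Sigma0, a
   constant k = exp(C W), and the cells c of a grid meeting A and U(tau), each
   with a representative S_c in A and a weight h_c:
   - int_B l dpi <= (b / k) l(Sigma0): as l(Sigma0)^2 / l + k^2 l >= 2 k l(Sigma0),
     this is controlled by the chi-square integral of l(Sigma0)^2 / l over B;
   - l(S_c) > h_c^4 l(Sigma0) for some c; then the sum of
     h_c^-2 sqrt (l(S_c) l(Sigma0)) exceeds l(Sigma0), and the Hellinger affinity
     is at most exp(- a n r^2), a > 0;
   - otherwise l <= h_c / 2 (kappa l^2 / l(S_c) + sqrt (l(S_c) l(Sigma0)) / kappa)
     on c, and this integrates to at least a multiple eps b / k of l(Sigma0).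
   The expectations are Gaussian integrals, computed from determinants. The
   shrinkage prior gives an off-diagonal grid interval of length t at distance
   m t from 0 a mass of order tau1 / (t m^2), so that weights growing like m keep
   both the sum of h_c^-2 and the sum of h_c pi(c) / b below exp(C W). For M large,
   each contribution is at most exp(- W), up to a factor 1 / eps. *)
Require Import Defs.
From HB Require Import structures.
From mathcomp Require Import all_boot all_order all_algebra.
From mathcomp Require Import spectral complex.
From mathcomp Require Import all_classical all_reals all_analysis.
From mathcomp Require Import measurable_realfun.
From mathcomp Require Import ring lra zify.
Set Implicit Arguments. Unset Strict Implicit. Unset Printing Implicit Defensive.
Import Order.TTheory GRing.Theory Num.Theory.
Import numFieldNormedType.Exports.
Local Open Scope ring_scope.

(** * Quadratic forms and determinants *)

(** The grid has about n to a power of order p^2 cells, too many for a union bound, so the cells are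
    never counted: both weighted sums factorise over the coordinates. With mesh t = sqrt (ln p / (n
    p)), two points of a cell are at squared distance at most p ln p / n, and the chi-square cost
    inside a cell is exp(O(W)). An off-diagonal weight sqrt p times m contributes a factor 1 + O(H /
    p) to the sum of inverse squares, H = 1 + ln L being a harmonic bound, and again 1 + O(H / p) to
    the sum of masses times weights, as tau1 / t is at most of order p^(-3/2). Over p^2 coordinates
    both give exp(O(p H)), and H = O(ln p) by (A2). This balance fixes the scale sqrt p. The
    argument consists of inequalities between iterated integrals of non-negative functions.
    Comparing such integrals requires no measurability, which keeps U(tau), A and the event about
    the posterior out of all measurability proofs. The normalising constant of the constrained prior
    cancels in the posterior ratio, so that all masses are those of the product prior pi^u. *)

Section Spectral.
Variable R : realType.

(** Over the complex numbers [S] is Hermitian, hence unitarily diagonalisable with real spectrum;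
    [eigenvalue_map] brings an eigenvalue back to the reals. *)
Lemma sym_has_eigenvalue n (S : 'M[R]_n.+1) : S^T = S -> exists a, eigenvalue S a.
Proof.
move=> Ssym; pose A := map_mx (real_complex R) S.
have Ah : A \is hermsymmx.
  apply/is_hermitianmxP; rewrite expr0 scale1r.
  apply/matrixP => i k; rewrite !mxE -[in RHS]Ssym mxE.
  exact/esym/conjc_real.
have An := hermitian_normalmx Ah.
have dr := hermitian_spectral_diag_real Ah.
have /orthomx_spectralP E := An.
set P := spectralmx A in E; set d := spectral_diag A in E dr.
have Pu : P \in unitmx by exact: spectral_unit.
have : eigenvalue A (d 0 0).
  apply/eigenvalueP; exists (row 0 P).
    by rewrite {1}E -row_mul !mulmxA mulmxV// mul1mx row_mul row_diag_mx -scalemxAl -rowE.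
  by apply: contraTneq Pu => P0; rewrite -row_free_unit; apply/row_freePn; exists 0; rewrite P0 sub0mx.
have /mxOverP/(_ 0 0)/complex_realP[a ->] := dr.
rewrite -[_%:C%C]/(real_complex R a).
by rewrite eigenvalue_map => ea; exists a.
Qed.

Definition nrm2 n (x : 'cV[R]_n) : R := (x^T *m x) 0 0.
Definition qform n (S : 'M[R]_n) (x : 'cV[R]_n) : R := (x^T *m S *m x) 0 0.

Lemma nrm2E n (x : 'cV[R]_n) : nrm2 x = \sum_i x i 0 ^+ 2.
Proof. by rewrite /nrm2 mxE; apply: eq_bigr => i _; rewrite mxE expr2. Qed.

Lemma nrm2_ge0 n (x : 'cV[R]_n) : 0 <= nrm2 x.
Proof. by rewrite nrm2E; apply: sumr_ge0 => i _; exact: sqr_ge0. Qed.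

Lemma nrm2_eq0 n (x : 'cV[R]_n) : (nrm2 x == 0) = (x == 0).
Proof.
apply/idP/eqP => [|->]; last by rewrite /nrm2 mulmx0 mxE.
rewrite nrm2E psumr_eq0 => [/allP x0|i _]; last exact: sqr_ge0.
apply/matrixP => i j; rewrite ord1 [RHS]mxE.
by apply/eqP; rewrite -sqrf_eq0; apply: x0; rewrite mem_index_enum.
Qed.

Lemma nrm2_gt0 n (x : 'cV[R]_n) : (0 < nrm2 x) = (x != 0).
Proof. by rewrite lt0r nrm2_eq0 nrm2_ge0 andbT. Qed.

(** The reflection along [e - v] exchanges [v] and the first basis vector [e], so its first row is
    [v]. It degenerates when [v] is already [e], which is treated apart. *)
Lemma householder n (v : 'rV[R]_n.+1) : (v *m v^T) 0 0 = 1 ->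
  exists H : 'M[R]_n.+1, H *m H^T = 1%:M /\ row 0 H = v.
Proof.
move=> v1; have [->|ve] := eqVneq v (delta_mx 0 0).
  by exists 1%:M; rewrite trmx1 mulmx1 row1.
pose e : 'rV[R]_n.+1 := delta_mx 0 0.
pose w := e - v.
have wn : nrm2 w^T != 0.
  rewrite nrm2_eq0; apply: contraNneq ve => w0.
  have : w = 0 by rewrite -[w]trmxK w0 trmx0.
  by move/eqP; rewrite subr_eq0 eq_sym.
have e1 : (e *m e^T) 0 0 = 1.
  by rewrite -rowE !mxE !eqxx.
have ev : (v *m e^T) 0 0 = (e *m v^T) 0 0.
  by rewrite -[v *m e^T]trmxK trmx_mul trmxK mxE.
have ew : nrm2 w^T = 2 * (e *m w^T) 0 0.
  rewrite /nrm2 trmxK /w linearB /= mulmxBl !mulmxBr !mxE.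
  move: e1 ev v1; rewrite !mxE => -> -> ->; ring.
have wE : w = e - v by [].
clearbody w; set a := nrm2 w^T in wn ew.
pose H := 1%:M - (2 / a) *: (w^T *m w).
have Ht : H^T = H by rewrite /H linearB /= linearZ /= trmx1 trmx_mul trmxK.
have ww : w *m w^T = a%:M by rewrite [LHS]mx11_scalar /a /nrm2 trmxK.
exists H; split.
  rewrite Ht /H mulmxBl mul1mx mulmxBr mulmx1 -!scalemxAl -!scalemxAr scalerA.
  rewrite mulmxA -(mulmxA w^T) ww -mulmxA mul_scalar_mx -scalemxAr scalerA.
  apply/matrixP => i j; rewrite !mxE; set z := \sum_k _; field => //.
rewrite rowE -/e /H mulmxBr mulmx1 -scalemxAr mulmxA.
rewrite [e *m w^T]mx11_scalar mul_scalar_mx scalerA.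
have -> : 2 / a * (e *m w^T) 0 0 = 1 by rewrite mulrAC -ew mulfV.
by rewrite scale1r wE opprB addrC subrK.
Qed.

(** Deflation: a unit eigenvector is completed to an orthogonal [H], and the symmetry of
    [H *m S *m H^T] clears its first row and column outside the corner. *)
Theorem sym_spectral n (S : 'M[R]_n) : S^T = S ->
  exists (P : 'M[R]_n) (d : 'rV[R]_n), P *m P^T = 1%:M /\ S = P^T *m diag_mx d *m P.
Proof.
elim: n S => [|n IH] S Ssym.
  by exists 1%:M, 0; split; apply/matrixP => -[].
have [a /eigenvalueP[v0 v0S v0n]] := sym_has_eigenvalue Ssym.
have nv : 0 < nrm2 v0^T by rewrite nrm2_gt0 -(inj_eq trmx_inj) trmxK trmx0.
pose v := (Num.sqrt (nrm2 v0^T))^-1 *: v0.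
have v1 : (v *m v^T) 0 0 = 1.
  rewrite /v linearZ /= -scalemxAl -scalemxAr scalerA mxE.
  by rewrite -{3}[v0]trmxK -[X in _ * X]/(nrm2 _) -expr2 exprVn sqr_sqrtr ?ltW// mulVf// gt_eqF.
have vS : v *m S = a *: v by rewrite /v -scalemxAl v0S scalerA mulrC -scalerA.
have [H [HH Hv]] := householder v1.
have HtH : H^T *m H = 1%:M by apply: mulmx1C.
(* The type [1 + n], convertible to [n.+1], gives access to the block decomposition. *)
pose B : 'M[R]_(1 + n) := H *m S *m H^T.
have Bsym : B^T = B by rewrite /B !trmx_mul trmxK Ssym mulmxA.
have B0 : row 0 B = a *: delta_mx 0 0.
  by rewrite /B !row_mul Hv vS -scalemxAl -Hv -row_mul HH row1.
have SE : S = H^T *m B *m H.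
  by rewrite /B !mulmxA HtH mul1mx -mulmxA HtH mulmx1.
clearbody B.
have B0E j : B 0 j = a * (j == 0)%:R.
  by have /rowP/(_ j) := B0; rewrite !mxE eqxx.
have l0 (i : 'I_1) : lshift n i = 0 by rewrite ord1; exact/val_inj.
have Bur : ursubmx B = 0.
  apply/matrixP => i j; rewrite [LHS]mxE [LHS]mxE l0 B0E [RHS]mxE.
  by rewrite (_ : (_ == _) = false) ?mulr0//; apply/negbTE/eqP => /(congr1 val).
have Bdl : dlsubmx B = 0 by rewrite -Bsym -trmx_ursub Bur trmx0.
have Bul : ulsubmx B = a%:M.
  apply/matrixP => i j; rewrite [LHS]mxE [LHS]mxE !l0 B0E [RHS]mxE !ord1.
  by rewrite !eqxx mulr1 mulr1n.
have Bs : (drsubmx B)^T = drsubmx B by rewrite trmx_drsub Bsym.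
have [P' [d' [PP' Sd]]] := IH _ Bs.
pose P1 : 'M[R]_(1 + n) := block_mx 1%:M 0 0 P'.
pose d1 : 'rV[R]_(1 + n) := row_mx a%:M d'.
have BE : B = P1^T *m diag_mx d1 *m P1.
  rewrite -[LHS]submxK Bur Bdl Bul Sd /P1 /d1 diag_mx_row tr_block_mx !mulmx_block.
  rewrite !(trmx1, trmx0, mul0mx, mulmx0, mul1mx, mulmx1, addr0, add0r).
  by congr block_mx; apply/matrixP => i j; rewrite !ord1 !mxE.
have PP1 : P1 *m P1^T = 1%:M.
  rewrite /P1 tr_block_mx mulmx_block.
  rewrite !(trmx1, trmx0, mul0mx, mulmx0, mul1mx, mulmx1, addr0, add0r) PP'.
  by rewrite -scalar_mx_block.
exists (P1 *m H), d1; split.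
  by rewrite trmx_mul mulmxA -(mulmxA P1) HH mulmx1.
by rewrite SE BE trmx_mul !mulmxA.
Qed.

End Spectral.

(** * Eigenvalue bounds as bounds on quadratic forms, and determinants of [m + H] and [m - H] *)

Section QuadraticForms.
Variable R : realType.

Lemma qformE n (S : 'M[R]_n) (x : 'cV[R]_n) : qform S x = \sum_i \sum_j x i 0 * S i j * x j 0.
Proof.
rewrite /qform mxE; under eq_bigr => j _ do rewrite mxE big_distrl /=.
by rewrite exchange_big; apply: eq_bigr => i _; apply: eq_bigr => j _; rewrite mxE.
Qed.

Lemma qformD n (S T : 'M[R]_n) x : qform (S + T) x = qform S x + qform T x.
Proof. by rewrite /qform mulmxDr mulmxDl mxE. Qed.

Lemma qformZ n a (S : 'M[R]_n) x : qform (a *: S) x = a * qform S x.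
Proof. by rewrite /qform -scalemxAr -scalemxAl mxE. Qed.

Lemma qformN n (S : 'M[R]_n) x : qform (- S) x = - qform S x.
Proof. by rewrite /qform mulmxN mulNmx mxE. Qed.

Lemma qformB n (S T : 'M[R]_n) x : qform (S - T) x = qform S x - qform T x.
Proof. by rewrite qformD qformN. Qed.

Lemma qform1 n (x : 'cV[R]_n) : qform 1%:M x = nrm2 x.
Proof. by rewrite /qform mulmx1. Qed.

Lemma qform_congr n (P S : 'M[R]_n) x : qform (P^T *m S *m P) x = qform S (P *m x).
Proof. by rewrite /qform trmx_mul !mulmxA. Qed.

Lemma qform_diag n (d : 'rV[R]_n) x : qform (diag_mx d) x = \sum_i d 0 i * x i 0 ^+ 2.
Proof.
rewrite qformE; apply: eq_bigr => i _; rewrite (bigD1 i)//= big1 ?addr0.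
  by rewrite mxE eqxx mulr1n; ring.
by move=> j ji; rewrite mxE eq_sym (negPf ji) mulr0n mulr0 mul0r.
Qed.

Lemma nrm2_orth n (P : 'M[R]_n) x : P *m P^T = 1%:M -> nrm2 (P *m x) = nrm2 x.
Proof.
move=> /mulmx1C PP; rewrite /nrm2 trmx_mul mulmxA -(mulmxA x^T) PP mulmx1 //.
Qed.

(** The order relations lo I <= S <= hi I for a symmetric [S]. Unlike [eig_between], this form
    passes at once to sums, principal blocks and perturbations. *)
Definition qbnd n (S : 'M[R]_n) (lo hi : R) : Prop :=
  S^T = S /\ forall x : 'cV[R]_n, lo * nrm2 x <= qform S x <= hi * nrm2 x.

Lemma spectral_eigenvector n (S P : 'M[R]_n) (d : 'rV[R]_n) i :
  P *m P^T = 1%:M -> S = P^T *m diag_mx d *m P ->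
  nrm2 (row i P)^T = 1 /\ row i P *m S = d 0 i *: row i P.
Proof.
move=> PP SE; split.
  rewrite /nrm2 trmxK rowE trmx_mul mulmxA -(mulmxA _ P) PP mulmx1.
  by rewrite trmx_delta mul_delta_mx mxE !eqxx.
rewrite SE -row_mul !mulmxA PP mul1mx row_mul row_diag_mx.
by rewrite -scalemxAl -rowE.
Qed.

Lemma qform_spectral n (S P : 'M[R]_n) (d : 'rV[R]_n) i :
  P *m P^T = 1%:M -> S = P^T *m diag_mx d *m P -> qform S (row i P)^T = d 0 i.
Proof.
move=> PP SE; have [n1 E] := spectral_eigenvector i PP SE.
have nE : (row i P *m (row i P)^T) 0 0 = nrm2 (row i P)^T by rewrite /nrm2 trmxK.
by rewrite /qform trmxK E -scalemxAl mxE nE n1 mulr1.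
Qed.

Lemma qbnd_spectral n (P : 'M[R]_n) (d : 'rV[R]_n) lo hi :
  P *m P^T = 1%:M -> qbnd (P^T *m diag_mx d *m P) lo hi <-> forall i, lo <= d 0 i <= hi.
Proof.
move=> PP; split=> [[_ Sb] i|db].
  have [n1 _] := spectral_eigenvector i PP (erefl (P^T *m diag_mx d *m P)).
  by have := Sb (row i P)^T; rewrite (qform_spectral i PP (erefl (P^T *m diag_mx d *m P))) n1 !mulr1.
split; first by rewrite !trmx_mul trmxK tr_diag_mx mulmxA.
move=> x; rewrite qform_congr -(nrm2_orth x PP) qform_diag nrm2E !mulr_sumr.
apply/andP; split; apply: ler_sum => i _; apply: ler_wpM2r; rewrite ?sqr_ge0//;
  by have /andP[] := db i.
Qed.

Lemma eig_between_qbnd n (S : 'M[R]_n) lo hi :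
  S^T = S -> eig_between S lo hi -> qbnd S lo hi.
Proof.
move=> Ssym Se; have [P [d [PP SE]]] := sym_spectral Ssym.
rewrite SE; apply/qbnd_spectral => // i; apply: Se; apply/eigenvalueP.
have [n1 E] := spectral_eigenvector i PP SE.
exists (row i P) => //; apply: contra_eq_neq n1 => ->.
by rewrite trmx0 /nrm2 mulmx0 mxE eq_sym oner_eq0.
Qed.

Lemma qbnd_eig_between n (S : 'M[R]_n) lo hi : qbnd S lo hi -> eig_between S lo hi.
Proof.
move=> [Ssym Sb] a /eigenvalueP[v vS v0].
have vn : 0 < nrm2 v^T by rewrite nrm2_gt0 -(inj_eq trmx_inj) trmxK trmx0.
have E : (v *m v^T) 0 0 = nrm2 v^T by rewrite /nrm2 trmxK.
by have := Sb v^T; rewrite /qform trmxK vS -scalemxAl mxE E !ler_pM2r.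
Qed.

Lemma qbnd_posdef n (S : 'M[R]_n) lo hi : 0 < lo -> qbnd S lo hi -> posdef S.
Proof.
move=> lo0 [Ssym Sb]; split=> // x x0.
have /andP[+ _] := Sb x; apply: lt_le_trans.
by rewrite mulr_gt0// nrm2_gt0.
Qed.

Lemma qbnd_sub n (S : 'M[R]_n) lo hi lo' hi' :
  lo' <= lo -> hi <= hi' -> qbnd S lo hi -> qbnd S lo' hi'.
Proof.
move=> l h [Ssym Sb]; split=> // x; have /andP[a b] := Sb x.
apply/andP; split.
  by apply: le_trans a; rewrite ler_wpM2r// nrm2_ge0.
by apply: le_trans b _; rewrite ler_wpM2r// nrm2_ge0.
Qed.

(* The symmetric square root: [V = S^(1/2)] and [W = S^(-1/2)]. *)
Lemma qbnd_sqrt n (S : 'M[R]_n) lo hi : 0 < lo -> qbnd S lo hi ->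
  exists V W : 'M[R]_n, [/\ V^T = V, W^T = W, V *m V = S, V *m W = 1%:M &
   (forall x, nrm2 (V *m x) <= hi * nrm2 x) /\ (forall x, nrm2 (W *m x) <= lo^-1 * nrm2 x)].
Proof.
move=> lo0 Sb; have [P [d [PP SE]]] := sym_spectral Sb.1.
have db := (qbnd_spectral d lo hi PP).1; rewrite -SE in db; have {}db := db Sb.
have d0 i : 0 < d 0 i by have /andP[+ _] := db i; exact: lt_le_trans.
have P1 := mulmx1C PP.
pose D (f : R -> R) : 'M[R]_n := P^T *m diag_mx (map_mx f d) *m P.
have DT f : (D f)^T = D f by rewrite /D !trmx_mul trmxK tr_diag_mx mulmxA.
have DD f g : D f *m D g = D (fun x => f x * g x).
  rewrite /D !mulmxA -(mulmxA _ P) PP mulmx1 -(mulmxA P^T) mulmx_diag.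
  by congr (_ *m diag_mx _ *m _); apply/rowP => i; rewrite !mxE.
have nD f c x : (forall i, f (d 0 i) ^+ 2 <= c) -> nrm2 (D f *m x) <= c * nrm2 x.
  move=> fc; rewrite -(nrm2_orth x PP) -(nrm2_orth _ PP) /D !mulmxA PP mul1mx.
  rewrite -mulmxA !nrm2E mulr_sumr; apply: ler_sum => i _.
  by rewrite mul_diag_mx mxE mxE exprMn ler_wpM2r ?sqr_ge0.
exists (D Num.sqrt), (D (fun x => (Num.sqrt x)^-1)); split => //.
- rewrite DD SE; congr (_ *m diag_mx _ *m _).
  by apply/rowP => i; rewrite mxE -expr2 sqr_sqrtr// ltW.
- rewrite DD /D (_ : map_mx _ _ = const_mx 1) ?diag_const_mx ?mulmx1//.
  by apply/rowP => i; rewrite !mxE mulfV// gt_eqF// sqrtr_gt0.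
- split=> x; apply: nD => i; have /andP[l h] := db i.
    by rewrite sqr_sqrtr// ltW.
  by rewrite exprVn (sqr_sqrtr (ltW (d0 i))) lef_pV2// posrE.
Qed.

Lemma qbnd_unit n (S : 'M[R]_n) lo hi : 0 < lo -> qbnd S lo hi -> S \in unitmx.
Proof.
move=> lo0 Sb; have [V [W [_ _ <- /mulmx1_unit[Vu _] _]]] := qbnd_sqrt lo0 Sb.
by rewrite unitmx_mul Vu.
Qed.

(** Here [invmx S = W^T *m W] with [W = S^(-1/2)]: one bound is the norm bound of [W], the other
    that of [V = S^(1/2)] applied to [W *m x]. *)
Lemma qbnd_inv n (S : 'M[R]_n) lo hi : 0 < lo -> 0 < hi -> qbnd S lo hi ->
  qbnd (invmx S) hi^-1 lo^-1.
Proof.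
move=> lo0 hi0 Sb; have Su := qbnd_unit lo0 Sb.
have [V [W [VT WT VV VW [nV nW]]]] := qbnd_sqrt lo0 Sb.
have WV := mulmx1C VW.
have iS : invmx S = W^T *m 1%:M *m W.
  rewrite mulmx1 WT; apply: (can_inj (mulKmx Su)); rewrite mulmxV// -VV.
  by rewrite mulmxA -(mulmxA V V) VW mulmx1 VW.
split; first by rewrite trmx_inv Sb.1.
move=> x; rewrite iS qform_congr qform1 nW andbT.
rewrite ler_pdivrMl//.
by have := nV (W *m x); rewrite mulmxA VW mul1mx.
Qed.

Lemma qbnd_det_gt0 n (S : 'M[R]_n) lo hi : 0 < lo -> qbnd S lo hi -> 0 < \det S.
Proof.
move=> lo0 Sb; have [V [W [_ _ <- /mulmx1_unit[Vu _] _]]] := qbnd_sqrt lo0 Sb.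
rewrite det_mulmx -expr2 exprn_even_gt0//=.
by rewrite -unitfE; move: Vu; rewrite unitmxE.
Qed.

Lemma frob2_tr n (A : 'M[R]_n) : frob2 A^T = frob2 A.
Proof.
rewrite /frob2 exchange_big; apply: eq_bigr => i _; apply: eq_bigr => j _.
by rewrite mxE.
Qed.

Lemma frob2N n (A : 'M[R]_n) : frob2 (- A) = frob2 A.
Proof. by apply: eq_bigr => i _; apply: eq_bigr => j _; rewrite mxE sqrrN. Qed.

Lemma frob2_col n (A : 'M[R]_n) : frob2 A = \sum_j nrm2 (col j A).
Proof.
rewrite /frob2 exchange_big; apply: eq_bigr => j _; rewrite nrm2E.
by apply: eq_bigr => i _; rewrite mxE.
Qed.

Lemma mulmx_col n (A B : 'M[R]_n) j : A *m col j B = col j (A *m B).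
Proof. by rewrite !colE mulmxA. Qed.

Lemma frob2_mull n (A B : 'M[R]_n) c :
  (forall x, nrm2 (A *m x) <= c * nrm2 x) -> frob2 (A *m B) <= c * frob2 B.
Proof.
move=> Ac; rewrite !frob2_col mulr_sumr; apply: ler_sum => j _.
by rewrite -mulmx_col.
Qed.

Lemma frob2_mulr n (A B : 'M[R]_n) c : A^T = A ->
  (forall x, nrm2 (A *m x) <= c * nrm2 x) -> frob2 (B *m A) <= c * frob2 B.
Proof.
move=> AT Ac; rewrite -[frob2 (B *m A)]frob2_tr -(frob2_tr B) trmx_mul AT.
exact: frob2_mull.
Qed.

Lemma frob2_orth n (P A : 'M[R]_n) : P *m P^T = 1%:M ->
  frob2 (P^T *m A *m P) = frob2 A.
Proof.
move=> PP; have P1 := mulmx1C PP.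
have E B : frob2 (P *m B) = frob2 B.
  by rewrite !frob2_col; apply: eq_bigr => j _; rewrite -mulmx_col nrm2_orth.
rewrite -(E (_ *m _)) !mulmxA PP mul1mx -frob2_tr trmx_mul -[RHS]frob2_tr.
rewrite !frob2_col; apply: eq_bigr => j _; rewrite -mulmx_col nrm2_orth ?trmxK//.
Qed.

Lemma frob2_diag n (d : 'rV[R]_n) : frob2 (diag_mx d) = \sum_i d 0 i ^+ 2.
Proof.
apply: eq_bigr => i _; rewrite (bigD1 i)//= big1 ?addr0.
  by rewrite mxE eqxx mulr1n.
by move=> j ji; rewrite mxE eq_sym (negPf ji) mulr0n expr0n.
Qed.

(* The congruence by [m^(-1/2)] turns the determinants into [prod (1 - d_i^2)], with [d_i] the eigenvalues of [m^(-1/2) H m^(-1/2)]. *)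
Lemma det_pencil n (m H : 'M[R]_n) lo hi : 0 < lo -> qbnd m lo hi -> H^T = H ->
  exists d : 'rV[R]_n,
  [/\ \det (m + H) * \det (m - H) = \det m ^+ 2 * \prod_i (1 - d 0 i ^+ 2),
      \sum_i d 0 i ^+ 2 <= lo^-1 ^+ 2 * frob2 H,
      frob2 H <= hi ^+ 2 * \sum_i d 0 i ^+ 2 &
      (forall x, 0 <= qform (m + H) x) -> (forall x, 0 <= qform (m - H) x) ->
      forall i, d 0 i ^+ 2 <= 1].
Proof.
move=> lo0 mb HT.
have [V [W [VT WT VV VW [nV nW]]]] := qbnd_sqrt lo0 mb.
have WV := mulmx1C VW.
pose B := W *m H *m W.
have BT : B^T = B by rewrite /B !trmx_mul WT HT mulmxA.
have HE : H = V *m B *m V.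
  by rewrite /B !mulmxA VW mul1mx -mulmxA WV mulmx1.
have [P [d [PP BE]]] := sym_spectral BT.
have P1 := mulmx1C PP.
have detP : \det P ^+ 2 = 1 by rewrite expr2 -[X in X * _]det_tr -det_mulmx P1 det1.
(* [m + e *: H] is congruent to the diagonal matrix with entries [1 + e * d_i]; the product of the
   two determinants uses [e = 1] and [e = -1]. *)
have det1 (e : R) : \det (m + e *: H) = \det m * \prod_i (1 + e * d 0 i).
  have -> : m + e *: H = V *m P^T *m diag_mx (const_mx 1 + e *: d) *m P *m V.
    rewrite linearD linearZ /= diag_const_mx mulmxDr mulmx1 mulmxDl mulmxDl.
    rewrite -[V *m P^T *m P]mulmxA P1 mulmx1 VV HE BE.
    by congr (_ + _); rewrite -!(scalemxAl, scalemxAr) !mulmxA.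
  rewrite !det_mulmx det_tr det_diag -VV det_mulmx.
  under eq_bigr => i _ do rewrite !mxE.
  rewrite -[RHS]mulr1 -detP; ring.
exists d; split.
- rewrite -[m - H]/(m + - H) -scaleN1r -{1}[H]scale1r !det1 mulrACA -expr2.
  congr (_ * _); rewrite -big_split /=; apply: eq_bigr => i _; ring.
- rewrite -frob2_diag -(frob2_orth (diag_mx d) PP) -BE /B expr2 -mulrA.
  apply: le_trans (frob2_mulr _ WT nW) _.
  by rewrite ler_wpM2l ?invr_ge0 ?(ltW lo0)// frob2_mull.
- rewrite -frob2_diag -(frob2_orth (diag_mx d) PP) -BE HE expr2 -mulrA.
  (* In dimension 0 nothing forces [hi] to be non-negative, so this case is separate. *)
  have [n0|n0] := leqP n 0.
    have z (A : 'M[R]_n) : frob2 A = 0.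
      by apply: big1 => i _; have := ltn_ord i; rewrite ltnNge (leq_trans n0).
    by rewrite !z !mulr0.
  have hi0 : 0 <= hi.
    have /andP[l h] := mb.2 (delta_mx (Ordinal n0) 0).
    have := le_trans l h; rewrite ler_pM2r; first exact/le_trans/ltW.
    rewrite nrm2_gt0; apply/eqP => /matrixP/(_ (Ordinal n0) 0)/eqP.
    by rewrite !mxE !eqxx oner_eq0.
  apply: le_trans (frob2_mulr _ VT nV) _.
  by rewrite ler_wpM2l// frob2_mull.
(* Evaluated at [W] times the i-th eigenvector, the two forms equal [1 + d_i] and [1 - d_i]; both
   are non-negative, hence [d_i ^+ 2 <= 1]. *)
- move=> q1 q2 i; have := q1 (W *m (row i P)^T); have := q2 (W *m (row i P)^T).
  rewrite -!qform_congr WT !(mulmxDl, mulmxDr) mulmxN mulNmx.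
  have -> : W *m m *m W = 1%:M by rewrite -VV !mulmxA WV mul1mx.
  rewrite qformB qformD qform1 -/B (qform_spectral i PP BE).
  have [-> _] := spectral_eigenvector i PP BE.
  move=> ? ?; nra.
Qed.

(** Each factor satisfies [1 - d^2 <= exp (- d^2)], and is non-negative because both forms [m + H]
    and [m - H] are. This is the source of the decay of the affinity. *)
Lemma det_pencil_le n (m H : 'M[R]_n) lo hi : 0 < lo -> 0 < hi -> qbnd m lo hi -> H^T = H ->
  (forall x, 0 <= qform (m + H) x) -> (forall x, 0 <= qform (m - H) x) ->
  \det (m + H) * \det (m - H) <= \det m ^+ 2 * expR (- (frob2 H / hi ^+ 2)).
Proof.
move=> lo0 hi0 mb HT q1 q2; have [d [-> _ dH /(_ q1 q2) d1]] := det_pencil lo0 mb HT.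
apply: ler_wpM2l; first exact: sqr_ge0.
apply: (@le_trans _ _ (expR (- \sum_i d 0 i ^+ 2))); last first.
  by rewrite ler_expR lerN2 ler_pdivrMr ?exprn_gt0// mulrC.
rewrite -sumrN expR_sum; apply: ler_prod => i _.
rewrite subr_ge0 d1 /=.
exact: expR_ge1Dx.
Qed.

(** Reverse bound, from [1 - y >= exp (- 2 y)] on [0 <= y <= 1/2]; the smallness of [H] keeps every
    [d_i ^+ 2] in that range. It controls the chi-square integral. *)
Lemma det_pencil_ge n (m H : 'M[R]_n) lo hi : 0 < lo -> qbnd m lo hi -> H^T = H ->
  frob2 H <= lo ^+ 2 / 2 ->
  \det m ^+ 2 * expR (- (2 * (frob2 H / lo ^+ 2))) <= \det (m + H) * \det (m - H).
Proof.
move=> lo0 mb HT Hs; have [d [-> dH _ _]] := det_pencil lo0 mb HT.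
have sd : \sum_i d 0 i ^+ 2 <= frob2 H / lo ^+ 2 by rewrite mulrC -exprVn.
apply: ler_wpM2l; first exact: sqr_ge0.
apply: (@le_trans _ _ (expR (- (2 * \sum_i d 0 i ^+ 2)))).
  by rewrite ler_expR lerN2 ler_pM2l.
rewrite mulr_sumr -sumrN expR_sum; apply: ler_prod => i _.
rewrite expR_ge0 /=.
have di : d 0 i ^+ 2 <= 2^-1.
  apply: le_trans (_ : \sum_j d 0 j ^+ 2 <= _).
    by rewrite (bigD1 i)//= lerDl sumr_ge0// => j _; exact: sqr_ge0.
  by apply: le_trans sd _; rewrite ler_pdivrMr ?exprn_gt0// mulrC.
have d0 := sqr_ge0 (d 0 i).
set y := d 0 i ^+ 2 in di d0 *.
(* It remains that [(1 - y) (1 + 2 y) >= 1] for [0 <= y <= 1/2]. *)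
have e1 : 1 + 2 * y <= expR (2 * y) by exact: expR_ge1Dx.
rewrite expRN -[leLHS]mul1r ler_pdivrMr ?expR_gt0//.
nra.
Qed.

End QuadraticForms.

Local Open Scope classical_set_scope.
Local Open Scope ring_scope.

(** * Iterated Lebesgue integrals *)

Section IteratedIntegral.
Variable R : realType.
Implicit Types (d : nat).
Let mu := @lebesgue_measure R.

(** The integral of a non-negative function is a supremum over the simple functions below it, so
    comparison requires no measurability. The indicators of [U(tau)], of the far set and of the
    posterior event are handled through this alone. *)
Lemma ge0_le_integralT (f g : R -> \bar R) :
  (forall x, 0 <= f x)%E -> (forall x, f x <= g x)%E ->
  (\int[mu]_x f x <= \int[mu]_x g x)%E.
Proof.
move=> f0 fg; have g0 x : (0 <= g x)%E by exact: le_trans (f0 x) (fg x).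
rewrite !ge0_integralTE//; apply: ereal_sup_le => _ [h hf <-].
by exists h => // x; apply: le_trans (hf x) (fg x).
Qed.

(* No sigma-algebra is put on [nat -> R]: a function on it is called measurable when
   it is so along every family of sequences with measurable coordinates. *)
Definition cylm disp (T : measurableType disp) (F : T -> nat -> R) :=
  forall i, measurable_fun setT (fun t => F t i).

Definition jmeas disp (T : measurableType disp) (f : T -> (nat -> R) -> \bar R) :=
  forall disp' (T' : measurableType disp') (g : T' -> T) (F : T' -> nat -> R),
    measurable_fun setT g -> cylm F -> measurable_fun setT (fun t => f (g t) (F t)).

Definition cmeas (f : (nat -> R) -> \bar R) :=
  forall disp (T : measurableType disp) (F : T -> nat -> R),
    cylm F -> measurable_fun setT (fun t => f (F t)).

Definition cmeas2 (f : (nat -> R) -> (nat -> R) -> \bar R) :=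
  forall disp (T : measurableType disp) (F G : T -> nat -> R),
    cylm F -> cylm G -> measurable_fun setT (fun t => f (F t) (G t)).

Lemma cylm_vcons disp (T : measurableType disp) (g : T -> R) (F : T -> nat -> R) :
  measurable_fun setT g -> cylm F -> cylm (fun t => vcons (g t) (F t)).
Proof. by move=> mg mF [|i] /=. Qed.

Lemma cylm_cst disp (T : measurableType disp) v : cylm (fun _ : T => v).
Proof. by move=> i; exact: measurable_cst. Qed.

Lemma cmeas2l f v : cmeas2 f -> cmeas (f v).
Proof. by move=> mf disp T F mF; apply: mf => //; exact: cylm_cst. Qed.

Lemma cmeas2r f v : cmeas2 f -> cmeas (f^~ v).
Proof. by move=> mf disp T F mF; apply: mf => //; exact: cylm_cst. Qed.

Lemma cmeas2C f : cmeas2 f -> cmeas2 (fun u v => f v u).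
Proof. by move=> mf disp T F G mF mG; exact: mf. Qed.

Lemma cmeas_vcons f : cmeas f -> jmeas (fun (x : R) v => f (vcons x v)).
Proof. by move=> mf disp T g F mg mF; apply: mf; exact: cylm_vcons. Qed.

Lemma cmeasM f g : cmeas f -> cmeas g -> cmeas (fun v => f v * g v)%E.
Proof. by move=> mf mg disp T F mF; apply: emeasurable_funM; [exact: mf|exact: mg]. Qed.

Lemma cmeas2M f g : cmeas2 f -> cmeas2 g -> cmeas2 (fun u v => f u v * g u v)%E.
Proof.
by move=> mf mg disp T F G mF mG; apply: emeasurable_funM; [exact: mf|exact: mg].
Qed.

Lemma cmeas_cst (k : \bar R) : cmeas (fun=> k).
Proof. by move=> disp T F mF; exact: measurable_cst. Qed.

Lemma cmeas_r f : cmeas f -> cmeas2 (fun _ v => f v).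
Proof. by move=> mf disp T F G _ mG; exact: mf. Qed.

Lemma cmeas_prod (I : Type) (s : seq I) (f : I -> (nat -> R) -> \bar R) :
  (forall i, cmeas (f i)) -> cmeas (fun v => \prod_(i <- s) f i v)%E.
Proof.
move=> mf disp T F mF; elim: s => [|i s IH].
  by under eq_fun do rewrite big_nil; exact: measurable_cst.
under eq_fun do rewrite big_cons; apply: emeasurable_funM => //; exact: mf.
Qed.

Lemma cmeas_coord (i : nat) (f : R -> \bar R) :
  measurable_fun setT f -> cmeas (fun v => f (v i)).
Proof. by move=> mf disp T F mF; exact: measurableT_comp. Qed.

Lemma eq_intRn d (f g : (nat -> R) -> \bar R) : f =1 g -> intRn d f = intRn d g.
Proof. by move=> /funext ->. Qed.

Lemma intRn_ge0 d (f : (nat -> R) -> \bar R) :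
  (forall v, 0 <= f v)%E -> (0 <= intRn d f)%E.
Proof.
elim: d f => [|d IH] f f0 /=; first exact: f0.
by apply: integral_ge0 => x _; apply: IH.
Qed.

Lemma le_intRn d (f g : (nat -> R) -> \bar R) :
  (forall v, 0 <= f v)%E -> (forall v, f v <= g v)%E -> (intRn d f <= intRn d g)%E.
Proof.
elim: d f g => [|d IH] f g f0 fg /=; first exact: fg.
apply: ge0_le_integralT => x; first exact: intRn_ge0.
exact: IH.
Qed.

(** Induction on [d], one Tonelli step on [T * R] at a time. Since [jmeas] quantifies over all
    parameter spaces, the new variable can be absorbed into the parameter. *)
Lemma measurable_intRn d disp (T : measurableType disp) (f : T -> (nat -> R) -> \bar R) :
  (forall t v, 0 <= f t v)%E -> jmeas f -> measurable_fun setT (fun t => intRn d (f t)).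
Proof.
elim: d disp T f => [|d IH] disp T f f0 mf /=.
  by apply: mf => //; exact: cylm_cst.
pose f' (z : T * R) v := f z.1 (vcons z.2 v).
apply: (@measurable_fun_fubini_tonelli_F _ _ _ _ R mu (fun z => intRn d (f' z))).
  apply: IH => [t v|disp' T' g F mg mF]; first exact: f0.
  apply: mf; first exact: measurableT_comp.
  by apply: cylm_vcons => //; exact: measurableT_comp.
by move=> z; apply: intRn_ge0 => v; exact: f0.
Qed.

Lemma cmeas_intRn d f :
  (forall u v, 0 <= f u v)%E -> cmeas2 f -> cmeas (fun u => intRn d (f u)).
Proof.
move=> f0 mf disp T F mF; apply: measurable_intRn => //.
move=> disp' T' g G mg mG; apply: mf => // i; exact: measurableT_comp (mF i) mg.
Qed.

Lemma measurable_intRn_vcons d f : (forall v, 0 <= f v)%E -> cmeas f ->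
  measurable_fun setT (fun x => intRn d (fun v => f (vcons x v))).
Proof. by move=> f0 mf; apply: measurable_intRn => //; exact: cmeas_vcons. Qed.

Lemma cmeas_jmeas f x : cmeas f -> cmeas (fun v => f (vcons x v)).
Proof. by move=> mf disp T F mF; apply: mf; exact: cylm_vcons. Qed.

Lemma intRnD d f g : (forall v, 0 <= f v)%E -> (forall v, 0 <= g v)%E ->
  cmeas f -> cmeas g ->
  intRn d (fun v => f v + g v)%E = (intRn d f + intRn d g)%E.
Proof.
elim: d f g => [|d IH] f g f0 g0 mf mg //=.
under eq_integral => x _.
  rewrite (IH _ _ _ _ (cmeas_jmeas x mf) (cmeas_jmeas x mg))//.
  over.
by rewrite ge0_integralD//; try (by move=> x _; exact: intRn_ge0);
  exact: measurable_intRn_vcons.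
Qed.

Lemma intRnZ d (k : \bar R) f : (0 <= k)%E -> (forall v, 0 <= f v)%E -> cmeas f ->
  intRn d (fun v => k * f v)%E = (k * intRn d f)%E.
Proof.
elim: d f => [|d IH] f k0 f0 mf //=.
under eq_integral => x _.
  rewrite (IH _ k0 _ (cmeas_jmeas x mf))//.
  over.
by rewrite ge0_integralZl//; try (by move=> x _; exact: intRn_ge0);
  exact: measurable_intRn_vcons.
Qed.

Lemma intRn0 d : intRn d (fun _ : nat -> R => 0%E) = 0%E.
Proof. by elim: d => [//|d IH] /=; under eq_integral do rewrite IH; exact: integral0. Qed.

Lemma cmeas_sum (I : Type) (s : seq I) (f : I -> (nat -> R) -> \bar R) :
  (forall i, cmeas (f i)) -> cmeas (fun v => \sum_(i <- s) f i v)%E.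
Proof. by move=> mf disp T F mF; apply: emeasurable_sum => i; exact: mf. Qed.

Lemma intRn_sum d (I : Type) (s : seq I) (f : I -> (nat -> R) -> \bar R) :
  (forall i v, 0 <= f i v)%E -> (forall i, cmeas (f i)) ->
  intRn d (fun v => \sum_(i <- s) f i v)%E = (\sum_(i <- s) intRn d (f i))%E.
Proof.
move=> f0 mf; elim: s => [|i s IH].
  by rewrite big_nil -[RHS](intRn0 d); apply: eq_intRn => v; rewrite big_nil.
rewrite big_cons -IH -intRnD//.
- by apply: eq_intRn => v; rewrite big_cons.
- by move=> v; exact: sume_ge0.
- exact: cmeas_sum.
Qed.

Lemma intRn_integral d (f : R -> (nat -> R) -> \bar R) :
  (forall x v, 0 <= f x v)%E -> jmeas f ->
  intRn d (fun v => \int[mu]_x f x v)%E = (\int[mu]_x intRn d (f x))%E.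
Proof.
elim: d f => [//|d IH] f f0 mf /=.
under eq_integral => x _.
  rewrite IH//.
    over.
  move=> disp T g F mg mF; apply: mf => //; exact: cylm_vcons.
apply: (@fubini_tonelli _ _ _ _ R mu mu
   (fun z => intRn d (fun v => f z.2 (vcons z.1 v)))).
  apply: measurable_intRn => // disp T g F mg mF.
  by apply: mf; [exact: measurableT_comp|apply: cylm_vcons=> //; exact: measurableT_comp].
by move=> z; apply: intRn_ge0.
Qed.

(** Tonelli for parameter against data: the terms bounding the posterior are integrals over the
    parameter, and their expectation is computed by integrating over the data first. *)
Lemma intRn_swap d e f : (forall u v, 0 <= f u v)%E -> cmeas2 f ->
  intRn d (fun u => intRn e (f u)) = intRn e (fun v => intRn d (f^~ v)).
Proof.
elim: d f => [//|d IH] f f0 mf /=.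
under eq_integral => x _.
  rewrite IH//.
    over.
  by move=> disp T F G mF mG; apply: mf => //; exact: cylm_vcons.
rewrite -intRn_integral//; first by move=> x v; exact: intRn_ge0.
move=> disp T g F mg mF; apply: measurable_intRn => //.
move=> disp' T' g' F' mg' mF'; apply: mf => [|i].
  by apply: cylm_vcons => //; exact: measurableT_comp mg mg'.
exact: measurableT_comp (mF i) mg'.
Qed.

(** Later it separates the first observation, [p] coordinates, from the rest of a sample. *)
Fixpoint vcat (d : nat) (u w : nat -> R) : nat -> R :=
  if d is d'.+1 then vcons (u 0%N) (vcat d' (fun i => u i.+1) w) else w.

Lemma vcatE d u w i : vcat d u w i = if (i < d)%N then u i else w (i - d)%N.
Proof.
elim: d u i => [|d IH] u i /=; first by rewrite subn0.
by case: i => [//|i] /=; rewrite IH ltnS subSS.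
Qed.

Lemma intRn_cat d e f :
  intRn (d + e) f = intRn d (fun u => intRn e (fun w => f (vcat d u w))).
Proof.
elim: d f => [//|d IH] f /=.
by apply: eq_integral => x _; rewrite IH.
Qed.

Lemma intRn_prod d (g : nat -> R -> \bar R) :
  (forall i x, 0 <= g i x)%E -> (forall i, measurable_fun setT (g i)) ->
  intRn d (fun v => \prod_(i < d) g i (v i))%E = (\prod_(i < d) \int[mu]_x g i x)%E.
Proof.
elim: d g => [|d IH] g g0 mg /=; first by rewrite !big_ord0.
rewrite [RHS]big_ord_recl -(IH (fun i => g i.+1))//.
have P0 v : (0 <= \prod_(i < d) g i.+1 (v i))%E by exact: prode_ge0.
have mP : cmeas (fun v => \prod_(i < d) g i.+1 (v i))%E.
  by apply: cmeas_prod => i; apply: (@cmeas_coord i (g i.+1)).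
transitivity (\int[mu]_x (g 0%N x * intRn d (fun v => \prod_(i < d) g i.+1 (v i))))%E.
  apply: eq_integral => x _; rewrite -intRnZ//.
  by apply: eq_intRn => v; rewrite big_ord_recl.
by rewrite ge0_integralZr//; [exact: mg|apply: intRn_ge0 => v; exact: P0].
Qed.

End IteratedIntegral.

(** * Gaussian integrals *)

Section MatrixMeasurability.
Variable R : realType.

(* [powR] sends [0] to [0], as does the inverse, so the identity holds at [0] too. *)
Lemma invr_powR (x : R) : x^-1 = x * (x ^+ 2) `^ (-1).
Proof.
rewrite powR_inv1 ?sqr_ge0//; have [->|x0] := eqVneq x 0; first by rewrite invr0 mul0r.
by field.
Qed.

(** [Num.sqrt] is 0 on negative numbers, hence the truncation; measurability of roots then comes
    from that of powers. *)
Lemma sqrtr_powR (x : R) : Num.sqrt x = (Num.max x 0) `^ 2^-1.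
Proof.
rewrite powR12_sqrt ?le_max ?lexx ?orbT//.
by have [x0|x0] := leP x 0; rewrite // ler0_sqrtr// sqrtr0.
Qed.

Section Param.
Context disp (T : measurableType disp).

Lemma measurable_funV (f : T -> R) :
  measurable_fun setT f -> measurable_fun setT (fun t => (f t)^-1).
Proof.
move=> mf; under eq_fun do rewrite invr_powR.
apply: measurable_funM => //.
by apply: (measurableT_comp (measurable_powR _)); exact: measurable_funX.
Qed.

Lemma measurable_funsqrt (f : T -> R) :
  measurable_fun setT f -> measurable_fun setT (fun t => Num.sqrt (f t)).
Proof.
move=> mf; under eq_fun do rewrite sqrtr_powR.
apply: (measurableT_comp (measurable_powR _)).
by apply: measurable_maxr => //; exact: measurable_cst.
Qed.

Definition mxmeas m n (M : T -> 'M[R]_(m, n)) :=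
  forall i j, measurable_fun setT (fun t => M t i j).

Lemma measurable_det n (M : T -> 'M[R]_n) :
  mxmeas M -> measurable_fun setT (fun t => \det (M t)).
Proof.
move=> mM; apply: measurable_sum => s; apply: measurable_funM.
  exact: measurable_cst.
by apply: measurable_prod => i _; exact: mM.
Qed.

Lemma mxmeas_inv n (M : T -> 'M[R]_n) : mxmeas M -> mxmeas (fun t => invmx (M t)).
Proof.
move=> mM i j.
(* [invmx] returns a singular matrix unchanged; elsewhere Cramer's formula expresses the entries
   through determinants. *)
rewrite (_ : (fun t => _) = (fun t => if \det (M t) == 0 then M t i j
   else (\det (M t))^-1 * cofactor (M t) j i)); last first.
  apply/funext => t; rewrite /invmx unitmxE unitfE.
  by case: eqP => //= _; rewrite !mxE.
apply: measurable_fun_ifT => //.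
  apply: measurable_fun_eqr; [exact: measurable_det|exact: measurable_cst].
apply: measurable_funM; first by apply: measurable_funV; exact: measurable_det.
apply: measurable_funM; first exact: measurable_cst.
apply: measurable_det => k l.
rewrite (_ : (fun t => _) = (fun t => M t (lift j k) (lift i l)))//.
by apply/funext => t; rewrite !mxE.
Qed.

Lemma measurable_qform n (M : T -> 'M[R]_n) (x : T -> 'cV[R]_n) :
  mxmeas M -> mxmeas x -> measurable_fun setT (fun t => qform (M t) (x t)).
Proof.
move=> mM mx; under eq_fun do rewrite qformE.
apply: measurable_sum => i; apply: measurable_sum => j.
by apply: measurable_funM => //; apply: measurable_funM.
Qed.

Lemma measurable_expRN2 (f : T -> R) : measurable_fun setT f ->
  measurable_fun setT (fun t => expR (- f t / 2)).
Proof.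
move=> mf; apply: measurableT_comp => //.
apply: measurable_funM; [exact: measurableT_comp|exact: measurable_cst].
Qed.

Lemma measurable_mvnpdf n (M : T -> 'M[R]_n) (x : T -> 'cV[R]_n) :
  mxmeas M -> mxmeas x -> measurable_fun setT (fun t => mvnpdf (M t) (x t)).
Proof.
move=> mM mx; apply: measurable_funM.
  apply: measurable_expRN2; apply: measurable_qform => //; exact: mxmeas_inv.
apply: measurable_funV; apply: measurable_funsqrt.
by apply: measurable_funM; [exact: measurable_cst|exact: measurable_det].
Qed.

Lemma measurable_lik N n (M : T -> 'M[R]_n) (X : T -> 'I_N -> 'cV[R]_n) :
  mxmeas M -> (forall i, mxmeas (X^~ i)) -> measurable_fun setT (fun t => lik (M t) (X t)).
Proof.
move=> mM mX; apply: measurable_prod => i _; apply: measurable_mvnpdf => //; exact: mX.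
Qed.

End Param.

Definition colv p (v : nat -> R) : 'cV[R]_p := \col_i v i.

Lemma mxmeas_colv disp (T : measurableType disp) p (F : T -> nat -> R) :
  cylm F -> mxmeas (fun t => colv p (F t)).
Proof.
move=> mF i j; rewrite (_ : (fun t => _) = (fun t => F t i))//.
by apply/funext => t; rewrite mxE.
Qed.

Lemma mxmeas_mxsym disp (T : measurableType disp) p (F : T -> nat -> R) :
  cylm F -> mxmeas (fun t => mxsym p (F t)).
Proof.
move=> mF i j; rewrite (_ : (fun t => _) = (fun t => F t (symidx (minn i j) (maxn i j))))//.
by apply/funext => t; rewrite mxE.
Qed.

Lemma mxmeas_dataof disp (T : measurableType disp) N p (F : T -> nat -> R) i :
  cylm F -> mxmeas (fun t => dataof N p (F t) i).
Proof.
move=> mF j k; rewrite (_ : (fun t => _) = (fun t => F t (i * p + j)%N))//.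
by apply/funext => t; rewrite mxE.
Qed.

Lemma mxmeas_cst disp (T : measurableType disp) m n (M : 'M[R]_(m, n)) :
  mxmeas (fun _ : T => M).
Proof. by move=> i j; exact: measurable_cst. Qed.

End MatrixMeasurability.

(** * Gaussian integrals in any dimension *)

Section Gaussian.
Variable R : realType.
Let mu := @lebesgue_measure R.

Lemma integral_gauss1 (s u : R) : 0 < s ->
  (\int[mu]_x (expR (- (s * (x + u) ^+ 2) / 2))%:E)%E = (Num.sqrt (2 * pi / s))%:E.
Proof.
move=> s0.
have n0 : (Num.sqrt s)^-1 != 0 by rewrite invr_eq0 gt_eqF// sqrtr_gt0.
have := integral_normal_pdf (- u) (Num.sqrt s)^-1.
have s2 : (Num.sqrt s)^-1 ^+ 2 = s^-1 by rewrite exprVn sqr_sqrtr// ltW.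
under eq_integral => x _.
  rewrite normal_pdfE// /normal_peak /normal_fun s2 opprK.
  rewrite (_ : - (x + u) ^+ 2 / (s^-1 *+ 2) = - (s * (x + u) ^+ 2) / 2); last first.
    rewrite -mulr_natr; field; exact: lt0r_neq0.
  rewrite EFinM.
  over.
rewrite ge0_integralZl//; last first.
  apply/measurable_EFinP; apply: measurable_expRN2.
  apply: measurable_funM; first exact: measurable_cst.
  apply: measurable_funX; apply: measurable_funD => //.
set I := (\int[mu]_x _)%E => H.
have -> : 2 * pi / s = s^-1 * pi *+ 2 by rewrite -mulr_natr; ring.
set q := Num.sqrt _ in H *.
have q0 : 0 < q by rewrite sqrtr_gt0 pmulrn_lgt0// mulr_gt0 ?invr_gt0// pi_gt0.
transitivity (q%:E * (q^-1%:E * I))%E.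
  by rewrite muleA -EFinM mulfV ?gt_eqF// mul1e.
by rewrite H mule1.
Qed.

(* Completing the square in the last [p] coordinates; [a - b^T D^-1 b] is the Schur complement. *)
Lemma qform_block p (a c : R) (b y : 'cV[R]_p) (D : 'M[R]_p) :
  D^T = D -> D \in unitmx ->
  qform (block_mx a%:M b^T b D) (col_mx c%:M y) =
  (a - qform (invmx D) b) * c ^+ 2 + qform D (y + c *: (invmx D *m b)).
Proof.
move=> DT Du; have iT : (invmx D)^T = invmx D by rewrite trmx_inv DT.
rewrite /qform tr_col_mx mul_row_block mul_row_col tr_scalar_mx.
rewrite [(y + _)^T]linearD /= [(c *: _)^T]linearZ /= trmx_mul iT.
rewrite !(mulmxDl, mulmxDr) -!(scalemxAl, scalemxAr) !mulmxA.
rewrite -(mulmxA _ (invmx D) D) mulVmx// mulmx1 -(mulmxA _ D (invmx D)) mulmxV// mulmx1.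
rewrite !mul_scalar_mx !mul_mx_scalar -!(scalemxAl, scalemxAr).
have -> : y^T *m b = b^T *m y.
  by apply/matrixP => i j; rewrite !ord1 -[in LHS](trmxK b) -trmx_mul mxE.
move: (b^T *m y) (b^T *m invmx D *m b) (y^T *m D *m y) => q1 q2 q3.
by rewrite !mxE eqxx mulr1n; ring.
Qed.

Lemma det_schur p (a : R) (b : 'cV[R]_p) (D : 'M[R]_p) :
  D^T = D -> D \in unitmx ->
  \det (block_mx a%:M b^T b D) = (a - qform (invmx D) b) * \det D.
Proof.
move=> DT Du; have iT : (invmx D)^T = invmx D by rewrite trmx_inv DT.
have -> : block_mx a%:M b^T b D =
   block_mx 1%:M (b^T *m invmx D) 0 1%:M *m block_mx (a - qform (invmx D) b)%:M 0 b D.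
  rewrite mulmx_block !mul1mx !mul0mx !add0r -(mulmxA b^T _ D) mulVmx// mulmx1.
  congr block_mx; rewrite [X in _ + X]mx11_scalar -/(qform _ _) -raddfD /=.
  by rewrite subrK.
by rewrite det_mulmx det_ublock !det1 !mul1r det_lblock det_scalar1.
Qed.

(** Induction on the dimension: the inner integral runs over the last [p] coordinates, around a
    centre that depends on the first one. The arbitrary shift [u] lets the induction hypothesis
    apply there, with a value free of [x]; the Schur complement [s] is the precision left for the
    first coordinate. *)
Lemma intRn_gauss p (A : 'M[R]_p) lo hi (u : 'cV[R]_p) : 0 < lo -> qbnd A lo hi ->
  intRn p (fun v => (expR (- qform A (colv p v + u) / 2))%:E) =
  (Num.sqrt ((2 * pi) ^+ p / \det A))%:E.
Proof.
move=> lo0; elim: p A u => [|p IH] A u Ab.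
  by rewrite /= qformE big_ord0 oppr0 mul0r expR0 det_mx00 expr0 divr1 sqrtr1.
rewrite [in LHS]/intRn -/intRn.
pose A1 : 'M[R]_(1 + p) := A.
pose a := A1 0 0; pose b := dlsubmx A1; pose D := drsubmx A1.
have A1T : A1^T = A1 by exact: Ab.1.
have A1b (x : 'cV[R]_(1 + p)) : lo * nrm2 x <= qform A1 x <= hi * nrm2 x by exact: Ab.2.
have AE : A1 = block_mx a%:M b^T b D.
  rewrite -[LHS]submxK; congr block_mx.
    rewrite [LHS]mx11_scalar; congr (_%:M); rewrite !mxE; congr (A1 _ _); exact/val_inj.
  by rewrite /b trmx_dlsub A1T.
have DT : D^T = D by rewrite /D trmx_drsub A1T.
have Db : qbnd D lo hi.
  split=> // x; have := A1b (col_mx 0 x); rewrite AE.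
  rewrite /qform /nrm2 tr_col_mx mul_row_block !mul_row_col.
  by rewrite trmx0 !mul0mx !add0r mulmx0 add0r.
have Du := qbnd_unit lo0 Db.
set s := a - qform (invmx D) b.
(* [s] is the value of the form at the vector [(1, - D^-1 b)], hence positive. *)
have s0 : 0 < s.
  have := A1b (col_mx 1%:M (- (invmx D *m b))); rewrite AE.
  rewrite qform_block// scale1r addNr expr1n mulr1 -/s.
  have -> : qform D 0 = 0 by rewrite /qform mulmx0 mxE.
  rewrite addr0 => /andP[+ _]; apply: lt_le_trans.
  rewrite mulr_gt0// nrm2_gt0; apply/eqP => /matrixP/(_ (lshift p 0) 0).
  by rewrite col_mxEu !mxE => /eqP; rewrite oner_eq0.
pose u1 : 'cV[R]_(1 + p) := u.
pose u0 := u1 (lshift p 0) 0; pose w := dsubmx u1.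
have uE : u1 = col_mx u0%:M w.
  by rewrite -[LHS]vsubmxK; congr col_mx; rewrite [LHS]mx11_scalar !mxE.
have E x v : qform A (colv p.+1 (vcons x v) + u) =
   s * (x + u0) ^+ 2 + qform D (colv p v + (w + (x + u0) *: (invmx D *m b))).
  rewrite -[qform A _]/(qform A1 (colv (1 + p) (vcons x v) + u1)) AE.
  rewrite (_ : _ + u1 = col_mx (x + u0)%:M (colv p v + w)).
    by rewrite qform_block// addrA.
  rewrite uE (_ : colv (1 + p) _ = col_mx x%:M (colv p v)).
    by rewrite add_col_mx -raddfD.
  apply/matrixP => i j; rewrite mxE ord1; case: (splitP i) => k ik.
    have -> : i = lshift p k by exact/val_inj.
    by rewrite col_mxEu !ord1 [RHS]mxE eqxx.
  have -> : i = rshift 1 k by exact/val_inj.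
  by rewrite col_mxEd mxE.
have dD := qbnd_det_gt0 lo0 Db.
transitivity (\int[mu]_x ((expR (- (s * (x + u0) ^+ 2) / 2))%:E *
     (Num.sqrt ((2 * pi) ^+ p / \det D))%:E))%E.
  apply: eq_integral => x _.
  rewrite -(IH D (w + (x + u0) *: (invmx D *m b)) Db) -intRnZ ?lee_fin ?expR_ge0//.
  - apply: eq_intRn => v; rewrite E -EFinM -expRD; congr (expR _)%:E; ring.
  - move=> disp T F mF; apply/measurable_EFinP; apply: measurable_expRN2.
    apply: measurable_qform; first exact: mxmeas_cst.
    move=> i j; rewrite (_ : (fun t => _) = (fun t => F t i +
       (w + (x + u0) *: (invmx D *m b)) i j)); last first.
      by apply/funext => t; rewrite [LHS]mxE mxE.
    by apply: measurable_funD => //; exact: measurable_cst.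
rewrite ge0_integralZr//; last first.
  apply/measurable_EFinP; apply: measurable_expRN2.
  apply: measurable_funM; first exact: measurable_cst.
  apply: measurable_funX; apply: measurable_funD => //.
rewrite integral_gauss1// -EFinM -sqrtrM; last first.
  by rewrite divr_ge0 ?mulr_ge0 ?pi_ge0 ?ltW.
rewrite -[\det A]/(\det A1) AE det_schur// -/s exprS.
by congr (Num.sqrt _)%:E; field; rewrite !gt_eqF.
Qed.

End Gaussian.

(** * Hellinger affinity and chi-square integral of two centred normal laws *)

Section Affinity.
Variable R : realType.

Lemma nrm2_mul_qbnd n (S : 'M[R]_n) lo hi x : 0 < lo -> 0 <= hi -> qbnd S lo hi ->
  nrm2 (S *m x) <= hi ^+ 2 * nrm2 x.
Proof.
move=> lo0 hi0 Sb; have [V [_ [_ _ VV _ [nV _]]]] := qbnd_sqrt lo0 Sb.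
rewrite -VV -mulmxA (le_trans (nV _))// expr2 -mulrA ler_wpM2l//.
Qed.

Lemma qbnd_frob n (H : 'M[R]_n) c : 0 <= c -> H^T = H -> frob2 H <= c ^+ 2 -> qbnd H (- c) c.
Proof.
move=> c0 HT Hc; have [P [d [PP HE]]] := sym_spectral HT.
rewrite HE; apply/qbnd_spectral => // i.
have di : d 0 i ^+ 2 <= c ^+ 2.
  apply: le_trans Hc; rewrite HE frob2_orth// frob2_diag (bigD1 i)//= lerDl.
  by apply: sumr_ge0 => j _; exact: sqr_ge0.
by rewrite -ler_norml -(ger0_norm c0) -ler_sqr ?nnegrE// !real_normK ?num_real.
Qed.

Lemma qbndD n (S T : 'M[R]_n) lo hi lo' hi' :
  qbnd S lo hi -> qbnd T lo' hi' -> qbnd (S + T) (lo + lo') (hi + hi').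
Proof.
move=> [ST Sb] [TT Tb]; split=> [|x]; first by rewrite linearD /= ST TT.
rewrite qformD !mulrDl; have /andP[a b] := Sb x; have /andP[a' b'] := Tb x.
by rewrite !lerD.
Qed.

Lemma qbndZ n (S : 'M[R]_n) c lo hi : 0 <= c ->
  qbnd S lo hi -> qbnd (c *: S) (c * lo) (c * hi).
Proof.
move=> c0 [ST Sb]; split=> [|x]; first by rewrite linearZ /= ST.
rewrite qformZ -!mulrA; have /andP[a b] := Sb x.
by rewrite !ler_wpM2l.
Qed.

Lemma qbndN n (S : 'M[R]_n) lo hi : qbnd S lo hi -> qbnd (- S) (- hi) (- lo).
Proof.
move=> [ST Sb]; split=> [|x]; first by rewrite linearN /= ST.
by rewrite qformN !mulNr !lerN2 andbC; exact: Sb.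
Qed.

Lemma invmxB n (S1 S2 : 'M[R]_n) : S1 \in unitmx -> S2 \in unitmx ->
  invmx S1 - invmx S2 = invmx S1 *m (S2 - S1) *m invmx S2.
Proof.
move=> u1 u2; rewrite mulmxBr mulmxBl mulVmx// mul1mx -mulmxA mulmxV// mulmx1 //.
Qed.

(** By [invmxB] the difference of inverses is [S2 - S1] between two inverses of operator norm at
    most [T]. *)
Lemma frob2_invB n (S1 S2 : 'M[R]_n) T : 1 <= T -> qbnd S1 T^-1 T -> qbnd S2 T^-1 T ->
  frob2 (invmx S1 - invmx S2) <= T ^+ 4 * frob2 (S1 - S2).
Proof.
move=> T1 b1 b2; have T0 : 0 < T by lra.
have iT : 0 < T^-1 by rewrite invr_gt0.
have i1 := qbnd_inv iT T0 b1; have i2 := qbnd_inv iT T0 b2; rewrite invrK in i1 i2.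
have u1 := qbnd_unit iT b1; have u2 := qbnd_unit iT b2.
rewrite invmxB// -(frob2N (S1 - S2)) opprB.
have n2 x := nrm2_mul_qbnd x iT (ltW T0) i2.
have n1 x := nrm2_mul_qbnd x iT (ltW T0) i1.
apply: le_trans (frob2_mulr _ i2.1 n2) _.
rewrite (_ : T ^+ 4 = T ^+ 2 * T ^+ 2); last by rewrite -exprD.
by rewrite -mulrA ler_wpM2l ?sqr_ge0// frob2_mull.
Qed.

Lemma frob2_invB_ge n (S1 S2 : 'M[R]_n) T : 1 <= T -> qbnd S1 T^-1 T -> qbnd S2 T^-1 T ->
  frob2 (S1 - S2) <= T ^+ 4 * frob2 (invmx S1 - invmx S2).
Proof.
move=> T1 b1 b2; have T0 : 0 < T by lra.
have iT : 0 < T^-1 by rewrite invr_gt0.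
have i1 := qbnd_inv iT T0 b1; have i2 := qbnd_inv iT T0 b2; rewrite invrK in i1 i2.
by have := frob2_invB T1 i1 i2; rewrite !invmxK.
Qed.

Definition mvncst p (S : 'M[R]_p) : R := Num.sqrt ((2 * pi) ^+ p * \det S).

Lemma mvnpdfE p (S : 'M[R]_p) x : mvnpdf S x = expR (- qform (invmx S) x / 2) / mvncst S.
Proof. by []. Qed.

Lemma twopi_gt0 p : 0 < (2 * pi) ^+ p :> R.
Proof. by rewrite exprn_gt0// mulr_gt0// pi_gt0. Qed.

Lemma mvncst_gt0 p (S : 'M[R]_p) lo hi : 0 < lo -> qbnd S lo hi -> 0 < mvncst S.
Proof. by move=> lo0 b; rewrite sqrtr_gt0 mulr_gt0 ?twopi_gt0 ?(qbnd_det_gt0 lo0 b). Qed.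

Lemma mvncst_sqr p (S : 'M[R]_p) lo hi : 0 < lo -> qbnd S lo hi ->
  mvncst S ^+ 2 = (2 * pi) ^+ p * \det S.
Proof. by move=> lo0 b; rewrite sqr_sqrtr// ltW// mulr_gt0 ?twopi_gt0 ?(qbnd_det_gt0 lo0 b). Qed.

Lemma mvnpdf_gt0 p (S : 'M[R]_p) lo hi x : 0 < lo -> qbnd S lo hi -> 0 < mvnpdf S x.
Proof. by move=> lo0 b; rewrite divr_gt0 ?expR_gt0 ?(mvncst_gt0 lo0 b). Qed.

Lemma mvnpdf_ge0 p (S : 'M[R]_p) x : 0 <= mvnpdf S x.
Proof. by rewrite divr_ge0 ?expR_ge0 ?sqrtr_ge0. Qed.

Lemma intRn_gauss_scaled p (A : 'M[R]_p) lo hi k : 0 < lo -> 0 <= k -> qbnd A lo hi ->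
  intRn p (fun v => (k * expR (- qform A (colv p v) / 2))%:E) =
  (k * Num.sqrt ((2 * pi) ^+ p / \det A))%:E.
Proof.
move=> lo0 k0 b; rewrite EFinM -(intRn_gauss 0 lo0 b) -intRnZ ?lee_fin//.
- by apply: eq_intRn => v; rewrite addr0 EFinM.
- move=> disp T F mF; apply/measurable_EFinP; apply: measurable_expRN2.
  apply: measurable_qform; first exact: mxmeas_cst.
  by under eq_fun do rewrite addr0; exact: mxmeas_colv.
Qed.

Lemma expRsqrt (x : R) : Num.sqrt (expR x) = expR (x / 2).
Proof.
by rewrite [X in Num.sqrt (expR X)](splitr x) expRD -expr2 sqrtr_sqr ger0_norm ?expR_ge0.
Qed.

(** The integrand is, up to a constant, a centred Gaussian whose precision is the mean [m] of the
    two precisions, these being [m + H] and [m - H]. The fourth power of the integral is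
    [det O1 * det O2 / det m ^+ 2], which [det_pencil_le] bounds. *)
Theorem mvn_affinity p (S1 S2 : 'M[R]_p) T : 1 <= T -> qbnd S1 T^-1 T -> qbnd S2 T^-1 T ->
  (intRn p (fun v => (Num.sqrt (mvnpdf S1 (colv p v) * mvnpdf S2 (colv p v)))%:E)
   <= (expR (- (frob2 (S1 - S2) / (16 * T ^+ 6))))%:E)%E.
Proof.
move=> T1 b1 b2; have T0 : 0 < T by lra.
have iT : 0 < T^-1 by rewrite invr_gt0.
have i1 := qbnd_inv iT T0 b1; have i2 := qbnd_inv iT T0 b2; rewrite invrK in i1 i2.
set O1 := invmx S1 in i1; set O2 := invmx S2 in i2.
pose m := 2^-1 *: (O1 + O2); pose H := 2^-1 *: (O1 - O2).
have mH : m + H = O1.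
  by apply/matrixP => i j; rewrite !mxE; field.
have mH' : m - H = O2.
  by apply/matrixP => i j; rewrite !mxE; field.
have mb : qbnd m T^-1 T.
  apply: (@qbnd_sub _ _ _ (2^-1 * (T^-1 + T^-1)) (2^-1 * (T + T))); try lra.
  by apply: qbndZ; [lra|exact: qbndD].
have HT : H^T = H by rewrite /H linearZ /= linearB /= i1.1 i2.1.
set k := (Num.sqrt (mvncst S1 * mvncst S2))^-1.
have c1 := mvncst_gt0 iT b1; have c2 := mvncst_gt0 iT b2.
have k0 : 0 <= k by rewrite invr_ge0 sqrtr_ge0.
rewrite (_ : (fun v => _) = (fun v => (k * expR (- qform m (colv p v) / 2))%:E)); last first.
  apply/funext => v; rewrite !mvnpdfE mulf_div -expRD sqrtrM ?expR_ge0// expRsqrt.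
  rewrite sqrtrV ?mulr_ge0 ?ltW// -/k mulrC; congr (_ * expR _)%:E.
  by rewrite /m qformZ qformD -/O1 -/O2; field.
rewrite (intRn_gauss_scaled iT k0 mb) lee_fin.
have dm := qbnd_det_gt0 iT mb; have d1 := qbnd_det_gt0 iT b1; have d2 := qbnd_det_gt0 iT b2.
have q1 x : 0 <= qform (m + H) x.
  by rewrite mH; have /andP[+ _] := i1.2 x; apply: le_trans; rewrite mulr_ge0 ?nrm2_ge0 ?ltW.
have q2 x : 0 <= qform (m - H) x.
  by rewrite mH'; have /andP[+ _] := i2.2 x; apply: le_trans; rewrite mulr_ge0 ?nrm2_ge0 ?ltW.
have := det_pencil_le iT T0 mb HT q1 q2; rewrite mH mH' /O1 /O2 !det_inv => D.
(* Passing from [H], half the difference of the precisions, to [S1 - S2] costs [4 * T ^+ 4]; with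
   [T ^+ 2] from [det_pencil_le] and the fourth root this makes [16 * T ^+ 6]. *)
have HH : frob2 (S1 - S2) / (4 * T ^+ 4) <= frob2 H.
  rewrite ler_pdivrMr ?mulr_gt0 ?exprn_gt0//.
  apply: le_trans (frob2_invB_ge T1 b1 b2) _; rewrite -/O1 -/O2.
  rewrite (_ : O1 - O2 = 2 *: H); last by rewrite /H scalerA mulfV ?scale1r.
  rewrite (_ : frob2 (2 *: H) = 4 * frob2 H); last first.
    rewrite /frob2 mulr_sumr; apply: eq_bigr => i _; rewrite mulr_sumr; apply: eq_bigr => j _.
    by rewrite mxE; ring.
  by rewrite le_eqVlt; apply/orP; left; apply/eqP; ring.
rewrite -(@ler_pXn2r _ 4)// ?nnegrE ?mulr_ge0 ?sqrtr_ge0 ?expR_ge0//.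
have -> : (k * Num.sqrt ((2 * pi) ^+ p / \det m)) ^+ 4 = (\det S1)^-1 * (\det S2)^-1 / \det m ^+ 2.
  have E4 (x : R) : x ^+ 4 = (x ^+ 2) ^+ 2 by rewrite -exprM.
  rewrite exprMn /k exprVn !E4 !sqr_sqrtr ?mulr_ge0 ?ltW ?divr_gt0 ?invr_gt0 ?twopi_gt0//.
  rewrite exprMn (mvncst_sqr iT b1) (mvncst_sqr iT b2).
  by field; rewrite !gt_eqF ?twopi_gt0.
rewrite ler_pdivrMr ?exprn_gt0// [leRHS]mulrC; apply: le_trans D _.
rewrite ler_wpM2l ?sqr_ge0// -expRM_natl ler_expR mulrN lerN2.
apply: le_trans (_ : (frob2 (S1 - S2) / (4 * T ^+ 4)) / T ^+ 2 <= _); last first.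
  by rewrite ler_wpM2r// invr_ge0 sqr_ge0.
by rewrite le_eqVlt; apply/orP; left; apply/eqP; field; exact: lt0r_neq0.
Qed.

(** The integrand is Gaussian with precision [M = 2 O1 - O2 = O1 - H], where [O2 = O1 + H]. The
    smallness hypothesis makes [M] positive definite; the squared integral is then
    [det O1 ^+ 2 / (det O2 * det M)], and [det_pencil_ge] applies. *)
Theorem mvn_chi2 p (S1 S2 : 'M[R]_p) T : 1 <= T -> qbnd S1 T^-1 T -> qbnd S2 T^-1 T ->
  frob2 (S1 - S2) <= (4 * T ^+ 6)^-1 ->
  (intRn p (fun v => (mvnpdf S1 (colv p v) ^+ 2 / mvnpdf S2 (colv p v))%:E)
   <= (expR (T ^+ 6 * frob2 (S1 - S2)))%:E)%E.
Proof.
move=> T1 b1 b2 sm; have T0 : 0 < T by lra.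
have iT : 0 < T^-1 by rewrite invr_gt0.
have i1 := qbnd_inv iT T0 b1; have i2 := qbnd_inv iT T0 b2; rewrite invrK in i1 i2.
set O1 := invmx S1 in i1; set O2 := invmx S2 in i2.
pose H := O2 - O1; pose M := O1 - H.
have mH : O1 + H = O2 by rewrite /H addrC subrK.
have HT : H^T = H by rewrite /H linearB /= i1.1 i2.1.
have HF : frob2 H <= T ^+ 4 * frob2 (S1 - S2).
  by rewrite -frob2N /H opprB; exact: frob2_invB.
(* The Frobenius norm of [H] is at most half the lower bound [T^-1] of [O1], so [M] keeps the lower
   bound [T^-1 / 2]. *)
have HF' : frob2 H <= (T^-1 / 2) ^+ 2.
  apply: le_trans HF _; apply: le_trans (_ : T ^+ 4 * (4 * T ^+ 6)^-1 <= _).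
    by rewrite ler_wpM2l ?exprn_ge0 ?(ltW T0).
  by rewrite le_eqVlt; apply/orP; left; apply/eqP; field; exact: lt0r_neq0.
have Mb : qbnd M (T^-1 / 2) (T + T^-1 / 2).
  have h0 : 0 <= T^-1 / 2 by lra.
  have := qbndD i1 (qbndN (qbnd_frob h0 HT HF')).
  by rewrite opprK; apply: qbnd_sub; lra.
have M0 : 0 < T^-1 / 2 by lra.
have dM := qbnd_det_gt0 M0 Mb; have d1 := qbnd_det_gt0 iT b1; have d2 := qbnd_det_gt0 iT b2.
have c1 := mvncst_gt0 iT b1; have c2 := mvncst_gt0 iT b2.
set k := mvncst S2 / mvncst S1 ^+ 2.
have k0 : 0 <= k by rewrite divr_ge0 ?sqr_ge0 ?ltW.
rewrite (_ : (fun v => _) = (fun v => (k * expR (- qform M (colv p v) / 2))%:E)); last first.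
  apply/funext => v; rewrite !mvnpdfE.
  have -> : - qform M (colv p v) / 2 =
      2%:R * (- qform O1 (colv p v) / 2) - (- qform O2 (colv p v) / 2).
    by rewrite /M /H !qformB; field.
  rewrite expRD expRN expRM_natl /k.
  by congr _%:E; field; rewrite ?expR_eq0 !gt_eqF ?expR_gt0.
rewrite (intRn_gauss_scaled M0 k0 Mb) lee_fin.
have HF2 : frob2 H <= T^-1 ^+ 2 / 2.
  by apply: le_trans HF' _; rewrite expr_div_n ler_wpM2l ?sqr_ge0//; lra.
have := det_pencil_ge iT i1 HT HF2; rewrite mH -/M /O1 /O2 !det_inv => D.
have CM : 0 <= (2 * pi) ^+ p / \det M by rewrite divr_ge0// ltW// twopi_gt0.
rewrite -(@ler_pXn2r _ 2)// ?nnegrE ?(mulr_ge0 k0 (sqrtr_ge0 _)) ?expR_ge0//.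
rewrite exprMn (sqr_sqrtr CM) /k.
rewrite expr_div_n (mvncst_sqr iT b2) (mvncst_sqr iT b1).
have -> : (2 * pi) ^+ p * \det S2 / ((2 * pi) ^+ p * \det S1) ^+ 2 * ((2 * pi) ^+ p / \det M)
   = ((\det S1)^-1 ^+ 2) / ((\det S2)^-1 * \det M).
  by field; rewrite !gt_eqF ?twopi_gt0.
rewrite ler_pdivrMr ?mulr_gt0 ?invr_gt0// -expRM_natl.
rewrite -ler_pdivrMl ?expR_gt0// -expRN.
apply: le_trans D; rewrite mulrC ler_wpM2l ?sqr_ge0// ler_expR lerN2 ler_pM2l//.
apply: le_trans (_ : T ^+ 4 * frob2 (S1 - S2) / T^-1 ^+ 2 <= _).
  by rewrite ler_wpM2r// invr_ge0 sqr_ge0.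
by rewrite le_eqVlt; apply/orP; left; apply/eqP; field; exact: lt0r_neq0.
Qed.

End Affinity.

(** * From the posterior to two Gaussian integrals *)

Section Samples.
Variable R : realType.

Lemma dataof_vcat0 n p (u w : nat -> R) : dataof n.+1 p (vcat p u w) 0 = colv p u.
Proof. by apply/matrixP => i j; rewrite !mxE vcatE mul0n add0n ltn_ord. Qed.

Lemma dataof_vcatS n p (u w : nat -> R) (i : 'I_n) :
  dataof n.+1 p (vcat p u w) (lift ord0 i) = dataof n p w i.
Proof.
apply/matrixP => k j; rewrite !mxE vcatE lift0 mulSn -addnA.
by rewrite ltnNge leq_addr /= addKn.
Qed.

(** Tensorisation: the first observation occupies the first [p] coordinates and is integrated out,
    contributing one factor [c]. *)
Lemma intRn_data_le n p (f : 'cV[R]_p -> R) c :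
  (forall x, 0 <= f x) -> cmeas (fun v => (f (colv p v))%:E) ->
  (intRn p (fun v => (f (colv p v))%:E) <= c%:E)%E ->
  (intRn (n * p) (fun v => (\prod_(i < n) f (dataof n p v i))%:E) <= (c ^+ n)%:E)%E.
Proof.
move=> f0 mf fc.
have c0 : 0 <= c.
  by rewrite -lee_fin; apply: le_trans fc; apply: intRn_ge0 => v; rewrite lee_fin.
elim: n => [|n IH].
  by rewrite mul0n /= big_ord0 expr0.
rewrite mulSn intRn_cat.
have mP : cmeas (fun w => (\prod_(i < n) f (dataof n p w i))%:E).
  move=> disp T F mF; apply/measurable_EFinP; apply: measurable_prod => i _.
  apply/measurable_EFinP.
  rewrite (_ : EFin \o _ = (fun t => (f (colv p (fun j => F t (i * p + j)%N)))%:E)); last first.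
    by apply/funext => t; congr (f _)%:E; apply/matrixP => k j; rewrite !mxE.
  by apply: mf => j; exact: mF.
have P0 w : (0 <= (\prod_(i < n) f (dataof n p w i))%:E)%E.
  by rewrite lee_fin; apply: prodr_ge0 => i _; exact: f0.
under eq_intRn => u.
  under eq_intRn => w.
    rewrite big_ord_recl dataof_vcat0.
    under eq_bigr => i _ do rewrite dataof_vcatS.
    rewrite EFinM.
    over.
  rewrite intRnZ ?lee_fin// muleC.
  over.
rewrite intRnZ//; last 2 first.
- exact: intRn_ge0.
- by move=> v; rewrite lee_fin.
by rewrite exprSr EFinM; apply: lee_pmul => //; apply: intRn_ge0 => // v; rewrite lee_fin.
Qed.

Lemma sqrt_prod (I : Type) (s : seq I) (f : I -> R) : (forall i, 0 <= f i) ->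
  Num.sqrt (\prod_(i <- s) f i) = \prod_(i <- s) Num.sqrt (f i).
Proof.
move=> f0; elim: s => [|i s IH]; first by rewrite !big_nil sqrtr1.
by rewrite !big_cons sqrtrM// IH.
Qed.

Lemma cmeas_mvnpdf_fun p (S1 S2 : 'M[R]_p) (g : R -> R -> R) :
  (forall disp (T : measurableType disp) (f1 f2 : T -> R), measurable_fun setT f1 ->
     measurable_fun setT f2 -> measurable_fun setT (fun t => g (f1 t) (f2 t))) ->
  cmeas (fun v => (g (mvnpdf S1 (colv p v)) (mvnpdf S2 (colv p v)))%:E).
Proof.
move=> mg disp T F mF; apply/measurable_EFinP; apply: mg;
  by apply: measurable_mvnpdf; [exact: mxmeas_cst|exact: mxmeas_colv].
Qed.

Lemma lik_ge0 n p (S : 'M[R]_p) (X : 'I_n -> 'cV[R]_p) : 0 <= lik S X.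
Proof. by apply: prodr_ge0 => i _; exact: mvnpdf_ge0. Qed.

Lemma lik_gt0 n p (S : 'M[R]_p) (X : 'I_n -> 'cV[R]_p) lo hi :
  0 < lo -> qbnd S lo hi -> 0 < lik S X.
Proof. by move=> lo0 b; apply: prodr_gt0 => i _; exact: mvnpdf_gt0 b. Qed.

Lemma lik_affinity n p (S1 S2 : 'M[R]_p) T : 1 <= T -> qbnd S1 T^-1 T -> qbnd S2 T^-1 T ->
  (intRn (n * p) (fun v => (Num.sqrt (lik S1 (dataof n p v) * lik S2 (dataof n p v)))%:E)
   <= (expR (- (frob2 (S1 - S2) / (16 * T ^+ 6))) ^+ n)%:E)%E.
Proof.
move=> T1 b1 b2.
rewrite (_ : (fun v => _) = (fun v => (\prod_(i < n)
   Num.sqrt (mvnpdf S1 (dataof n p v i) * mvnpdf S2 (dataof n p v i)))%:E)); last first.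
  apply/funext => v; rewrite /lik -big_split /= sqrt_prod// => i.
  by rewrite mulr_ge0 ?mvnpdf_ge0.
apply: (@intRn_data_le n p (fun x => Num.sqrt (mvnpdf S1 x * mvnpdf S2 x))).
- by move=> x; exact: sqrtr_ge0.
- apply: (@cmeas_mvnpdf_fun p S1 S2 (fun x y => Num.sqrt (x * y))) => *.
  by apply: measurable_funsqrt; exact: measurable_funM.
- exact: mvn_affinity.
Qed.

Lemma lik_chi2 n p (S1 S2 : 'M[R]_p) T : 1 <= T -> qbnd S1 T^-1 T -> qbnd S2 T^-1 T ->
  frob2 (S1 - S2) <= (4 * T ^+ 6)^-1 ->
  (intRn (n * p) (fun v => (lik S1 (dataof n p v) ^+ 2 / lik S2 (dataof n p v))%:E)
   <= (expR (T ^+ 6 * frob2 (S1 - S2)) ^+ n)%:E)%E.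
Proof.
move=> T1 b1 b2 sm.
rewrite (_ : (fun v => _) = (fun v => (\prod_(i < n)
   (mvnpdf S1 (dataof n p v i) ^+ 2 / mvnpdf S2 (dataof n p v i)))%:E)); last first.
  by apply/funext => v; rewrite /lik [in RHS]big_split /= prodrXl prodfV.
apply: (@intRn_data_le n p (fun x => mvnpdf S1 x ^+ 2 / mvnpdf S2 x)).
- by move=> x; rewrite divr_ge0 ?sqr_ge0 ?mvnpdf_ge0.
- apply: (@cmeas_mvnpdf_fun p S1 S2 (fun x y => x ^+ 2 / y)) => *.
  by apply: measurable_funM; [exact: measurable_funX|exact: measurable_funV].
- exact: mvn_chi2.
Qed.

End Samples.

(** * The three-way split of the event that the posterior mass is large *)

Section PosteriorBound.
Variable R : realType.

(* AM-GM: [r L^2 + 1/r >= 2 L] with [r = kap h / lc]. *)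
Lemma amgm_cell (h kap L lc l0 : R) : 0 < h -> 0 < kap -> 0 <= L -> 0 < lc -> 0 < l0 ->
  lc <= h ^+ 4 * l0 -> L <= h / 2 * (kap * (L ^+ 2 / lc) + kap^-1 * Num.sqrt (lc * l0)).
Proof.
move=> h0 k0 L0 c0 l00 le.
set s := Num.sqrt _.
have s0 : 0 <= s by exact: sqrtr_ge0.
have s2 : s ^+ 2 = lc * l0 by rewrite sqr_sqrtr// mulr_ge0 ?ltW.
(* As [lc ^+ 2 <= h ^+ 4 * (lc * l0)], the root [s] dominates [lc / h ^+ 2], the quantity that pairs
   with [L ^+ 2 / lc] in AM-GM. *)
have ls : lc <= h ^+ 2 * s.
  rewrite -(@ler_pXn2r _ 2)// ?nnegrE ?mulr_ge0 ?(ltW h0) ?(ltW c0)//.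
  by rewrite exprMn s2 -exprM expr2 mulrCA ler_wpM2l// (ltW c0).
suff H : L <= h / 2 * (kap * (L ^+ 2 / lc) + kap^-1 * (lc / h ^+ 2)).
  apply: (le_trans H).
  rewrite ler_wpM2l ?divr_ge0 ?(ltW h0)//.
  by rewrite lerD2l ler_wpM2l ?invr_ge0 ?(ltW k0)// ler_pdivrMr ?exprn_gt0// mulrC.
pose r := kap * h / lc.
have r0 : 0 < r by rewrite divr_gt0// mulr_gt0.
have -> : h / 2 * (kap * (L ^+ 2 / lc) + kap^-1 * (lc / h ^+ 2)) = (r * L ^+ 2 + r^-1) / 2.
  by rewrite /r; field; rewrite !gt_eqF.
rewrite ler_pdivlMr// -subr_ge0.
have -> : r * L ^+ 2 + r^-1 - L * 2 = r^-1 * (r * L - 1) ^+ 2.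
  by field; rewrite gt_eqF.
by rewrite mulr_ge0 ?sqr_ge0// invr_ge0 ltW.
Qed.

Lemma amgm_ball (k L l0 : R) : 0 < L -> 2 * k * l0 <= l0 ^+ 2 / L + k ^+ 2 * L.
Proof.
move=> L0; rewrite -subr_ge0.
have -> : l0 ^+ 2 / L + k ^+ 2 * L - 2 * k * l0 = L^-1 * (l0 - k * L) ^+ 2.
  by field; rewrite gt_eqF.
by rewrite mulr_ge0 ?sqr_ge0// invr_ge0 ltW.
Qed.

Section Abstract.
(** [d] and [N] are the dimensions of parameter and data, [prd] the unconstrained prior density,
    [iA] and [iU] the indicators of the far set and of [U(tau)], [z] the inverse normalising
    constant, [lc i] the likelihood at the representative of cell [i], [h i] its weight and [m i] a
    bound on its mass. About [iA] and [iU] only bounds, the covering [AU] and the value of [iU] on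
    [B] are assumed. *)
Variables (d N : nat) (prd : (nat -> R) -> \bar R) (L : (nat -> R) -> (nat -> R) -> R)
  (l0 : (nat -> R) -> R).
Variables (I : eqType) (s : seq I) (C : I -> (nat -> R) -> bool) (B : (nat -> R) -> bool)
  (lc : I -> (nat -> R) -> R) (h : I -> R) (m : I -> R) (iA iU : (nat -> R) -> R)
  (z eps k kap b K1 K3 rho : R).
Hypotheses (prd0 : forall th, (0 <= prd th)%E) (mprd : cmeas prd)
  (L0 : forall th X, 0 <= L th X) (mL : cmeas2 (fun th X => (L th X)%:E))
  (l00 : forall X, 0 < l0 X) (ml0 : cmeas (fun X => (l0 X)%:E))
  (mC : forall i, cmeas (fun th => (C i th)%:R%:E)) (mB : cmeas (fun th => (B th)%:R%:E))
  (lc0 : forall i X, 0 < lc i X) (mlc : forall i, cmeas (fun X => (lc i X)%:E))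
  (LB : forall th X, B th -> 0 < L th X)
  (h0 : forall i, 0 < h i) (z0 : 0 <= z) (eps0 : 0 < eps) (k0 : 0 < k) (kap0 : 0 < kap)
  (b0 : 0 < b) (K30 : 0 <= K3)
  (iA0 : forall th, 0 <= iA th <= 1) (iU0 : forall th, 0 <= iU th)
  (BU : forall th, B th -> iU th = 1)
  (AU : forall th, iA th * iU th <= \sum_(i <- s) (C i th)%:R)
  (massB : intRn d (fun th => (B th)%:R%:E * prd th)%E = b%:E)
  (massC : forall i, (intRn d (fun th => (C i th)%:R%:E * prd th) <= (m i)%:E)%E)
  (chiB : forall th, B th -> (intRn N (fun X => (l0 X ^+ 2 / L th X)%:E) <= K1%:E)%E)
  (chiC : forall i th, C i th -> (intRn N (fun X => (L th X ^+ 2 / lc i X)%:E) <= K3%:E)%E)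
  (affC : forall i, i \in s -> (intRn N (fun X => (Num.sqrt (lc i X * l0 X))%:E) <= rho%:E)%E).

Let w th X := ((iU th)%:E * prd th * z%:E * (L th X)%:E)%E.
Let post X := fine (intRn d (fun th => (iA th)%:E * w th X)%E) / fine (intRn d (fun th => w th X)).

Let Q i th X := h i / 2 * (kap * (L th X ^+ 2 / lc i X) + kap^-1 * Num.sqrt (lc i X * l0 X)).

(** Each of the three terms dominates [l0 X] in one of the three cases, and each is built from
    quantities whose data integrals [K1], [rho] and [K3] control. *)
Let T1 X := ((k * b)^-1%:E * intRn d (fun th => (B th)%:R%:E * prd th * (l0 X ^+ 2 / L th X)%:E))%E.
Let T2 X := (\sum_(i <- s) (h i ^- 2)%:E * (Num.sqrt (lc i X * l0 X))%:E)%E.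
Let T3 X := ((k / (b * eps))%:E * \sum_(i <- s) intRn d (fun th => (C i th)%:R%:E * prd th * (Q i th X)%:E))%E.

Let w_ge0 th X : (0 <= w th X)%E.
Proof. by rewrite /w !mule_ge0 ?lee_fin. Qed.

Let Q_ge0 i th X : 0 <= Q i th X.
Proof.
rewrite /Q mulr_ge0 ?divr_ge0 ?(ltW (h0 _))// addr_ge0// mulr_ge0 ?invr_ge0 ?(ltW kap0)// ?sqrtr_ge0//.
by rewrite divr_ge0 ?sqr_ge0 ?ltW.
Qed.

Let mulnat_ge0 (c : bool) th (x : R) : 0 <= x -> (0 <= c%:R%:E * prd th * x%:E)%E.
Proof. by move=> x0; rewrite !mule_ge0 ?lee_fin. Qed.

Let measL disp (T : measurableType disp) (F G : T -> nat -> R) : cylm F -> cylm G ->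
  measurable_fun setT (fun t => L (F t) (G t)).
Proof. by move=> mF mG; apply/measurable_EFinP; exact: mL. Qed.

Let meas_l0 disp (T : measurableType disp) (G : T -> nat -> R) : cylm G ->
  measurable_fun setT (fun t => l0 (G t)).
Proof. by move=> mG; apply/measurable_EFinP; exact: ml0. Qed.

Let meas_lc i disp (T : measurableType disp) (G : T -> nat -> R) : cylm G ->
  measurable_fun setT (fun t => lc i (G t)).
Proof. by move=> mG; apply/measurable_EFinP; exact: mlc. Qed.

Let cm2_ratioB : cmeas2 (fun th X => (l0 X ^+ 2 / L th X)%:E).
Proof.
move=> disp T F G mF mG; apply/measurable_EFinP; apply: measurable_funM.
  by apply: measurable_funX; exact: meas_l0.
by apply: measurable_funV; exact: measL.
Qed.

Let cm2_ratioC i : cmeas2 (fun th X => (L th X ^+ 2 / lc i X)%:E).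
Proof.
move=> disp T F G mF mG; apply/measurable_EFinP; apply: measurable_funM.
  by apply: measurable_funX; exact: measL.
by apply: measurable_funV; exact: meas_lc.
Qed.

Let cm_aff i : cmeas (fun X => (Num.sqrt (lc i X * l0 X))%:E).
Proof.
move=> disp T F mF; apply/measurable_EFinP; apply: measurable_funsqrt.
by apply: measurable_funM; [exact: meas_lc|exact: meas_l0].
Qed.

Let cm2_Q i : cmeas2 (fun th X => (Q i th X)%:E).
Proof.
move=> disp T F G mF mG; apply/measurable_EFinP; apply: measurable_funM.
  exact: measurable_cst.
apply: measurable_funD; apply: measurable_funM; try exact: measurable_cst.
  by apply/measurable_EFinP; exact: cm2_ratioC.
by apply/measurable_EFinP; exact: cm_aff.
Qed.

Let cmB : cmeas (fun th => (B th)%:R%:E * prd th)%E. Proof. exact: cmeasM. Qed.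
Let cmC i : cmeas (fun th => (C i th)%:R%:E * prd th)%E. Proof. exact: cmeasM. Qed.

Let kb_ge0 : 0 <= (k * b)^-1.
Proof. by rewrite invr_ge0 ltW// mulr_gt0. Qed.

Let kbe_gt0 : 0 < k / (b * eps).
Proof. by rewrite divr_gt0// mulr_gt0. Qed.

Let T1_ge0 X : (0 <= T1 X)%E.
Proof.
rewrite mule_ge0//; apply: intRn_ge0 => th.
by apply: mulnat_ge0; rewrite divr_ge0 ?sqr_ge0.
Qed.

Let T2_ge0 X : (0 <= T2 X)%E.
Proof.
by apply: sume_ge0 => i _; rewrite mule_ge0 ?lee_fin ?invr_ge0 ?sqr_ge0 ?sqrtr_ge0.
Qed.

Let T3_ge0 X : (0 <= T3 X)%E.
Proof.
rewrite mule_ge0 ?lee_fin ?(ltW kbe_gt0)//; apply: sume_ge0 => i _.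
by apply: intRn_ge0 => th; apply: mulnat_ge0; exact: Q_ge0.
Qed.

Lemma posterior_event X : eps <= post X -> ((l0 X)%:E <= T1 X + T2 X + T3 X)%E.
Proof.
move=> ep.
set D := intRn d (fun th => w th X) in ep.
set Nu := intRn d (fun th => (iA th)%:E * w th X)%E in ep.
have D0 : (0 <= D)%E by apply: intRn_ge0 => th; exact: w_ge0.
have Nu0 : (0 <= Nu)%E.
  apply: intRn_ge0 => th; rewrite mule_ge0// lee_fin; by have /andP[] := iA0 th.
have ND : (Nu <= D)%E.
  apply: le_intRn => th; first by rewrite mule_ge0// lee_fin; have /andP[] := iA0 th.
  rewrite -[leRHS]mul1e lee_wpmul2r// lee_fin; by have /andP[] := iA0 th.
(* Division by 0 and [fine] of an infinite value both give 0, so [eps <= post X] forces [D] to be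
   finite and non-zero. Then [z] is positive too, and cancels. *)
have fD : fine D != 0.
  apply: contraTneq ep => D00; rewrite -/D -/Nu /post.
  by rewrite -/D -/Nu D00 invr0 mulr0 -ltNge.
have Dfin : D \is a fin_num by move: fD; case: (D) => //=; rewrite eqxx.
have Nfin : Nu \is a fin_num.
  by rewrite ge0_fin_numE// (le_lt_trans ND)// ltey_eq Dfin.
have fD0 : 0 < fine D by rewrite lt0r fD fine_ge0.
have epN : (eps%:E * D <= Nu)%E.
  by rewrite -(fineK Dfin) -(fineK Nfin) -EFinM lee_fin -ler_pdivlMr.
have z1 : 0 < z.
  rewrite lt0r z0 andbT; apply: contraNneq fD => zz.
  rewrite /D (_ : (fun th => w th X) = (fun=> 0%E)) ?intRn0//.
  by apply/funext => th; rewrite /w zz mule0 mul0e.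
pose DB := intRn d (fun th => (B th)%:R%:E * prd th * (L th X)%:E)%E.
pose NC := (\sum_(i <- s) intRn d (fun th => (C i th)%:R%:E * prd th * (L th X)%:E))%E.
have cmBL : cmeas (fun th => (B th)%:R%:E * prd th * (L th X)%:E)%E.
  by apply: cmeasM => //; apply: (cmeas2r X mL).
have cmCL i : cmeas (fun th => (C i th)%:R%:E * prd th * (L th X)%:E)%E.
  by apply: cmeasM => //; apply: (cmeas2r X mL).
have DB0 : (0 <= DB)%E by apply: intRn_ge0 => th; exact: mulnat_ge0.
have zD : (z%:E * DB <= D)%E.
  rewrite -intRnZ//; last by move=> v; exact: mulnat_ge0.
  apply: le_intRn => th; first by rewrite mule_ge0// mulnat_ge0.
  rewrite /w; case: (boolP (B th)) => [Bt|_]; last by rewrite !mul0e mule0 -/(w th X).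
  by rewrite (BU Bt) muleA (muleC z%:E).
have zN : (Nu <= z%:E * NC)%E.
  rewrite /NC ge0_sume_distrr; last first.
    by move=> i _; apply: intRn_ge0 => th; exact: mulnat_ge0.
  under eq_bigr => i _.
    rewrite -intRnZ//; last by move=> v; exact: mulnat_ge0.
    over.
  rewrite -intRn_sum; last 2 first.
  - by move=> i v; rewrite mule_ge0// mulnat_ge0.
  - by move=> i; apply: cmeasM => //; exact: cmeas_cst.
  apply: le_intRn => th; first by rewrite mule_ge0// lee_fin; have /andP[] := iA0 th.
  rewrite (eq_bigr (fun i => (C i th)%:R%:E * (prd th * z%:E * (L th X)%:E))%E); last first.
    by move=> i _; rewrite [RHS]muleA [in RHS]muleA muleC -!muleA; congr (_ * (_ * _))%E; rewrite muleC.
  rewrite -ge0_sume_distrl// -/(w th X) sumEFin /w !muleA -EFinM -!muleA.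
  apply: lee_wpmul2r; first by rewrite !mule_ge0 ?lee_fin.
  by rewrite lee_fin.
(* What remains of [eps <= post X] once the constraint and [z] are removed: likelihood mass on the
   ball against likelihood mass on the cells. *)
have key : (eps%:E * DB <= NC)%E.
  rewrite -(@lee_pmul2l _ z%:E) ?lte_fin//.
  apply: le_trans zN; apply: le_trans epN.
  by rewrite muleCA lee_pmul2l ?lte_fin.
(* Small evidence first: [amgm_ball] is integrated over [B], and [k ^+ 2 * DB] uses up at most half
   of [2 * k * l0 X * b]. *)
have [big|small] := leP ((b / k * l0 X)%:E) DB; last first.
  rewrite -addeA; apply: (@le_trans _ _ (T1 X)); last by rewrite leeDl// adde_ge0.
  rewrite /T1; set Y := intRn d _.
  have Yge : ((2 * k * l0 X * b)%:E <= Y + (k ^+ 2)%:E * DB)%E.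
    rewrite /DB -intRnZ ?lee_fin ?sqr_ge0//; last by move=> v; exact: mulnat_ge0.
    rewrite -intRnD.
    - rewrite EFinM -massB -intRnZ//.
      + apply: le_intRn => th.
          by rewrite mule_ge0 ?lee_fin ?mulr_ge0 ?(ltW k0) ?(ltW (l00 X))// mule_ge0// lee_fin.
        case: (boolP (B th)) => [Bt|_]; last by rewrite !mul0e !mule0 adde0.
        rewrite !mul1e muleCA -ge0_muleDr ?lee_fin.
        * rewrite muleC lee_wpmul2l// -EFinM -EFinD lee_fin.
          exact/amgm_ball/LB.
        * by rewrite divr_ge0 ?sqr_ge0.
        * by rewrite mulr_ge0 ?sqr_ge0.
      + by rewrite lee_fin !mulr_ge0 ?(ltW k0) ?(ltW (l00 X)).
      + by move=> v; rewrite mule_ge0 ?lee_fin.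
    - by move=> v; apply: mulnat_ge0; rewrite divr_ge0 ?sqr_ge0.
    - by move=> v; rewrite mule_ge0 ?lee_fin ?sqr_ge0// mulnat_ge0.
    - by apply: cmeasM => //; exact: (cmeas2r X cm2_ratioB).
    - by apply: cmeasM => //; exact: cmeas_cst.
  have DBfin : DB \is a fin_num.
    by rewrite ge0_fin_numE// (lt_trans small)// ltry.
  move: small Yge; rewrite -(fineK DBfin) -EFinM lte_fin => small Yge.
  have Y0 : (0 <= Y)%E.
    by apply: intRn_ge0 => th; apply: mulnat_ge0; rewrite divr_ge0 ?sqr_ge0.
  have : ((k * b * l0 X)%:E <= Y)%E.
    have sm : k ^+ 2 * fine DB <= k * b * l0 X.
      have -> : k * b * l0 X = k ^+ 2 * (b / k * l0 X) by field; rewrite gt_eqF.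
      by rewrite ler_wpM2l ?sqr_ge0// ltW.
    move: Yge Y0; case: (Y) => [y| |]; [|by move=> *; rewrite leey|by move=> _].
    rewrite -EFinD !lee_fin => ? ?; lra.
  move=> le; apply: (@le_trans _ _ ((k * b)^-1%:E * (k * b * l0 X)%:E)%E).
    by rewrite -EFinM lee_fin le_eqVlt; apply/orP; left; apply/eqP; field; rewrite !gt_eqF.
  by rewrite lee_wpmul2l ?lee_fin.
have NC1 : ((eps * (b / k * l0 X))%:E <= NC)%E.
  by apply: le_trans key; rewrite EFinM lee_pmul2l ?lte_fin.
(* If some representative has likelihood above [h i ^+ 4 * l0 X], its single term in [T2] already
   exceeds [l0 X]. *)
have [/hasP|/hasPn all_small] := boolP (has (fun i => h i ^+ 4 * l0 X < lc i X) s).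
  move=> [i si big_i]; apply: (@le_trans _ _ (T2 X)); last first.
    by rewrite addeAC leeDr// adde_ge0.
  rewrite /T2 (big_rem i si) /=.
  apply: le_trans (leeDl _ _); last first.
    by apply: sume_ge0 => j _; rewrite mule_ge0 ?lee_fin ?invr_ge0 ?sqr_ge0 ?sqrtr_ge0.
  rewrite -EFinM lee_fin mulrC ler_pdivlMr ?exprn_gt0//.
  rewrite -(@ler_pXn2r _ 2)// ?nnegrE ?sqrtr_ge0 ?mulr_ge0 ?(ltW (h0 i)) ?(ltW (l00 X))//.
  rewrite sqr_sqrtr ?mulr_ge0 ?(ltW (l00 X)) ?(ltW (lc0 _ _))//.
  rewrite (_ : (_ * _) ^+ 2 = h i ^+ 4 * l0 X * l0 X); last by ring.
  by rewrite ler_wpM2r ?(ltW (l00 X)) ?(ltW big_i).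
(* Otherwise [amgm_cell] bounds the likelihood by [Q] throughout every cell. *)
have NQ : (NC <= \sum_(i <- s) intRn d (fun th => (C i th)%:R%:E * prd th * (Q i th X)%:E))%E.
  rewrite /NC [leLHS]big_seq [leRHS]big_seq; apply: lee_sum => j sj.
  apply: le_intRn => th; first exact: mulnat_ge0.
  rewrite lee_wpmul2l ?mule_ge0 ?lee_fin//.
  by apply: amgm_cell => //; rewrite leNgt; exact: all_small sj.
apply: (@le_trans _ _ (T3 X)); last by rewrite leeDr// adde_ge0.
apply: (@le_trans _ _ ((k / (b * eps))%:E * NC)%E); last by rewrite lee_pmul2l ?lte_fin.
apply: (@le_trans _ _ ((k / (b * eps))%:E * (eps * (b / k * l0 X))%:E)%E).
  rewrite -EFinM lee_fin le_eqVlt; apply/orP; left; apply/eqP; field.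
  by rewrite !gt_eqF.
by rewrite lee_pmul2l ?lte_fin.
Qed.

Let bound := K1 / k + \sum_(i <- s) h i ^- 2 * rho
  + k / (b * eps) * \sum_(i <- s) m i * (h i / 2 * (kap * K3 + kap^-1 * rho)).

(** Tonelli turns each expectation into an integral over the parameter of data integrals bounded by
    [K1], [rho] or [K3]; what is left are the masses of [B] and of the cells. *)
Theorem posterior_expectation_le :
  (intRn N (fun X => ((eps <= post X)%R%:R * l0 X)%:E) <= bound%:E)%E.
Proof.
have c2B : cmeas2 (fun X th => (B th)%:R%:E * prd th * (l0 X ^+ 2 / L th X)%:E)%E.
  by apply: cmeas2M; [exact: cmeas_r|exact: cmeas2C].
have c2C i : cmeas2 (fun X th => (C i th)%:R%:E * prd th * (Q i th X)%:E)%E.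
  by apply: cmeas2M; [exact: cmeas_r|exact: (cmeas2C (cm2_Q i))].
have p1 X th : (0 <= (B th)%:R%:E * prd th * (l0 X ^+ 2 / L th X)%:E)%E.
  by apply: mulnat_ge0; rewrite divr_ge0 ?sqr_ge0.
have p3 i X th : (0 <= (C i th)%:R%:E * prd th * (Q i th X)%:E)%E.
  by apply: mulnat_ge0; exact: Q_ge0.
have m1 : cmeas (fun X => intRn d (fun th => (B th)%:R%:E * prd th * (l0 X ^+ 2 / L th X)%:E))%E.
  exact: cmeas_intRn.
have m3 i : cmeas (fun X => intRn d (fun th => (C i th)%:R%:E * prd th * (Q i th X)%:E))%E.
  exact: cmeas_intRn.
have mT1 : cmeas T1 by apply: cmeasM => //; exact: cmeas_cst.
have mT2 : cmeas T2.
  by apply: cmeas_sum => i; apply: cmeasM; [exact: cmeas_cst|exact: cm_aff].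
have mS3 : cmeas (fun X => \sum_(i <- s) intRn d (fun th => (C i th)%:R%:E * prd th * (Q i th X)%:E))%E.
  exact: cmeas_sum.
have mT3 : cmeas T3 by apply: cmeasM => //; exact: cmeas_cst.
have mT12 : cmeas (fun X => T1 X + T2 X)%E.
  by move=> disp T F mF; apply: emeasurable_funD; [exact: mT1|exact: mT2].
apply: (@le_trans _ _ (intRn N (fun X => T1 X + T2 X + T3 X)%E)).
  apply: le_intRn => X; first by rewrite lee_fin mulr_ge0 ?ler0n ?(ltW (l00 X)).
  have [ep|_] := boolP (eps <= post X); first by rewrite mul1r; exact: posterior_event.
  by rewrite mul0r !adde_ge0.
rewrite intRnD//; last by move=> X; rewrite adde_ge0.
rewrite intRnD// /bound !EFinD.
apply: leeD; first apply: leeD.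
- rewrite intRnZ//; last by move=> X; exact: intRn_ge0.
  rewrite intRn_swap//.
  apply: (@le_trans _ _ ((k * b)^-1%:E * (b%:E * K1%:E))%E); last first.
    by rewrite -!EFinM lee_fin le_eqVlt; apply/orP; left; apply/eqP; field; rewrite !gt_eqF.
  rewrite lee_pmul2l ?lte_fin ?invr_gt0 ?mulr_gt0//.
  (* [B] is non-empty, having positive mass, so [K1] bounds some non-negative integral. *)
  have K10 : (0 <= K1%:E)%E.
    have [[th Bt]|nB] := pselect (exists th, B th).
      apply: le_trans (chiB Bt); apply: intRn_ge0 => X.
      by rewrite lee_fin divr_ge0 ?sqr_ge0.
    move: massB; rewrite (_ : (fun th => _) = (fun=> 0%E)) ?intRn0.
      by move=> [bz]; move: b0; rewrite -bz ltxx.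
    apply/funext => th; case: (boolP (B th)) => Bt; last by rewrite mul0e.
    by case: nB; exists th.
  rewrite -massB muleC -intRnZ//; last by move=> th; rewrite mule_ge0 ?lee_fin.
  apply: le_intRn => th; first exact: intRn_ge0.
  rewrite intRnZ//; last 3 first.
  + by rewrite mule_ge0 ?lee_fin.
  + by move=> X; rewrite lee_fin divr_ge0 ?sqr_ge0.
  + exact: (cmeas2l th cm2_ratioB).
  rewrite muleC; case: (boolP (B th)) => Bt; last by rewrite !mul0e !mule0.
  by rewrite lee_wpmul2r ?chiB// mul1e.
- rewrite intRn_sum; last 2 first.
  + by move=> i X; rewrite mule_ge0 ?lee_fin ?invr_ge0 ?sqr_ge0 ?sqrtr_ge0.
  + by move=> i; apply: cmeasM; [exact: cmeas_cst|exact: cm_aff].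
  rewrite -sumEFin [leLHS]big_seq [leRHS]big_seq; apply: lee_sum => i si.
  rewrite intRnZ ?lee_fin ?invr_ge0 ?sqr_ge0//.
  by rewrite EFinM lee_wpmul2l ?lee_fin ?invr_ge0 ?sqr_ge0// affC.
- rewrite intRnZ//; last 2 first.
  + by rewrite lee_fin ltW.
  + by move=> X; apply: sume_ge0 => i _; exact: intRn_ge0.
  rewrite intRn_sum//; last by move=> i X; exact: intRn_ge0.
  rewrite [leRHS]EFinM lee_wpmul2l ?lee_fin ?(ltW kbe_gt0)//.
  rewrite -sumEFin [leLHS]big_seq [leRHS]big_seq; apply: lee_sum => i si.
  rewrite intRn_swap//.
  have rho0 : 0 <= rho.
    by rewrite -lee_fin; apply: le_trans (affC si); apply: intRn_ge0 => X; rewrite lee_fin.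
  have hh0 : 0 <= h i / 2 by rewrite divr_ge0 ?(ltW (h0 i)).
  set c := h i / 2 * _.
  have QC th : C i th -> (intRn N (fun X => (Q i th X)%:E) <= c%:E)%E.
    move=> Ct; rewrite /Q /c.
    under eq_intRn => X do rewrite EFinM EFinD !(EFinM kap) (EFinM kap^-1).
    have r0 X : (0 <= (L th X ^+ 2 / lc i X)%:E)%E.
      by rewrite lee_fin divr_ge0 ?sqr_ge0 ?(ltW (lc0 _ _)).
    have s0 X : (0 <= (Num.sqrt (lc i X * l0 X))%:E)%E by rewrite lee_fin.
    have cr := cmeas2l th (cm2_ratioC i).
    have ca := cm_aff i.
    have kp : (0 <= kap%:E)%E by rewrite lee_fin ltW.
    have kv : (0 <= kap^-1%:E)%E by rewrite lee_fin invr_ge0 ltW.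
    rewrite intRnZ ?lee_fin//; last 2 first.
    + by move=> X; rewrite adde_ge0// mule_ge0.
    + by move=> disp T F mF; apply: emeasurable_funD; apply: emeasurable_funM;
         try exact: measurable_cst; [exact: cr|exact: ca].
    rewrite intRnD; last 4 first.
    + by move=> X; rewrite mule_ge0.
    + by move=> X; rewrite mule_ge0.
    + by apply: cmeasM => //; exact: cmeas_cst.
    + by apply: cmeasM => //; exact: cmeas_cst.
    rewrite !intRnZ// [leRHS]EFinM lee_wpmul2l ?lee_fin// EFinD [(kap * K3)%:E]EFinM [(kap^-1 * rho)%:E]EFinM.
    by apply: leeD; apply: lee_wpmul2l => //; [exact: chiC|exact: affC].
  have [[th Ct]|nC] := pselect (exists th, C i th); last first.
    rewrite (_ : (fun th => _) = (fun=> 0%E)) ?intRn0; last first.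
      apply/funext => th; case: (boolP (C i th)) => Ct; first by case: nC; exists th.
      by rewrite -[RHS](intRn0 R N); apply: eq_intRn => X; rewrite !mul0e.
    rewrite lee_fin mulr_ge0//.
      by rewrite -lee_fin; apply: le_trans (massC i); apply: intRn_ge0 => t; rewrite mule_ge0 ?lee_fin.
    rewrite /c mulr_ge0// addr_ge0// mulr_ge0 ?invr_ge0 ?(ltW kap0)//.
  have c0 : (0 <= c%:E)%E.
    by apply: le_trans (QC _ Ct); apply: intRn_ge0 => X; rewrite lee_fin Q_ge0.
  apply: (@le_trans _ _ (c%:E * (m i)%:E)%E); last by rewrite -EFinM lee_fin mulrC.
  apply: (@le_trans _ _ (c%:E * intRn d (fun th => (C i th)%:R%:E * prd th))%E); last first.
    exact: lee_wpmul2l.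
  rewrite -intRnZ//; last by move=> t; rewrite mule_ge0 ?lee_fin.
  apply: le_intRn => t; first exact: intRn_ge0.
  rewrite intRnZ//; last 3 first.
  + by rewrite mule_ge0 ?lee_fin.
  + by move=> X; rewrite lee_fin Q_ge0.
  + exact: (cmeas2l t (cm2_Q i)).
  rewrite muleC; case: (boolP (C i t)) => Ct'; last by rewrite !mul0e !mule0.
  by rewrite lee_wpmul2r ?QC// mul1e.
Qed.

End Abstract.
End PosteriorBound.

(** * Masses of boxes under the prior *)

Section ElementaryIntegrals.
Variable R : realType.
Let mu := @lebesgue_measure R.

Lemma is_derive_Vshift (y x : R) : y + x != 0 ->
  is_derive x 1 (fun x => - (y + x)^-1 : R) ((y + x) ^- 2).
Proof.
move=> yx; have h : is_derive x 1 (fun x => y + x : R) 1.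
  exact: (is_derive_eq (is_deriveD (is_derive_cst y x 1) (is_derive_id x 1)) (add0r 1)).
apply: (is_derive_eq (is_deriveN (is_deriveV yx h))).
by rewrite scaleNr opprK [LHS]mulr1.
Qed.

Lemma continuous_Vshift_norm (y : R) : 0 < y ->
  continuous (fun x : R => (y + `|x|) ^- 2).
Proof.
move=> y0 x; apply: cvgV.
  by rewrite expf_neq0// gt_eqF// ltr_wpDr.
rewrite (_ : (fun x => _) = (fun x : R => (y + `|x|) * (y + `|x|))); last first.
  by apply/funext => z; rewrite expr2.
by rewrite expr2; apply: cvgM; (apply: cvgD; [exact: cvg_cst|apply: cvg_norm; exact: cvg_id]).
Qed.

(** Outside [[- y, y]] the integrand is at least [1 / (4 x^2)]: it is an envelope, defined on the
    whole line, for the tail of the off-diagonal prior. *)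
Lemma integral_Vshift_norm (y : R) : 0 < y ->
  (\int[mu]_x ((y + `|x|) ^- 2)%:E = (2 / y)%:E)%E.
Proof.
move=> y0; have cf := continuous_Vshift_norm y0.
have yx (x : R) : 0 <= x -> y + x != 0 by move=> x0; rewrite gt_eqF// ltr_wpDr.
rewrite ge0_symfun_integralT//; last 2 first.
- by move=> x; rewrite invr_ge0 sqr_ge0.
- by move=> x /=; rewrite normrN.
rewrite -set_itvcy (@ge0_continuous_FTC2y R (fun x : R => (y + `|x|) ^- 2) (fun x => - (y + x)^-1) 0 0).
- by rewrite addr0 -EFinB sub0r opprK -EFinM.
- by move=> x _; rewrite invr_ge0 sqr_ge0.
- exact: continuous_subspaceT.
- rewrite -oppr0; apply: cvgN; apply/gtr0_cvgV0.
    by near=> x; rewrite addr_gt0//; near: x; exact: nbhs_pinfty_gt.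
  exact: cvg_addrl.
- move=> x x0; have [] := is_derive_Vshift (yx _ (ltW x0)) => //.
- apply: cvg_at_right_filter.
  by have [/derivable1_diffP/differentiable_continuous h _] := is_derive_Vshift (yx 0 (lexx 0)).
- move=> x; rewrite in_itv /= andbT => x0.
  rewrite derive1E (@derive_val _ _ _ _ _ _ _ (is_derive_Vshift (yx _ (ltW x0)))).
  by rewrite ger0_norm// ltW.
Unshelve. all: by end_near.
Qed.

Lemma is_derive_mobius (K r : R) : r + K * (1 - r) != 0 -> K != 0 ->
  is_derive r 1 (fun r => r * (K * (r + K * (1 - r)))^-1 : R) ((r + K * (1 - r)) ^- 2).
Proof.
move=> q0 K0.
have h1 : is_derive r 1 (fun r => 1 - r : R) (0 - 1).
  exact: (is_deriveB (is_derive_cst (1 : R) r 1) (is_derive_id r 1)).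
have h2 : is_derive r 1 (fun r => r + K * (1 - r) : R) (1 + K * (0 - 1)).
  exact: (is_deriveD (is_derive_id r 1) (is_deriveZ K h1)).
have h : is_derive r 1 (fun r => K * (r + K * (1 - r)) : R) (K * (1 + K * (0 - 1))).
  exact: (is_deriveZ K h2).
have Kq : K * (r + K * (1 - r)) != 0 by rewrite mulf_neq0.
have hV := @is_deriveV R (fun r => K * (r + K * (1 - r))) r _ 1 Kq h.
have hM := is_deriveM (is_derive_id (r : R) 1) hV.
apply: (is_derive_eq hM).
by rewrite -![_ *: _]/(_ * _) /=; field; rewrite q0.
Qed.

(** The antiderivative is the Moebius map [r / (K (r + K (1 - r)))], which is 0 at 0 and [1 / K] at
    1. The integrand has the shape of the upper bound for [off_kernel]. *)
Lemma integral_mobius (K : R) : 0 < K ->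
  (\int[mu]_(r in `[0%R, 1%R]) ((r + K * (1 - r)) ^- 2)%:E = (K^-1)%:E)%E.
Proof.
move=> K0.
have q0 (r : R) : 0 <= r <= 1 -> 0 < r + K * (1 - r).
  move=> /andP[r0 r1]; have [->|rn] := eqVneq r 1; first by rewrite subrr mulr0 addr0.
  by rewrite ltr_wpDl// mulr_gt0// subr_gt0 lt_neqAle rn.
have dF (r : R) : 0 <= r <= 1 -> is_derive r 1 (fun r => r * (K * (r + K * (1 - r)))^-1 : R)
   ((r + K * (1 - r)) ^- 2).
  by move=> r01; apply: is_derive_mobius; rewrite gt_eqF ?q0.
have cF (r : R) : 0 <= r <= 1 -> {for r, continuous (fun r : R => r * (K * (r + K * (1 - r)))^-1 : R)}.
  by move=> r01; have [/derivable1_diffP/differentiable_continuous h _] := dF _ r01.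
rewrite (@continuous_FTC2 R (fun r : R => (r + K * (1 - r)) ^- 2) (fun r => r * (K * (r + K * (1 - r)))^-1)) ?ltr01//.
- by rewrite subrr mulr0 !addr0 mulr1 mul0r mul1r sube0.
- apply: continuous_in_subspaceT => r; rewrite inE /= in_itv /= => r01.
  apply: cvgV; first by rewrite expf_neq0// gt_eqF// q0.
  rewrite (_ : (fun x => _) = (fun x => (x + K * (1 - x)) * (x + K * (1 - x)))); last first.
    by apply/funext => z; rewrite expr2.
  rewrite expr2; apply: cvgM; apply: cvgD; try exact: cvg_id;
    by apply: cvgM; [exact: cvg_cst|apply: cvgB; [exact: cvg_cst|exact: cvg_id]].
- split.
  + by move=> r; rewrite in_itv /= => /andP[r0 r1]; have [] := dF r; rewrite ?ltW.
  + by apply: cvg_at_right_filter; apply: cF; rewrite lexx ler01.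
  + by apply: cvg_at_left_filter; apply: cF; rewrite lexx ler01.
- move=> r; rewrite in_itv /= => /andP[r0 r1].
  have r01 : 0 <= r <= 1 by rewrite !ltW.
  by rewrite derive1E (@derive_val _ _ _ _ _ _ _ (dF _ r01)).
Qed.

End ElementaryIntegrals.

(** Product of the normalising constants of the standard normal density and of Beta(1/2, 1/2). *)
Definition off_cst (R : realType) : R := (Num.sqrt (2 * pi) * betaB 2^-1 2^-1)^-1.

(** * Density and interval masses of an off-diagonal entry *)

Section OffDiagonalPrior.
Variable R : realType.
Let mu := @lebesgue_measure R.

Definition box (c e x : R) : bool := `|x - c| <= e.

Lemma box_itv c e x : box c e x = (x \in `[c - e, c + e]).
Proof. by rewrite in_itv /= /box ler_distl. Qed.

Lemma measurable_box c e : measurable_fun setT (fun x => (box c e x)%:R : R).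
Proof.
rewrite (_ : (fun x => _) = \1_(`[c - e, c + e]%classic)).
  by apply: measurable_indic.
by apply/funext => x; rewrite indicE box_itv mem_setE.
Qed.

Lemma integral_box c e : 0 <= e -> (\int[mu]_x (box c e x)%:R%:E = (2 * e)%:E)%E.
Proof.
move=> e0; transitivity (\int[mu]_(x in setT) (\1_(`[c - e, c + e]%classic) x)%:E)%E.
  by apply: eq_integral => x _; rewrite indicE box_itv mem_setE.
rewrite integral_indic// setIT [LHS]lebesgue_measure_itv /= lte_fin.
case: ltP => h; rewrite -?EFinD; congr (_%:E); lra.
Qed.

Variable tau1 : R.
Hypothesis tau1_gt0 : 0 < tau1.

Let Bc : R := betaB 2^-1 2^-1.
Hypothesis Bc_gt0 : 0 < Bc.
Let kc : R := off_cst R.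
Let kp := kc / tau1.
Let offp := offpdf 2^-1 2^-1 tau1 : R -> \bar R.

Let kc_gt0 : 0 < kc.
Proof. by rewrite /kc /off_cst invr_gt0 mulr_gt0// sqrtr_gt0 mulr_gt0// pi_gt0. Qed.

Let kp_gt0 : 0 < kp. Proof. by rewrite divr_gt0. Qed.

(** Integrand of [offpdf] for [a = b = 1/2]: the roots of [r] and [1 - r] in the two densities
    combine to [1 / r]. The cut-off extends it by 0 to the line, ready for Tonelli. *)
Definition off_kernel (s r : R) : R :=
  ((0 < r) && (r < 1))%:R * (kp * (r^-1 * expR (- (s ^+ 2 / (2 * tau1 ^+ 2) * ((1 - r) / r))))).

Lemma off_kernel_ge0 s r : 0 <= off_kernel s r.
Proof.
rewrite /off_kernel; case: andP => [[r0 r1]|_]; last by rewrite mul0r.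
by rewrite mul1r mulr_ge0 ?(ltW kp_gt0)// mulr_ge0 ?invr_ge0 ?(ltW r0) ?expR_ge0.
Qed.

Lemma powR_mhalf (r : R) : 0 <= r -> r `^ (2^-1 - 1) = (Num.sqrt r)^-1.
Proof.
move=> r0; have -> : 2^-1 - 1 = - 2^-1 :> R by field.
by rewrite powRN powR12_sqrt.
Qed.

Lemma off_kernelE s r : 0 < r < 1 ->
  normpdf (r / (1 - r) * tau1 ^+ 2) s * betapdf 2^-1 2^-1 r = off_kernel s r.
Proof.
move=> /[dup] r01 /andP[r0 r1]; rewrite /off_kernel /normpdf /betapdf r01 mul1r.
have r1' : 0 < 1 - r by rewrite subr_gt0.
rewrite !powR_mhalf ?ltW//.
have -> : Num.sqrt (2 * pi * (r / (1 - r) * tau1 ^+ 2)) =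
   Num.sqrt (2 * pi) * (Num.sqrt r / Num.sqrt (1 - r) * tau1).
  have p0 : 0 <= 2 * pi :> R by rewrite mulr_ge0// pi_ge0.
  have v0 : 0 <= r / (1 - r) by rewrite divr_ge0 ?ltW.
  rewrite (sqrtrM _ p0) (sqrtrM _ v0) (sqrtrM _ (ltW r0)) sqrtrV ?(ltW r1')//.
  by rewrite sqrtr_sqr gtr0_norm.
have -> : - s ^+ 2 / (2 * (r / (1 - r) * tau1 ^+ 2)) =
          - (s ^+ 2 / (2 * tau1 ^+ 2) * ((1 - r) / r)).
  by field; rewrite !gt_eqF.
have x0 : 0 < Num.sqrt r by rewrite sqrtr_gt0.
have y0 : 0 < Num.sqrt (1 - r) by rewrite sqrtr_gt0.
have p0 : 0 < Num.sqrt (2 * pi) :> R by rewrite sqrtr_gt0 mulr_gt0// pi_gt0.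
rewrite -[in RHS](sqr_sqrtr (ltW r0)).
set E := expR _; have -> : expR (- (s ^+ 2 / (2 * tau1 ^+ 2) * ((1 - Num.sqrt r ^+ 2) / Num.sqrt r ^+ 2))) = E.
  by rewrite /E sqr_sqrtr// ltW.
by rewrite /kp /kc /off_cst -/Bc; field; rewrite !gt_eqF.
Qed.

Lemma offpE s : offp s = (\int[mu]_r (off_kernel s r)%:E)%E.
Proof.
rewrite /offp /offpdf integral_mkcond; apply: eq_integral => r _.
rewrite patchE mem_setE in_itv /=; case: ifP => r01; first by rewrite off_kernelE.
by rewrite /off_kernel r01 mul0r.
Qed.

Lemma measurable_off_kernel disp (T : measurableType disp) (f g : T -> R) :
  measurable_fun setT f -> measurable_fun setT g ->
  measurable_fun setT (fun t => off_kernel (f t) (g t)).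
Proof.
move=> mf mg; apply: measurable_funM.
  rewrite (_ : (fun t => _) = (fun t => if 0 < g t then if g t < 1 then 1 else 0 else 0)); last first.
    by apply/funext => t; case: ltP => //= _; case: ltP.
  apply: measurable_fun_ifT; [|apply: measurable_fun_ifT|]; try exact: measurable_cst.
    by apply: measurable_fun_ltr => //; exact: measurable_cst.
  by apply: measurable_fun_ltr => //; exact: measurable_cst.
have mV := measurable_funV mg.
apply: measurable_funM; first exact: measurable_cst.
apply: measurable_funM => //; apply: measurableT_comp => //.
apply: measurableT_comp => //; apply: measurable_funM.
  by apply: measurable_funM; [exact: measurable_funX|exact: measurable_cst].
apply: measurable_funM => //.
by apply: measurable_funB => //; exact: measurable_cst.
Qed.

Lemma offp_ge0 s : (0 <= offp s)%E.
Proof. by rewrite offpE; apply: integral_ge0 => r _; rewrite lee_fin off_kernel_ge0. Qed.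

Lemma measurable_offp : measurable_fun setT offp.
Proof.
rewrite (_ : offp = (fun s => \int[mu]_r (off_kernel s r)%:E)%E); last exact/funext/offpE.
apply: (@measurable_fun_fubini_tonelli_F _ _ _ _ R mu (fun z => (off_kernel z.1 z.2)%:E)).
  by apply/measurable_EFinP; exact: measurable_off_kernel.
by move=> z; rewrite lee_fin off_kernel_ge0.
Qed.

Lemma integral_normpdf (v : R) : 0 < v -> (\int[mu]_s (normpdf v s)%:E = 1)%E.
Proof.
move=> v0; have iv0 : 0 < v^-1 by rewrite invr_gt0.
have := @integral_gauss1 R v^-1 0 iv0.
rewrite invrK => H.
have q0 : 0 < Num.sqrt (2 * pi * v) by rewrite sqrtr_gt0 !mulr_gt0// pi_gt0.
transitivity ((Num.sqrt (2 * pi * v))^-1%:E * (Num.sqrt (2 * pi * v))%:E)%E; last first.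
  by rewrite -EFinM mulVf// gt_eqF.
rewrite -H -ge0_integralZl//.
- apply: eq_integral => s _; rewrite /normpdf -EFinM mulrC; congr (_ * expR _)%:E.
  by rewrite addr0; field; rewrite gt_eqF.
- apply/measurable_EFinP; apply: measurable_expRN2.
  apply: measurable_funM; first exact: measurable_cst.
  by apply: measurable_funX; apply: measurable_funD.
Qed.

Lemma integral_offp : (\int[mu]_s offp s = 1)%E.
Proof.
under eq_integral => s _ do rewrite offpE.
rewrite (@fubini_tonelli _ _ _ _ R mu mu (fun z => (off_kernel z.1 z.2)%:E))/=; last 2 first.
- by apply/measurable_EFinP; exact: measurable_off_kernel.
- by move=> z; rewrite lee_fin off_kernel_ge0.
(* [Bc > 0] excludes an infinite beta integral, which [fine] would send to 0. *)
have BE : (\int[mu]_(r in `]0%R, 1%R[) ((r `^ (2^-1 - 1)) * ((1 - r) `^ (2^-1 - 1)))%:E = Bc%:E)%E.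
  rewrite /Bc /betaB fineK// ge0_fin_numE.
    by move: Bc_gt0; rewrite /Bc /betaB; case: (integral _ _ _) => [b|//|]; rewrite ?ltxx// ltry.
  by apply: integral_ge0 => r _; rewrite lee_fin mulr_ge0// powR_ge0.
transitivity (Bc^-1%:E * Bc%:E)%E; last by rewrite -EFinM mulVf// gt_eqF.
rewrite -BE -ge0_integralZl//.
- rewrite [RHS]integral_mkcond; apply: eq_integral => r _; rewrite patchE mem_setE in_itv /=.
  case: ifP => r01; last first.
    under eq_integral do rewrite /off_kernel r01 mul0r.
    exact: integral0.
  have /andP[r0 r1] := r01.
  under eq_integral => s _ do rewrite -off_kernelE// EFinM muleC.
  rewrite ge0_integralZl//.
  + rewrite integral_normpdf ?mule1; last first.
      by rewrite mulr_gt0 ?divr_gt0 ?subr_gt0 ?exprn_gt0.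
    by rewrite /betapdf r01 mulrC EFinM.
  + apply/measurable_EFinP; apply: measurable_funM; last exact: measurable_cst.
    apply: measurableT_comp => //; apply: measurable_funM; last exact: measurable_cst.
    by apply: measurableT_comp => //; exact: measurable_funX.
  + by move=> s _; rewrite lee_fin divr_ge0 ?expR_ge0 ?sqrtr_ge0.
  + by rewrite lee_fin /betapdf r01 divr_ge0 ?(ltW Bc_gt0)// mulr_ge0 ?powR_ge0.
- apply/measurable_EFinP; apply: measurable_funTS; apply: measurable_funM.
    exact: measurable_powR.
  by apply: (measurableT_comp (measurable_powR _)); apply: measurable_funB => //; exact: measurable_cst.
- by move=> r _; rewrite lee_fin mulr_ge0// powR_ge0.
- by rewrite lee_fin invr_ge0 ltW.
Qed.

(** With [- x] the exponent, [exp x >= (1 + x)^2 / 4] and [1 + x = (r + K (1 - r)) / r]. The kernel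
    is thus below a multiple of the derivative of a Moebius map; a factor [r <= 1] is dropped. *)
Lemma off_kernel_ub s r : 0 < s -> off_kernel s r <=
  ((0 < r) && (r < 1))%:R * (4 * kp * (r + s ^+ 2 / (2 * tau1 ^+ 2) * (1 - r)) ^- 2).
Proof.
move=> s0; rewrite /off_kernel; case: andP => [[r0 r1]|_]; last by rewrite !mul0r.
rewrite !mul1r; set K := s ^+ 2 / _.
have K0 : 0 < K by rewrite divr_gt0 ?mulr_gt0 ?exprn_gt0.
rewrite (mulrC 4 kp) -[leRHS]mulrA ler_wpM2l ?(ltW kp_gt0)//.
set x := K * ((1 - r) / r).
have x0 : 0 <= x by rewrite mulr_ge0 ?(ltW K0)// divr_ge0 ?(ltW r0)// subr_ge0 ltW.
have ex : (1 + x) ^+ 2 / 4 <= expR x.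
  rewrite [in leRHS](splitr x) expRD -expr2.
  apply: (@le_trans _ _ ((1 + x / 2) ^+ 2)); first by nra.
  rewrite ler_pXn2r ?nnegrE ?expR_ge0//; first exact: expR_ge1Dx.
  by rewrite addr_ge0// divr_ge0.
have q0 : 0 < r + K * (1 - r) by rewrite ltr_wpDr// mulr_ge0 ?(ltW K0)// subr_ge0 ltW.
apply: (@le_trans _ _ (r^-1 * (4 / (1 + x) ^+ 2))).
  rewrite ler_wpM2l ?invr_ge0 ?(ltW r0)// expRN -invf_div lef_pV2// posrE ?expR_gt0//.
  by rewrite divr_gt0// exprn_gt0// ltr_wpDr.
have -> : 1 + x = (r + K * (1 - r)) / r by rewrite /x; field; rewrite gt_eqF.
have -> : r^-1 * (4 / ((r + K * (1 - r)) / r) ^+ 2) = r * (4 * (r + K * (1 - r)) ^- 2).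
  by field; rewrite !gt_eqF.
rewrite mulrC; apply: ler_piMr; last exact: ltW.
by rewrite mulr_ge0// invr_ge0 sqr_ge0.
Qed.

(** Cauchy-type tails: integrated over [r], the kernel bound is [4 * kp / K], and [K] is
    proportional to [s ^+ 2]. *)
Lemma offp_ub_pos s : 0 < s -> (offp s <= (8 * kc * tau1 / s ^+ 2)%:E)%E.
Proof.
move=> s0; rewrite offpE; set K := s ^+ 2 / (2 * tau1 ^+ 2).
have K0 : 0 < K by rewrite divr_gt0 ?mulr_gt0 ?exprn_gt0.
apply: (@le_trans _ _ (\int[mu]_(r in `[0%R, 1%R]) ((4 * kp)%:E * ((r + K * (1 - r)) ^- 2)%:E))%E).
  rewrite [leRHS]integral_mkcond; apply: ge0_le_integralT => r.
    by rewrite lee_fin off_kernel_ge0.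
  rewrite patchE mem_setE in_itv /=.
  have := off_kernel_ub r s0; rewrite -/K.
  case: (boolP ((0 < r) && (r < 1))) => [/andP[r0 r1]|r01].
    by rewrite (ltW r0) (ltW r1) /= -EFinM lee_fin mul1r.
  rewrite mul0r => h; apply: (@le_trans _ _ 0%E); first by rewrite lee_fin.
  by case: ifP => // _; rewrite -EFinM lee_fin mulr_ge0 ?invr_ge0 ?sqr_ge0// mulr_ge0 ?(ltW kp_gt0).
rewrite ge0_integralZl//.
- rewrite integral_mobius// -EFinM lee_fin le_eqVlt; apply/orP; left; apply/eqP.
  by rewrite /K /kp; field; rewrite !gt_eqF.
- apply/measurable_EFinP; apply: measurable_funTS; apply: measurable_funV; apply: measurable_funX.
  apply: measurable_funD => //; apply: measurable_funM; first exact: measurable_cst.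
  by apply: measurable_funB => //; exact: measurable_cst.
- by move=> r _; rewrite lee_fin invr_ge0 sqr_ge0.
- by rewrite lee_fin mulr_ge0 ?(ltW kp_gt0).
Qed.

Lemma offpN s : offp (- s) = offp s.
Proof. by rewrite !offpE; apply: eq_integral => r _; rewrite /off_kernel sqrrN. Qed.

Lemma offp_ub s : s != 0 -> (offp s <= (8 * kc * tau1 / s ^+ 2)%:E)%E.
Proof.
move=> sn; have [s0|s0] := ltP 0 s; first exact: offp_ub_pos.
by rewrite -offpN -sqrrN; apply: offp_ub_pos; rewrite oppr_gt0 lt_neqAle sn.
Qed.

(** Only those [r] within order [1 / K] of 1 are kept: there the exponent is at least -1 and [1 / r]
    is at least 1. *)
Lemma offp_lb s S : s ^+ 2 <= S -> 2 * tau1 ^+ 2 <= S ->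
  ((kc * expR (-1) / 2 * tau1 / S)%:E <= offp s)%E.
Proof.
move=> sS tS; rewrite offpE; set K := S / (2 * tau1 ^+ 2).
have t2 : 0 < 2 * tau1 ^+ 2 by rewrite mulr_gt0 ?exprn_gt0.
have S0 : 0 < S by exact: lt_le_trans tS.
have K1 : 1 <= K by rewrite ler_pdivlMr// mul1r.
have K0 : 0 < K by lra.
have K8 : 0 < (8 * K)^-1 by rewrite invr_gt0; lra.
have kv : K * (8 * K)^-1 = 8^-1 by field; rewrite gt_eqF.
(* The window is [1 - 4 e <= r <= 1 - 2 e]. Since [K >= 1] it lies in [[1/2, 1)], and there
   [K * (1 - r) <= 1/2 <= r]. *)
set e := (8 * K)^-1 in K8 kv.
have e8 : e <= 8^-1 by rewrite -kv ler_peMl// ltW.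
apply: (@le_trans _ _ (\int[mu]_r ((kp * expR (-1))%:E * (box (1 - 3 * e) e r)%:R%:E))%E); last first.
  apply: ge0_le_integralT => r.
    by rewrite -EFinM lee_fin mulr_ge0// mulr_ge0 ?expR_ge0// ltW.
  rewrite -EFinM lee_fin; case: (boolP (box _ _ _)) => [|_]; last first.
    by rewrite mulr0 off_kernel_ge0.
  rewrite box_itv in_itv /= => /andP[rl ru].
  have r0 : 2^-1 <= r by lra.
  have r1 : r < 1 by lra.
  have r0' : 0 < r by lra.
  rewrite /off_kernel r1 r0' /= mul1r mulr1 ler_wpM2l ?(ltW kp_gt0)//.
  rewrite -[leLHS]mul1r; apply: ler_pM; rewrite ?expR_ge0//.
    by rewrite invf_ge1// ltW.
  rewrite ler_expR lerN2.
  apply: (@le_trans _ _ (K * ((1 - r) / r))).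
    rewrite ler_wpM2r ?divr_ge0 ?subr_ge0 ?(ltW r1) ?(ltW r0')//.
    by rewrite ler_pM2r ?invr_gt0.
  rewrite mulrA ler_pdivrMr// mul1r.
  have : K * (1 - r) <= K * (4 * e) by rewrite ler_wpM2l ?(ltW K0)//; lra.
  rewrite mulrCA kv; lra.
rewrite ge0_integralZl//.
- rewrite integral_box; last exact: ltW.
  rewrite -EFinM lee_fin le_eqVlt; apply/orP; left; apply/eqP.
  by rewrite /e /K /kp; field; rewrite !gt_eqF.
- by apply/measurable_EFinP; exact: measurable_box.
- by rewrite lee_fin mulr_ge0 ?expR_ge0// ltW.
Qed.

Let measI (b : R -> bool) : measurable_fun setT (fun x => (b x)%:R : R) ->
  measurable_fun setT (fun x => (b x)%:R%:E * offp x)%E.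
Proof.
by move=> mb; apply: emeasurable_funM; [exact/measurable_EFinP|exact: measurable_offp].
Qed.

Lemma off_mass_le1 c e : (\int[mu]_x ((box c e x)%:R%:E * offp x) <= 1)%E.
Proof.
rewrite -integral_offp; apply: ge0_le_integralT => x.
  by rewrite mule_ge0 ?lee_fin ?offp_ge0.
rewrite -[leRHS]mul1e lee_wpmul2r ?offp_ge0// lee_fin.
by case: box.
Qed.

Lemma off_mass_ub c e y : 0 <= e -> 0 < y -> y + e <= `|c| ->
  (\int[mu]_x ((box c e x)%:R%:E * offp x) <= (16 * kc * tau1 * e / y ^+ 2)%:E)%E.
Proof.
move=> e0 y0 yc.
apply: (@le_trans _ _ (\int[mu]_x ((8 * kc * tau1 / y ^+ 2)%:E * (box c e x)%:R%:E))%E).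
  apply: ge0_le_integralT => x; first by rewrite mule_ge0 ?lee_fin ?offp_ge0.
  case: (boolP (box c e x)) => [bx|_]; last by rewrite mul0e mule0.
  have yx : y <= `|x|.
    have := ler_normB c x; have : `|c| - `|x| <= `|c - x| by exact: lerB_dist.
    move: bx; rewrite /box distrC => ? ? ?; lra.
  have x0 : x != 0 by rewrite -normr_gt0; exact: lt_le_trans yx.
  rewrite mul1e mule1; apply: le_trans (offp_ub x0) _; rewrite lee_fin.
  rewrite ler_wpM2l ?mulr_ge0 ?(ltW kc_gt0) ?(ltW tau1_gt0)//.
  have x2 : 0 < x ^+ 2 by rewrite exprn_even_gt0.
  rewrite lef_pV2 ?posrE ?(exprn_gt0 2 y0)//.
  by rewrite -(real_normK (num_real x)) ler_pXn2r ?nnegrE// ltW.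
rewrite ge0_integralZl//.
- rewrite integral_box// -EFinM lee_fin le_eqVlt; apply/orP; left; apply/eqP.
  by field; rewrite gt_eqF.
- by apply/measurable_EFinP; exact: measurable_box.
- by rewrite lee_fin divr_ge0 ?sqr_ge0// !mulr_ge0 ?(ltW kc_gt0) ?(ltW tau1_gt0).
Qed.

(** The total mass is 1, and the mass outside is at most the integral of [32 kc tau1 / (y + |x|)^2],
    because [y + |x| <= 2 |x|] there. *)
Lemma off_mass0_lb y : 0 < y ->
  ((1 - 64 * kc * tau1 / y)%:E <= \int[mu]_x ((box 0 y x)%:R%:E * offp x))%E.
Proof.
move=> y0.
set I := (X in (_ <= X)%E).
have I1 : (I <= 1)%E by exact: off_mass_le1.
have I0 : (0 <= I)%E by apply: integral_ge0 => x _; rewrite mule_ge0 ?lee_fin ?offp_ge0.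
pose g (x : R) := ((32 * kc * tau1)%:E * ((y + `|x|) ^- 2)%:E)%E.
have mV : measurable_fun setT (fun x : R => (y + `|x|) ^- 2).
  by apply: continuous_measurable_fun; exact: continuous_Vshift_norm.
have gE : (\int[mu]_x g x = (64 * kc * tau1 / y)%:E)%E.
  rewrite ge0_integralZl//.
  - rewrite integral_Vshift_norm// -EFinM; congr (_%:E); field; by rewrite gt_eqF.
  - exact/measurable_EFinP.
  - by move=> x _; rewrite lee_fin invr_ge0 sqr_ge0.
  - by rewrite lee_fin !mulr_ge0 ?(ltW kc_gt0) ?(ltW tau1_gt0).
have g0 x : (0 <= g x)%E.
  rewrite mule_ge0// lee_fin ?invr_ge0 ?sqr_ge0//.
  by rewrite !mulr_ge0 ?(ltW kc_gt0) ?(ltW tau1_gt0).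
have : (1 <= I + (64 * kc * tau1 / y)%:E)%E.
  rewrite -integral_offp -gE -ge0_integralD//.
  - apply: ge0_le_integralT => x; first exact: offp_ge0.
    case: (boolP (box 0 y x)) => [_|]; first by rewrite mul1e leeDl.
    rewrite /box subr0 -ltNge mul0e add0e => yx.
    have x0 : x != 0 by rewrite -normr_gt0; exact: lt_trans yx.
    apply: le_trans (offp_ub x0) _; rewrite /g -EFinM lee_fin.
    have -> : 32 * kc * tau1 = 8 * kc * tau1 * 4 by ring.
    rewrite -[leRHS]mulrA ler_wpM2l ?mulr_ge0 ?(ltW kc_gt0) ?(ltW tau1_gt0)//.
    rewrite -(real_normK (num_real x)) -invf_div lef_pV2 ?posrE.
    + rewrite ler_pdivrMr//; move: (`|x|) yx => z yz; nra.
    + by rewrite exprn_gt0// (lt_trans y0).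
    + by rewrite divr_gt0// exprn_gt0// addr_gt0// (lt_trans y0).
  - by move=> x _; rewrite mule_ge0 ?lee_fin ?offp_ge0.
  - by apply: measI; exact: measurable_box.
  - apply: emeasurable_funM; first exact: measurable_cst.
    exact/measurable_EFinP.
move: I0 I1; case: (I) => [i| |]//.
rewrite -EFinD !lee_fin => ? ? ?; lra.
Qed.

Lemma off_mass_lb c e S : 0 <= e -> (`|c| + e) ^+ 2 <= S -> 2 * tau1 ^+ 2 <= S ->
  ((kc * expR (-1) * tau1 * e / S)%:E <= \int[mu]_x ((box c e x)%:R%:E * offp x))%E.
Proof.
move=> e0 cS tS.
have S0 : 0 < S by apply: lt_le_trans tS; rewrite mulr_gt0 ?exprn_gt0.
have K0 : 0 <= kc * expR (-1) / 2 * tau1 / S.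
  by rewrite divr_ge0 ?(ltW S0)// mulr_ge0 ?(ltW tau1_gt0)// divr_ge0// mulr_ge0 ?expR_ge0 ?(ltW kc_gt0).
apply: (@le_trans _ _ (\int[mu]_x ((kc * expR (-1) / 2 * tau1 / S)%:E * (box c e x)%:R%:E))%E); last first.
  apply: ge0_le_integralT => x; first by rewrite mule_ge0 ?lee_fin.
  case: (boolP (box c e x)) => [bx|_]; last by rewrite mul0e mule0.
  rewrite mul1e mule1; apply: offp_lb => //; apply: le_trans cS.
  rewrite -(real_normK (num_real x)) ler_pXn2r ?nnegrE ?addr_ge0//.
  have : `|x| - `|c| <= `|x - c| by exact: lerB_dist.
  move: bx; rewrite /box => ? ?; lra.
rewrite ge0_integralZl//.
- rewrite integral_box// -EFinM lee_fin le_eqVlt; apply/orP; left; apply/eqP.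
  by field; rewrite gt_eqF.
- by apply/measurable_EFinP; exact: measurable_box.
Qed.

End OffDiagonalPrior.

Section DiagonalPrior.
Variable R : realType.
Let mu := @lebesgue_measure R.
Variable rate : R.
Hypothesis rate_gt0 : 0 < rate.

Lemma gamma1pdf_ge0 x : 0 <= gamma1pdf rate x.
Proof. by rewrite /gamma1pdf; case: ifP => // _; rewrite mulr_ge0 ?expR_ge0// ltW. Qed.

Lemma gamma1pdf_le x : gamma1pdf rate x <= rate.
Proof.
rewrite /gamma1pdf; case: ifP => [x0|_]; last exact: ltW.
rewrite ler_piMr ?(ltW rate_gt0)// -expR0 ler_expR mulNr oppr_le0.
by rewrite mulr_ge0 ?(ltW rate_gt0)// ltW.
Qed.

Lemma measurable_gamma1pdf : measurable_fun setT (gamma1pdf rate).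
Proof.
apply: measurable_fun_ifT.
- by apply: measurable_fun_ltr => //; exact: measurable_cst.
- apply: measurable_funM; first exact: measurable_cst.
  by apply: measurableT_comp => //; apply: measurable_funM => //; exact: measurable_cst.
- exact: measurable_cst.
Qed.

Lemma gamma_mass_ub c e : 0 <= e ->
  (\int[mu]_x ((box c e x)%:R%:E * (gamma1pdf rate x)%:E) <= (rate * (2 * e))%:E)%E.
Proof.
move=> e0; rewrite EFinM -(integral_box c e0) -ge0_integralZl//.
- apply: ge0_le_integralT => x; first by rewrite mule_ge0 ?lee_fin ?gamma1pdf_ge0.
  by rewrite muleC lee_wpmul2r ?lee_fin// gamma1pdf_le.
- by apply/measurable_EFinP; exact: measurable_box.
- by rewrite lee_fin ltW.
Qed.

Lemma gamma_mass_lb c e U : 0 <= e -> 0 < c - e -> c + e <= U ->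
  ((rate * expR (- rate * U) * (2 * e))%:E <=
   \int[mu]_x ((box c e x)%:R%:E * (gamma1pdf rate x)%:E))%E.
Proof.
move=> e0 ce cU.
have k0 : 0 <= rate * expR (- rate * U) by rewrite mulr_ge0 ?expR_ge0// ltW.
rewrite EFinM -(integral_box c e0) -ge0_integralZl//.
- apply: ge0_le_integralT => x; first by rewrite mule_ge0 ?lee_fin.
  case: (boolP (box c e x)) => [|_]; last by rewrite mul0e mule0.
  rewrite box_itv in_itv /= => /andP[xl xu].
  rewrite mule1 mul1e lee_fin /gamma1pdf ifT; last by lra.
  by rewrite ler_pM2l// ler_expR !mulNr lerN2 ler_pM2l//; lra.
- by apply/measurable_EFinP; exact: measurable_box.
Qed.

End DiagonalPrior.

(** * Coordinates of symmetric matrices *)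

Section Coordinates.

(** The inverse of [symidx], obtained by walking through the pairs [j <= k] column after column
    rather than by solving a quadratic equation. *)
Fixpoint symdec (i : nat) : nat * nat :=
  if i is i'.+1 then
    let jk := symdec i' in if (jk.1 < jk.2)%N then (jk.1.+1, jk.2) else (0%N, jk.2.+1)
  else (0%N, 0%N).

Lemma symdimS k : symdim k.+1 = (symdim k + k.+1)%N.
Proof.
rewrite /symdim (_ : k.+1 * k.+2 = k * k.+1 + k.+1.*2)%N; last lia.
by rewrite halfD odd_double andbF add0n doubleK.
Qed.

Lemma symidxE j k : symidx j k = (symdim k + j)%N. Proof. by []. Qed.

Lemma leq_symdim k l : (k <= l)%N -> (symdim k <= symdim l)%N.
Proof.
elim: l => [|l IH]; first by rewrite leqn0 => /eqP ->.
rewrite leq_eqVlt => /predU1P[->//|]; rewrite ltnS => /IH h.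
by rewrite symdimS (leq_trans h)// leq_addr.
Qed.

Lemma symdecP i : ((symdec i).1 <= (symdec i).2)%N /\ symidx (symdec i).1 (symdec i).2 = i.
Proof.
elim: i => [//|i [le E]] /=; case: ltnP => h /=.
  by split=> //; rewrite symidxE addnS -symidxE E.
have e : (symdec i).1 = (symdec i).2 by apply/eqP; rewrite eqn_leq le.
by split=> //; rewrite symidxE addn0 symdimS addnS -symidxE -{1}e E.
Qed.

Lemma symdecS i : symdec i.+1 = if ((symdec i).1 < (symdec i).2)%N
  then ((symdec i).1.+1, (symdec i).2) else (0%N, (symdec i).2.+1).
Proof. by []. Qed.

Lemma symidxK j k : (j <= k)%N -> symdec (symidx j k) = (j, k).
Proof.
elim: k j => [|k IHk] j.
  by rewrite leqn0 => /eqP ->.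
elim: j => [_|j IHj jk].
  by rewrite symidxE addn0 symdimS addnS -symidxE symdecS IHk//= ltnn.
by rewrite symidxE addnS -symidxE symdecS IHj ?(ltnW jk)//= jk.
Qed.

Lemma symidx_lt j k p : (j <= k)%N -> (k < p)%N -> (symidx j k < symdim p)%N.
Proof.
move=> jk kp; apply: leq_trans (leq_symdim kp).
by rewrite symdimS symidxE addnS ltnS leq_add2l.
Qed.

Lemma symdec_lt i p : (i < symdim p)%N -> ((symdec i).2 < p)%N.
Proof.
move=> ip; rewrite ltnNge; apply/negP => pk.
have [_ E] := symdecP i; move: ip; rewrite -E ltnNge => /negP; apply.
by rewrite symidxE (leq_trans (leq_symdim pk))// leq_addr.
Qed.

Lemma symdec1_lt i p : (i < symdim p)%N -> ((symdec i).1 < p)%N.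
Proof. by move=> ip; have [le _] := symdecP i; exact: leq_ltn_trans le (symdec_lt ip). Qed.

(** A product over coordinates becomes [p] diagonal factors and fewer than [p * p] off-diagonal
    ones, the form in which all masses are estimated. *)
Lemma big_symdim (V : Type) (idx : V) (op : Monoid.com_law idx) p (G : nat -> nat -> V) :
  \big[op/idx]_(i < symdim p) G (symdec i).1 (symdec i).2 =
  op (\big[op/idx]_(j < p) G j j)
     (\big[op/idx]_(jk : 'I_p * 'I_p | (jk.1 < jk.2)%N) G jk.1 jk.2).
Proof.
case: p => [|p].
  rewrite !big_ord0 big1 ?Monoid.mulm1// => -[[]]//.
have d0 : (0 < symdim p.+1)%N by rewrite symdimS addnS.
(* [inord] lands in an ordinal type of successor form, hence the detour through [d.+1] and
   [cast_ord]. *)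
case E : (symdim p.+1) d0 => [//|d] _; rewrite -E.
pose h (jk : 'I_p.+1 * 'I_p.+1) : 'I_(symdim p.+1) := cast_ord (esym E) (inord (symidx jk.1 jk.2)).
pose h' (i : 'I_(symdim p.+1)) : 'I_p.+1 * 'I_p.+1 := (inord (symdec i).1, inord (symdec i).2).
have hE (jk : 'I_p.+1 * 'I_p.+1) : (jk.1 <= jk.2)%N -> h jk = symidx jk.1 jk.2 :> nat.
  by move=> le; rewrite /= inordK// -E symidx_lt.
have h1 i : ((h' i).1 : nat) = (symdec i).1 by rewrite /= inordK ?symdec1_lt.
have h2 i : ((h' i).2 : nat) = (symdec i).2 by rewrite /= inordK ?symdec_lt.
rewrite (reindex_onto h h') /=; last first.
  move=> i _; apply/val_inj; have [le e] := symdecP i.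
  by rewrite [LHS]hE ?h1 ?h2.
transitivity (\big[op/idx]_(jk : 'I_p.+1 * 'I_p.+1 | (jk.1 <= jk.2)%N) G jk.1 jk.2).
  apply: eq_big => [jk|jk /eqP hh].
    apply/eqP/idP => [<-|le]; first by rewrite h1 h2; have [] := symdecP (h jk).
    case: jk le => j k /= le; congr (_, _); apply/val_inj.
      by rewrite -[LHS]/(((h' (h (j, k))).1 : nat)) h1 hE// symidxK.
    by rewrite -[LHS]/(((h' (h (j, k))).2 : nat)) h2 hE// symidxK.
  have le : (jk.1 <= jk.2)%N by rewrite -hh h1 h2; have [] := symdecP (h jk).
  by rewrite inordK -?E ?symidx_lt// symidxK.
rewrite [LHS](bigID (fun jk : 'I_p.+1 * 'I_p.+1 => jk.1 == jk.2)) /=; congr (op _ _).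
  rewrite (reindex_onto (fun j => (j, j)) fst) /=; last first.
    by move=> [j k] /= /andP[_ /eqP ->].
  by apply: eq_bigl => j; rewrite leqnn !eqxx.
apply: eq_bigl => -[j k] /=; rewrite ltn_neqAle andbC; congr (_ && _).
Qed.

Variable R : realType.

Definition symcoord p (S : 'M[R]_p.+1) : nat -> R :=
  fun i => S (inord (symdec i).1) (inord (symdec i).2).

Lemma mxsym_symcoord p (S : 'M[R]_p.+1) : S^T = S -> mxsym p.+1 (symcoord S) = S.
Proof.
move=> ST; apply/matrixP => i j; rewrite mxE /symcoord.
have le : (minn i j <= maxn i j)%N by rewrite leq_max geq_minl.
rewrite symidxK//=; case: (leqP i j) => ij; first by rewrite !inord_val.
by rewrite !inord_val -[in LHS]ST mxE.
Qed.

Lemma mxsym_tr p (th : nat -> R) : (mxsym p th)^T = mxsym p th.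
Proof. by apply/matrixP => i j; rewrite !mxE minnC maxnC. Qed.

Lemma mxsymE p (th : nat -> R) i (ip : (i < symdim p)%N) :
  mxsym p th (Ordinal (symdec1_lt ip)) (Ordinal (symdec_lt ip)) = th i.
Proof.
rewrite mxE /=; have [le E] := symdecP i.
by rewrite (minn_idPl le) (maxn_idPr le) E.
Qed.

Lemma frob2_mxsym_le p (th th' : nat -> R) e :
  (forall i, (i < symdim p)%N -> `|th i - th' i| <= e) ->
  frob2 (mxsym p th - mxsym p th') <= (p%:R * e) ^+ 2.
Proof.
move=> h.
have -> : (p%:R * e) ^+ 2 = \sum_(i < p) \sum_(j < p) e ^+ 2.
  by rewrite !sumr_const !card_ord -(mulr_natr (_ *+ p)) -(mulr_natr (e ^+ 2)); ring.
apply: ler_sum => i _; apply: ler_sum => j _; rewrite !mxE.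
have le : (minn i j <= maxn i j)%N by rewrite leq_max geq_minl.
have lt : (symidx (minn i j) (maxn i j) < symdim p)%N by rewrite symidx_lt// gtn_max !ltn_ord.
have := h _ lt; move: (th _) (th' _) => x y xy.
rewrite -(real_normK (num_real (x - y))) ler_pXn2r ?nnegrE//.
exact: le_trans xy.
Qed.

Definition prior1 (tau1 lam : R) (i : nat) : R -> \bar R :=
  if (symdec i).1 == (symdec i).2 then fun x => (gamma1pdf (lam / 2) x)%:E
  else offpdf 2^-1 2^-1 tau1.

Lemma eprodE (s : seq (\bar R)) : eprod s = (\prod_(x <- s) x)%E.
Proof. by elim: s => [|x s IH]; rewrite ?big_nil ?big_cons //= IH. Qed.

Lemma prior_uE p tau1 lam (th : nat -> R) :
  prior_u 2^-1 2^-1 tau1 lam (mxsym p th) =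
  (\prod_(i < symdim p) prior1 tau1 lam i (th i))%E.
Proof.
pose G j k : \bar R := if j == k then (gamma1pdf (lam / 2) (th (symidx j k)))%:E
                       else offpdf 2^-1 2^-1 tau1 (th (symidx j k)).
transitivity (\prod_(i < symdim p) G (symdec i).1 (symdec i).2)%E; last first.
  apply: eq_bigr => i _; have [_ E] := symdecP i.
  by rewrite /G /prior1 E; case: ifP.
rewrite big_symdim /prior_u !eprodE !big_map !big_enum /=; congr (_ * _)%E.
  by apply: eq_bigr => j _; rewrite /G eqxx mxE minnn maxnn.
apply: eq_big => [jk|jk /set_mem/= lt]; first by apply/idP/idP => [/set_mem|/mem_set].
rewrite /G (ltn_eqF lt) mxE.
by rewrite (minn_idPl (ltnW lt)) (maxn_idPr (ltnW lt)).
Qed.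

Lemma prod_ffun_boxes d (J : finType) (c : J -> R) e (g : 'I_d -> R -> \bar R)
    (f : {ffun 'I_d -> J}) (th : nat -> R) :
  ([forall i, box (c (f i)) e (th i)]%:R%:E * \prod_i g i (th i) =
   \prod_i ((box (c (f i)) e (th i))%:R%:E * g i (th i)))%E.
Proof.
case: (boolP [forall i, _]) => [/forallP h|].
  by rewrite mul1e; apply: eq_bigr => i _; rewrite h mul1e.
rewrite negb_forall => /existsP[i hi]; rewrite mul0e (bigD1 i)//=.
by rewrite (negbTE hi) mul0e mul0e.
Qed.

Lemma intRn_prod_ord d (g : 'I_d -> R -> \bar R) :
  (forall i x, (0 <= g i x)%E) -> (forall i, measurable_fun setT (g i)) ->
  intRn d (fun v => \prod_(i < d) g i (v i))%E =
  (\prod_(i < d) \int[@lebesgue_measure R]_x g i x)%E.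
Proof.
move=> g0 mg; pose g' k : R -> \bar R := oapp g (fun=> 0%E) (insub k).
have E (i : 'I_d) : g' i = g i by rewrite /g' valK.
transitivity (intRn d (fun v => \prod_(i < d) g' i (v i))%E).
  by apply: eq_intRn => v; apply: eq_bigr => i _; rewrite E.
rewrite intRn_prod.
- by apply: eq_bigr => i _; rewrite E.
- by move=> i x; rewrite /g'; case: insub => [j|] /=.
- by move=> i; rewrite /g'; case: insub => [j|] /=; [exact: mg|exact: measurable_cst].
Qed.

End Coordinates.

(** * Balls inside the eigenvalue constraint *)

Section Neighbourhoods.
Variable R : realType.

Lemma frob2_qbnd n (S : 'M[R]_n) c : qbnd S (- c) c -> frob2 S <= n%:R * c ^+ 2.
Proof.
move=> Sb; have [P [d [PP SE]]] := sym_spectral Sb.1.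
have db : forall i, - c <= d 0 i <= c by apply/(qbnd_spectral _ _ _ PP); rewrite -SE.
rewrite SE frob2_orth// frob2_diag.
have -> : n%:R * c ^+ 2 = \sum_(i < n) c ^+ 2 by rewrite sumr_const card_ord mulr_natl.
apply: ler_sum => i _; have /andP[h1 h2] := db i.
by rewrite -subr_ge0 subr_sqr mulr_ge0//; [rewrite subr_ge0|rewrite addrC -lerBlDr sub0r].
Qed.

Lemma frob2D n (A B : 'M[R]_n) : frob2 (A + B) <= 2 * (frob2 A + frob2 B).
Proof.
rewrite /frob2 -big_split /= mulr_sumr; apply: ler_sum => i _.
rewrite -big_split /= mulr_sumr; apply: ler_sum => j _; rewrite mxE.
have h (x y : R) : (x + y) ^+ 2 <= 2 * (x ^+ 2 + y ^+ 2).
  by have := sqr_ge0 (x - y); rewrite sqrrB sqrrD; lra.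
exact: h.
Qed.

Lemma frob2Z n c (A : 'M[R]_n) : frob2 (c *: A) = c ^+ 2 * frob2 A.
Proof.
rewrite /frob2 mulr_sumr; apply: eq_bigr => i _; rewrite mulr_sumr.
by apply: eq_bigr => j _; rewrite mxE exprMn.
Qed.

Lemma qbnd1 n : qbnd (1%:M : 'M[R]_n) 1 1.
Proof. by split=> [|x]; rewrite ?trmx1// qform1 mul1r lexx. Qed.

Lemma entry_qbnd n (S : 'M[R]_n) lo hi i j : 0 < lo -> 0 <= hi -> qbnd S lo hi ->
  `|S i j| <= hi.
Proof.
move=> lo0 hi0 Sb; have := nrm2_mul_qbnd (delta_mx j 0) lo0 hi0 Sb.
rewrite -colE !nrm2E (bigD1 i)//= mxE.
rewrite [X in _ <= _ * X](bigD1 j)//= [X in _ <= _ * (_ + X)]big1; last first.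
  by move=> k kj; rewrite mxE (negbTE kj) expr0n.
rewrite addr0 mxE !eqxx expr1n mulr1 => h.
have : S i j ^+ 2 <= hi ^+ 2.
  by apply: le_trans h; rewrite lerDl sumr_ge0// => k _; exact: sqr_ge0.
by rewrite -(real_normK (num_real (S i j))) ler_pXn2r ?nnegrE.
Qed.

(* Moving [S0] a little towards the identity leaves room for a whole ball inside [U(tau)], even when an eigenvalue of [S0] sits on the boundary. *)
Definition shrunk n (S0 : 'M[R]_n) (del : R) := (1 - del) *: S0 + del *: 1%:M.

Lemma shrunk_tr n (S0 : 'M[R]_n) del : S0^T = S0 -> (shrunk S0 del)^T = shrunk S0 del.
Proof. by move=> ST; rewrite /shrunk linearD /= !linearZ /= ST trmx1. Qed.

Lemma shrunk_off n (S0 : 'M[R]_n) del i j : i != j -> shrunk S0 del i j = (1 - del) * S0 i j.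
Proof. by move=> ij; rewrite !mxE (negbTE ij) mulr0 addr0. Qed.

(** For [tau >= 3], moving by [del] towards the identity gains at least [del / 2] at both ends of
    [[1 / tau, tau]], room for a perturbation of Frobenius norm [del / 2]. The price is the
    displacement [del *: (S0 - 1%:M)], of squared norm at most [n.+1 * tau^2 * del^2]. *)
Lemma shrunk_ball n (S0 S : 'M[R]_n.+1) tau del : 3 <= tau -> 0 < del <= 1 ->
  qbnd S0 tau^-1 tau -> S^T = S -> frob2 (S - shrunk S0 del) <= (del / 2) ^+ 2 ->
  qbnd S tau^-1 tau /\ frob2 (S0 - S) <= 3 * n.+1%:R * tau ^+ 2 * del ^+ 2.
Proof.
move=> t3 /andP[d0 d1] S0b ST SF; have t0 : 0 < tau by lra.
have it3 : tau^-1 <= 3^-1 by rewrite lef_pV2 ?posrE//; lra.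
have it0 : 0 < tau^-1 by rewrite invr_gt0.
have h0 : 0 <= del / 2 by lra.
have ET : (S - shrunk S0 del)^T = S - shrunk S0 del.
  by rewrite linearB /= ST shrunk_tr ?S0b.1.
have Eb := qbnd_frob h0 ET SF.
have Sb : qbnd (shrunk S0 del) ((1 - del) * tau^-1 + del * 1) ((1 - del) * tau + del * 1).
  by apply: qbndD; apply: qbndZ; rewrite ?subr_ge0 ?(ltW d0)//; exact: qbnd1.
split.
  have := qbndD Eb Sb; rewrite subrK; apply: qbnd_sub; nra.
have -> : S0 - S = - (S - shrunk S0 del) + del *: (S0 - 1%:M).
  by apply/matrixP => i j; rewrite !mxE; ring.
apply: le_trans (frob2D _ _) _; rewrite frob2N frob2Z.
have Ib : qbnd (S0 - 1%:M) (- tau) tau.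
  by have := qbndD S0b (qbndN (qbnd1 n.+1)); apply: qbnd_sub; lra.
have IF := frob2_qbnd Ib.
have n1 : 1 <= n.+1%:R :> R by rewrite ler1n.
have A1 : del ^+ 2 * frob2 (S0 - 1%:M) <= del ^+ 2 * (n.+1%:R * tau ^+ 2).
  by rewrite ler_wpM2l ?sqr_ge0.
have A2 : 1 <= n.+1%:R * tau ^+ 2 by nra.
have A3 : del ^+ 2 * 1 <= del ^+ 2 * (n.+1%:R * tau ^+ 2) by rewrite ler_wpM2l ?sqr_ge0.
rewrite expr_div_n in SF; nra.
Qed.

(** A cell that meets [U(tau)] may stick out of it; its points still satisfy eigenvalue bounds with
    [2 * T]. *)
Lemma qbnd_perturb n (S S' : 'M[R]_n) T : 1 <= T -> qbnd S T^-1 T -> S'^T = S' ->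
  frob2 (S' - S) <= ((2 * T)^-1) ^+ 2 -> qbnd S' (2 * T)^-1 (2 * T).
Proof.
move=> T1 Sb ST' SF.
have T0 : 0 < T by lra.
have iT0 : 0 < T^-1 by rewrite invr_gt0.
have iT1 : T^-1 <= 1 by rewrite invf_le1.
have e : (2 * T)^-1 = T^-1 / 2 by field; rewrite gt_eqF.
have h0 : 0 <= (2 * T)^-1 by rewrite e; lra.
have ET : (S' - S)^T = S' - S by rewrite linearB /= ST' Sb.1.
have := qbndD (qbnd_frob h0 ET SF) Sb; rewrite subrK; apply: qbnd_sub; rewrite e; lra.
Qed.

End Neighbourhoods.

Section CellSums.
Variable R : realType.

Definition ndist (j L : nat) : nat := ((j - L) + (L - j))%N.

Lemma sum_ndist L (F : nat -> R) :
  \sum_(j < L + L.+1) F (ndist j L) = F 0%N + 2 * \sum_(m < L) F m.+1.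
Proof.
rewrite big_split_ord /= big_ord_recl /= addn0 {2}/ndist subnn addn0.
rewrite [X in X + _ = _](_ : _ = \sum_(m < L) F m.+1); last first.
  rewrite (reindex_inj rev_ord_inj) /=; apply: eq_bigr => m _.
  by congr F; rewrite /ndist; have := ltn_ord m; lia.
rewrite [X in _ + (_ + X) = _](_ : _ = \sum_(m < L) F m.+1); first by ring.
by apply: eq_bigr => m _; congr F; rewrite /ndist /= ?/bump /=; lia.
Qed.

Lemma harmonic_le (L : nat) : (0 < L)%N -> \sum_(m < L) (m.+1%:R : R)^-1 <= 1 + ln L%:R.
Proof.
case: L => [//|L] _; elim: L => [|L IH].
  by rewrite big_ord_recl big_ord0 addr0 invr1 ln1 addr0.
rewrite big_ord_recr /=; apply: (@le_trans _ _ (1 + ln L.+1%:R + L.+2%:R^-1)).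
  by rewrite lerD2r.
rewrite -addrA lerD2l.
have p1 : 0 < L.+1%:R :> R by rewrite ltr0n.
have p2 : 0 < L.+2%:R :> R by rewrite ltr0n.
(* [ln (1 - 1 / (L + 2)) <= - 1 / (L + 2)]: the increment of the logarithm pays for the new term. *)
have := @le_ln1Dx R (- L.+2%:R^-1).
have -> : 1 + - L.+2%:R^-1 = L.+1%:R / L.+2%:R :> R.
  have -> : L.+1%:R = L.+2%:R - 1 :> R by rewrite -[L.+2]addn1 natrD addrK.
  by field; rewrite gt_eqF.
rewrite ln_div ?posrE// => h.
have : ln L.+1%:R - ln L.+2%:R <= - L.+2%:R^-1 :> R.
  by apply: h; rewrite ltrN2 invf_lt1 ?ltr1n// ltr0n.
by rewrite lerBlDr (addrC (- _)) -lerBrDr.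
Qed.

End CellSums.

(** * Masses and weights of the grid cells *)

Section PriorMasses.
Variable R : realType.
Variables (tau1 lam : R).
Hypotheses (tau1_gt0 : 0 < tau1) (lam_gt0 : 0 < lam) (Bc_gt0 : 0 < betaB 2^-1 2^-1 :> R).
Let kc : R := off_cst R.
Let kc_gt0 : 0 < kc.
Proof. by rewrite /kc /off_cst invr_gt0 mulr_gt0// sqrtr_gt0 mulr_gt0// pi_gt0. Qed.
Let lam2_gt0 : 0 < lam / 2. Proof. by rewrite divr_gt0. Qed.

Definition isdiag (i : nat) : bool := (symdec i).1 == (symdec i).2.

Definition mass (i : nat) (c e : R) : \bar R :=
  (\int[@lebesgue_measure R]_x ((box c e x)%:R%:E * prior1 tau1 lam i x))%E.

Lemma prior1_ge0 i x : (0 <= prior1 tau1 lam i x)%E.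
Proof.
rewrite /prior1; case: ifP => _; last exact: offp_ge0.
by rewrite lee_fin gamma1pdf_ge0.
Qed.

Lemma measurable_prior1 i : measurable_fun setT (prior1 tau1 lam i).
Proof.
rewrite /prior1; case: ifP => _; last exact: measurable_offp.
by apply/measurable_EFinP; exact: measurable_gamma1pdf.
Qed.

Lemma cmeas_boxes (J : finType) d (c : J -> R) e (f : 'I_d -> J) :
  cmeas (fun th : nat -> R => ([forall i, box (c (f i)) e (th i)])%:R%:E).
Proof.
have -> : (fun th : nat -> R => ([forall i, box (c (f i)) e (th i)])%:R%:E : \bar R) =
    (fun th : nat -> R => \prod_(i < d) (box (c (f i)) e (th i))%:R%:E)%E.
  apply: funext => th; case: (boolP [forall i, _]) => [/forallP h|].
    by rewrite big1// => i _; rewrite h.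
  rewrite negb_forall => /existsP[i hi]; rewrite (bigD1 i)//=.
  by rewrite (negbTE hi) mul0e.
apply: cmeas_prod => i; apply: (@cmeas_coord _ i (fun x => (box (c (f i)) e x)%:R%:E)).
by apply/measurable_EFinP; exact: measurable_box.
Qed.

Lemma intRn_boxes (J : finType) d (c : J -> R) e (f : {ffun 'I_d -> J}) :
  intRn d (fun th => ([forall i, box (c (f i)) e (th i)])%:R%:E *
     \prod_(i < d) prior1 tau1 lam i (th i))%E =
  (\prod_(i < d) mass i (c (f i)) e)%E.
Proof.
rewrite -(@intRn_prod_ord _ d (fun i x => (box (c (f i)) e x)%:R%:E * prior1 tau1 lam i x)%E).
- by apply: eq_intRn => th; rewrite (prod_ffun_boxes c e (fun i => prior1 tau1 lam i)).
- by move=> i x; rewrite mule_ge0 ?lee_fin ?prior1_ge0.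
- move=> i; apply: emeasurable_funM; last exact: measurable_prior1.
  by apply/measurable_EFinP; exact: measurable_box.
Qed.

Lemma lee_prod_fin (I : Type) (r : seq I) (f : I -> \bar R) (g : I -> R) :
  (forall i, 0 <= f i)%E -> (forall i, f i <= (g i)%:E)%E ->
  (\prod_(i <- r) f i <= (\prod_(i <- r) g i)%:E)%E.
Proof.
move=> f0 fg; elim: r => [|i r IH]; first by rewrite !big_nil.
by rewrite !big_cons EFinM lee_pmul// prode_ge0.
Qed.

Lemma gee_prod_fin (I : Type) (r : seq I) (f : I -> \bar R) (g : I -> R) :
  (forall i, 0 <= g i) -> (forall i, (g i)%:E <= f i)%E ->
  ((\prod_(i <- r) g i)%:E <= \prod_(i <- r) f i)%E.
Proof.
move=> g0 gf; elim: r => [|i r IH]; first by rewrite !big_nil.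
by rewrite !big_cons EFinM lee_pmul ?lee_fin// prodr_ge0.
Qed.

Lemma mass_ge0 i c e : (0 <= mass i c e)%E.
Proof. by apply: integral_ge0 => x _; rewrite mule_ge0 ?lee_fin ?prior1_ge0. Qed.

Lemma massE_diag i c e : isdiag i ->
  mass i c e = (\int[@lebesgue_measure R]_x ((box c e x)%:R%:E * (gamma1pdf (lam / 2) x)%:E))%E.
Proof. by rewrite /mass /prior1 /isdiag => ->. Qed.

Lemma massE_off i c e : ~~ isdiag i ->
  mass i c e = (\int[@lebesgue_measure R]_x ((box c e x)%:R%:E * offpdf 2^-1 2^-1 tau1 x))%E.
Proof. by rewrite /mass /prior1 /isdiag => /negbTE ->. Qed.

Lemma mass_fin i c e : 0 <= e -> (mass i c e \is a fin_num)%E.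
Proof.
move=> e0; rewrite ge0_fin_numE ?mass_ge0//.
have [di|ndi] := boolP (isdiag i).
  by rewrite massE_diag//; apply: le_lt_trans (gamma_mass_ub lam2_gt0 c e0) _; rewrite ltry.
by rewrite massE_off//; apply: le_lt_trans (off_mass_le1 tau1_gt0 Bc_gt0 c e) _; rewrite ltry.
Qed.

Section Cells.
Variables (t : R) (L : nat).
Hypotheses (t_gt0 : 0 < t).

Let q := 32 * kc * tau1 / t.
Let q_gt0 : 0 < q. Proof. by rewrite divr_gt0// !mulr_gt0. Qed.

(** The indices [0 .. 2 L] are centred at [L], and [ndist j L] is the distance of the grid point to
    0 in units of the mesh. *)
Definition grid (j : nat) : R := (j%:R - L%:R) * t.

Definition cell_bound (i m : nat) : R :=
  if isdiag i then lam / 2 * t else if m == 0%N then 1 else q / m%:R ^+ 2.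

Lemma ndistE (j : nat) : `|j%:R - L%:R| = (ndist j L)%:R :> R.
Proof.
rewrite /ndist; have [jL|Lj] := leqP j L.
  by rewrite distrC ger0_norm ?subr_ge0 ?ler_nat// -natrB// (_ : j - L = 0)%N ?add0n//; lia.
rewrite ger0_norm ?subr_ge0 ?ler_nat ?(ltnW Lj)// -natrB ?(ltnW Lj)//.
by rewrite (_ : L - j = 0)%N ?addn0//; lia.
Qed.

Lemma cell_mass_le i (j : nat) : (mass i (grid j) (t / 2) <= (cell_bound i (ndist j L))%:E)%E.
Proof.
have t20 : 0 <= t / 2 by rewrite divr_ge0// ltW.
rewrite /cell_bound; have [di|ndi] := boolP (isdiag i).
  rewrite massE_diag//; apply: le_trans (gamma_mass_ub lam2_gt0 _ t20) _.
  by rewrite lee_fin [2 * _]mulrC divfK.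
rewrite massE_off//; case: eqP => [_|/eqP]; first exact: off_mass_le1.
rewrite -lt0n -(ltr0n R) => m0; set m := ndist j L in m0 *.
(* For [m >= 1] the interval stays at distance [m t - t / 2 >= m t / 2] from 0. *)
have y0 : 0 < m%:R * t / 2 by rewrite divr_gt0// mulr_gt0.
apply: le_trans (off_mass_ub tau1_gt0 Bc_gt0 t20 y0 _) _.
  have m1 : 1 <= m%:R :> R by rewrite ler1n -(ltr0n R).
  rewrite /grid normrM ndistE -/m (gtr0_norm t_gt0) -subr_ge0.
  have -> : m%:R * t - (m%:R * t / 2 + t / 2) = (m%:R - 1) * (t / 2) by field.
  by rewrite mulr_ge0// subr_ge0.
rewrite lee_fin le_eqVlt; apply/orP; left; apply/eqP; rewrite /q -/kc.
by field; rewrite !gt_eqF.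
Qed.

Lemma grid_cover x : `|x| <= L%:R * t -> exists j : 'I_(L + L.+1), box (grid j) (t / 2) x.
Proof.
rewrite ler_norml => /andP[x1 x2].
(* Truncation after adding [1/2] rounds to the nearest grid index. *)
pose y := x / t + L%:R + 2^-1.
have y0 : 0 <= y.
  have : - L%:R <= x / t by rewrite ler_pdivlMr// mulNr.
  rewrite /y; lra.
have yL : y < (L + L.+1)%:R.
  have : x / t <= L%:R by rewrite ler_pdivrMr.
  rewrite /y natrD -[L.+1%:R]natr1; lra.
have /andP[k1 k2] := truncn_itv y0.
have kL : (Num.truncn y < L + L.+1)%N by rewrite truncn_lt_nat.
exists (Ordinal kL); rewrite /box /grid /=.
have -> : x - ((Num.truncn y)%:R - L%:R) * t = (x / t - ((Num.truncn y)%:R - L%:R)) * t.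
  by rewrite [RHS]mulrBl divfK// gt_eqF.
rewrite normrM (gtr0_norm t_gt0) [leRHS]mulrC ler_pM2r//.
move: k1 k2; rewrite -[(Num.truncn y).+1%:R]natr1; move: (Num.truncn y)%:R => k; rewrite /y => k1 k2; rewrite ler_norml; apply/andP; split; lra.
Qed.

Variable sp : R.
Hypothesis sp_gt0 : 0 < sp.

(** The scale [sp], later the square root of [p], balances two sums with terms [1 / (sp * m)^2] and
    [sp * q / m]. Diagonal and central cells keep weight 1. *)
Definition cell_weight (i m : nat) : R := if isdiag i || (m == 0%N) then 1 else sp * m%:R.

Lemma cell_weight_gt0 i m : 0 < cell_weight i m.
Proof.
by rewrite /cell_weight; case: ifP => // /norP[_]; rewrite -lt0n => m0; rewrite mulr_gt0// ltr0n.
Qed.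

Lemma cell_bound_ge0 i m : 0 <= cell_bound i m.
Proof.
rewrite /cell_bound; case: ifP => _; first by rewrite mulr_ge0// ltW.
by case: ifP => // _; rewrite divr_ge0 ?sqr_ge0 ?(ltW q_gt0).
Qed.

Let H : R := 1 + ln L%:R.
Hypothesis L_gt0 : (0 < L)%N.

(** Replacing [1 / m^2] by [1 / m] brings in the same harmonic factor [H] as in
    [sum_bound_weight]. *)
Lemma sum_weightV i : \sum_(j < L + L.+1) (cell_weight i (ndist j L)) ^- 2 <=
  if isdiag i then (L + L.+1)%:R else 1 + 2 * (sp ^- 2 * H).
Proof.
rewrite /cell_weight; case: ifP => di /=.
  by under eq_bigr do rewrite expr1n invr1; rewrite sumr_const card_ord.
rewrite (sum_ndist _ (fun m => (if m == 0%N then 1 else sp * m%:R) ^- 2)) /= expr1n invr1.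
rewrite lerD2l ler_pM2l//.
apply: (@le_trans _ _ (\sum_(m < L) sp ^- 2 * (m.+1%:R)^-1)).
  apply: ler_sum => m _; rewrite exprMn invfM ler_pM2l ?invr_gt0 ?exprn_gt0//.
  rewrite lef_pV2 ?posrE ?exprn_gt0 ?ltr0n// expr2 ler_peMr// ler1n//.
by rewrite -mulr_sumr ler_pM2l ?invr_gt0 ?exprn_gt0// harmonic_le.
Qed.

Lemma sum_bound_weight i :
  \sum_(j < L + L.+1) cell_bound i (ndist j L) * cell_weight i (ndist j L) <=
  if isdiag i then (L + L.+1)%:R * (lam / 2 * t) else 1 + 2 * (sp * q * H).
Proof.
rewrite /cell_weight /cell_bound; case: ifP => di /=.
  by under eq_bigr do rewrite mulr1; rewrite sumr_const card_ord mulr_natl.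
rewrite (sum_ndist _ (fun m => (if m == 0%N then 1 else q / m%:R ^+ 2) *
   (if m == 0%N then 1 else sp * m%:R))) /= mulr1.
rewrite lerD2l ler_pM2l//.
apply: (@le_trans _ _ (\sum_(m < L) sp * q * (m.+1%:R)^-1)).
  apply: ler_sum => m _; rewrite le_eqVlt; apply/orP; left; apply/eqP.
  have z0 : m.+1%:R != 0 :> R by rewrite pnatr_eq0.
  by move: (m.+1%:R) z0 => z z0; field.
by rewrite -mulr_sumr ler_pM2l; [exact: harmonic_le|exact: mulr_gt0].
Qed.

End Cells.

(** By [1 + x <= exp x], an off-diagonal excess [x] of order [1 / p] costs only [exp (O(p))] over at
    most [p * p] entries. *)
Lemma prod_diag_off_le p (F : nat -> R) (a x : R) : 0 <= a -> 0 <= x ->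
  (forall i, 0 <= F i) -> (forall i, F i <= if isdiag i then a else 1 + x) ->
  \prod_(i < symdim p) F i <= a ^+ p * expR (x * (p * p)%:R).
Proof.
move=> a0 x0 F0 Fle.
apply: (@le_trans _ _ (\prod_(i < symdim p) (if isdiag i then a else 1 + x))).
  by apply: ler_prod => i _; rewrite F0 Fle.
rewrite (@big_symdim R 1 *%R p (fun j k => if j == k then a else 1 + x)).
rewrite (eq_bigr (fun=> a)); last by move=> j _; rewrite eqxx.
rewrite prodr_const card_ord ler_wpM2l ?exprn_ge0//.
rewrite (eq_bigr (fun=> 1 + x)); last by move=> jk /ltn_eqF ->.
rewrite prodr_const; apply: (@le_trans _ _ (expR x ^+ #|[pred jk : 'I_p * 'I_p | (jk.1 < jk.2)%N]|)).
  by rewrite lerXn2r ?nnegrE ?expR_ge0 ?addr_ge0// expR_ge1Dx.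
rewrite expRM_natr; apply: ler_weXn2l; first by rewrite -expR0 ler_expR.
by apply: leq_trans (max_card _) _; rewrite card_prod !card_ord.
Qed.

(** Companion for the ball, and the place where sparsity enters: the small factor [v] is paid only
    at non-zero entries, at most [s0] times. *)
Lemma prod_diag_off_ge p (F : nat -> R) (a x v : R) (nz : nat -> bool) s0 :
  0 <= a -> 0 <= x -> 0 < v <= 1 -> (forall i, 0 <= F i) ->
  (forall i, (i < symdim p)%N ->
     (if isdiag i then a else if nz i then v * expR (- x) else expR (- x)) <= F i) ->
  (#|[pred i : 'I_(symdim p) | ~~ isdiag i && nz i]| <= s0)%N ->
  a ^+ p * expR (- x * (p * p)%:R) * v ^+ s0 <= \prod_(i < symdim p) F i.
Proof.
move=> a0 x0 /andP[v0 v1] F0 Fge cs.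
apply: (@le_trans _ _ (\prod_(i < symdim p) ((if isdiag i then a else expR (- x)) *
    (if ~~ isdiag i && nz i then v else 1)))); last first.
  apply: ler_prod => i _; rewrite mulr_ge0 /=; first last.
  - by case: ifP => // _; exact: ltW.
  - by case: ifP => // _; exact: expR_ge0.
  apply: le_trans (Fge i (ltn_ord i)); case: (isdiag i) => /=; first by rewrite mulr1.
  by case: (nz i); rewrite ?mulr1// mulrC.
rewrite big_split /=; apply: ler_pM.
- by rewrite mulr_ge0 ?exprn_ge0 ?expR_ge0.
- by rewrite exprn_ge0// ltW.
- rewrite (@big_symdim R 1 *%R p (fun j k => if j == k then a else expR (- x))).
  rewrite (eq_bigr (fun=> a)); last by move=> j _; rewrite eqxx.
  rewrite prodr_const card_ord ler_wpM2l ?exprn_ge0//.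
  rewrite (eq_bigr (fun=> expR (- x))); last by move=> jk /ltn_eqF ->.
  rewrite prodr_const expRM_natr; apply: ler_wiXn2l; first exact: expR_ge0.
    by rewrite -expR0 ler_expR oppr_le0.
  by apply: leq_trans (max_card _) _; rewrite card_prod !card_ord.
- by rewrite -big_mkcond /= prodr_const; apply: ler_wiXn2l => //; exact: ltW.
Qed.

End PriorMasses.

(** * The bound for a fixed sample size *)

Section FiniteSample.
Variable R : realType.

Lemma card_offdiag_nz p (S0 : 'M[R]_p.+1) :
  (#|[pred i : 'I_(symdim p.+1) | ~~ isdiag i && (symcoord S0 i != 0)%R]| <= nsupp S0)%N.
Proof.
pose g (i : 'I_(symdim p.+1)) : 'I_p.+1 * 'I_p.+1 := (inord (symdec i).1, inord (symdec i).2).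
have gi : {in [pred i : 'I_(symdim p.+1) | ~~ isdiag i && (symcoord S0 i != 0)%R] &, injective g}.
  move=> i j _ _ [] /(congr1 val) /=; rewrite !inordK ?symdec1_lt// => e1 /(congr1 val) /=.
  rewrite !inordK ?symdec_lt// => e2; apply/val_inj => /=.
  by have [_ <-] := symdecP i; have [_ <-] := symdecP j; rewrite e1 e2.
rewrite -(card_in_image gi) /nsupp; apply: subset_leq_card.
apply/fintype.subsetP => jk /fintype.imageP[k]; rewrite inE => /andP[nd nz] ->.
apply/mem_set; rewrite /= nz andbT; apply: contra nd => /eqP/(congr1 val) /=.
by rewrite !inordK ?symdec1_lt ?symdec_lt// /isdiag => ->.
Qed.

Lemma diag_qbnd m (S : 'M[R]_m) lo hi i : qbnd S lo hi -> lo <= S i i.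
Proof.
move=> Sb; have /andP[+ _] := Sb.2 (delta_mx i 0).
rewrite /qform trmx_delta -rowE -colE !mxE /nrm2 trmx_delta mul_delta_mx mxE !eqxx.
by rewrite mulr1.
Qed.

Variables (n p' s0 L : nat).
Let p := p'.+1.
Let d := symdim p.
Variables (S0 : 'M[R]_p) (T tau lam tau1 eps r2 del t sp k : R).
Hypotheses (tau3 : 3 <= tau) (tauT : tau <= T) (S0b : qbnd S0 tau^-1 tau)
  (S0s : (nsupp S0 <= s0)%N) (lam0 : 0 < lam) (tau10 : 0 < tau1) (eps0 : 0 < eps)
  (Bc0 : 0 < betaB 2^-1 2^-1 :> R) (del01 : 0 < del <= 1) (t0 : 0 < t) (L0 : (0 < L)%N)
  (LT : T <= L%:R * t) (sp0 : 0 < sp) (k0 : 0 < k)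
  (small1 : 3 * p%:R * T ^+ 2 * del ^+ 2 <= (4 * T ^+ 6)^-1)
  (small2 : (p%:R * t) ^+ 2 <= ((2 * T)^-1) ^+ 2)
  (small3 : (p%:R * t) ^+ 2 <= (4 * (2 * T) ^+ 6)^-1).

(** [e] is the half-width of the coordinate boxes of the ball, with [p * e = del / 2] as in
    [shrunk_ball]. [x] bounds the prior mass of an off-diagonal entry outside [[- e, e]], and [v] is
    a lower bound for the mass of a box at a non-zero entry. *)
Let e := del / (2 * p%:R).
Let x := 64 * off_cst R * tau1 / e.
Let v := off_cst R * expR (-1) * tau1 * e / (T + 1) ^+ 2.
Let q := 32 * off_cst R * tau1 / t.
Let H := 1 + ln L%:R : R.

Hypotheses (x2 : x <= 2^-1) (v1 : v <= 1) (tauS : 2 * tau1 ^+ 2 <= (T + 1) ^+ 2).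

Let K1 := expR (T ^+ 6 * (3 * p%:R * T ^+ 2 * del ^+ 2)) ^+ n.
Let K3 := expR ((2 * T) ^+ 6 * (p%:R * t) ^+ 2) ^+ n.
Let rho := expR (- (r2 / (16 * (2 * T) ^+ 6))) ^+ n.
Let A1 := (L + L.+1)%:R ^+ p * expR (2 * (sp ^- 2 * H) * (p * p)%:R).
Let A2 := ((L + L.+1)%:R * (lam / 2 * t)) ^+ p * expR (2 * (sp * q * H) * (p * p)%:R).
Let b0 := (lam / 2 * expR (- (lam / 2) * (T + 1)) * (2 * e)) ^+ p
          * expR (- (2 * x) * (p * p)%:R) * v ^+ s0.

Let T3 : 3 <= T. Proof. exact: le_trans tauT. Qed.
Let T0 : 0 < T. Proof. exact: lt_le_trans T3. Qed.
Let T1 : 1 <= T. Proof. by apply: le_trans T3; rewrite ler1n. Qed.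
Let p0 : 0 < p%:R :> R. Proof. by rewrite ltr0n. Qed.
Let p1 : 1 <= p%:R :> R. Proof. by rewrite ler1n. Qed.
Let del0 : 0 < del. Proof. by case/andP: del01. Qed.
Let e0 : 0 < e. Proof. by rewrite divr_gt0// mulr_gt0. Qed.
Let pe : p%:R * e = del / 2. Proof. by rewrite /e; field; rewrite gt_eqF. Qed.
Let tau0 : 0 < tau. Proof. exact: lt_le_trans tau3. Qed.

Let tau_T (S : 'M[R]_p) : qbnd S tau^-1 tau -> qbnd S T^-1 T.
Proof. by apply: qbnd_sub => //; rewrite lef_pV2 ?posrE. Qed.

Let T_2T (S : 'M[R]_p) : qbnd S T^-1 T -> qbnd S (2 * T)^-1 (2 * T).
Proof.
by apply: qbnd_sub; rewrite ?lef_pV2 ?posrE ?mulr_gt0//; move: T0; lra.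
Qed.

Let Sst := shrunk S0 del.
Let cst := symcoord Sst.
Let ctr (i : 'I_d) : R := cst i.
(** The identity finite function gives [B] the shape of a cell, with index type ['I_d], so that the
    lemmas on boxes apply to both. *)
Let B (th : nat -> R) := [forall i : 'I_d, box (ctr ([ffun j : 'I_d => j] i)) e (th i)].
Let cell (f : {ffun 'I_d -> 'I_(L + L.+1)}) (th : nat -> R) :=
  [forall i, box (grid t L (f i)) (t / 2) (th i)].

Let Bqbnd th : B th -> qbnd (mxsym p th) tau^-1 tau /\
  frob2 (S0 - mxsym p th) <= 3 * p%:R * T ^+ 2 * del ^+ 2.
Proof.
move=> /forallP Bt.
have SstT : Sst^T = Sst by apply: shrunk_tr; exact: S0b.1.
have F : frob2 (mxsym p th - Sst) <= (del / 2) ^+ 2.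
  rewrite -pe -(mxsym_symcoord SstT); apply: frob2_mxsym_le => i id.
  by have := Bt (Ordinal id); rewrite ffunE.
have [Sb SF] := shrunk_ball tau3 del01 S0b (mxsym_tr p th) F.
split=> //; apply: le_trans SF _.
rewrite ler_wpM2r ?sqr_ge0// ler_wpM2l ?mulr_ge0 ?(ltW p0)//.
by rewrite ler_pXn2r ?nnegrE ?(ltW tau0) ?(ltW T0).
Qed.

Let cell_dist f th th' : cell f th -> cell f th' ->
  frob2 (mxsym p th - mxsym p th') <= (p%:R * t) ^+ 2.
Proof.
move=> /forallP c1 /forallP c2; apply: frob2_mxsym_le => i id.
have := c1 (Ordinal id); have := c2 (Ordinal id); rewrite /box /=.
set g := grid t L _ => h2 h1.
have -> : th i - th' i = (th i - g) - (th' i - g) by ring.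
by apply: le_trans (ler_normB _ _) _; rewrite [leRHS]splitr lerD.
Qed.

Let prd (th : nat -> R) := prior_u 2^-1 2^-1 tau1 lam (mxsym p th).

Let prdE th : prd th = (\prod_(i < d) prior1 tau1 lam i (th i))%E.
Proof. exact: prior_uE. Qed.

Let prd0 th : (0 <= prd th)%E.
Proof. by rewrite prdE; apply: prode_ge0 => i _; exact: prior1_ge0. Qed.

Let mprd : cmeas prd.
Proof.
rewrite (_ : prd = fun th => \prod_(i < d) prior1 tau1 lam i (th i))%E; last exact/funext.
apply: cmeas_prod => i; apply: (@cmeas_coord _ i (prior1 tau1 lam i)).
exact: measurable_prior1.
Qed.

(** The mass is a product over coordinates. Shrinking keeps the zero entries of [S0] at zero, so all
    but at most [s0] off-diagonal boxes are centred at 0 and carry mass at least [1 - x]. *)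
Let massB : exists b, [/\ 0 < b0, b0 <= b, 0 < b & intRn d (fun th => (B th)%:R%:E * prd th)%E = b%:E].
Proof.
have E : intRn d (fun th => (B th)%:R%:E * prd th)%E =
    (\prod_(i < d) mass tau1 lam i (ctr i) e)%E.
  transitivity (intRn d (fun th => ([forall i : 'I_d, box (ctr ([ffun j : 'I_d => j] i)) e (th i)])%:R%:E *
     \prod_(i < d) prior1 tau1 lam i (th i))%E).
    by apply: eq_intRn => th; rewrite prdE.
  rewrite (intRn_boxes tau10 lam0 Bc0 ctr e [ffun j : 'I_d => j]).
  by apply: eq_bigr => i _; rewrite ffunE.
have Mfin : (\prod_(i < d) mass tau1 lam i (ctr i) e)%E \is a fin_num.
  by apply: prode_fin_num => i _; apply: mass_fin => //; exact: ltW.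
have kc0 : 0 < off_cst R by rewrite /off_cst invr_gt0 mulr_gt0// sqrtr_gt0 mulr_gt0// pi_gt0.
have x0 : 0 < x by rewrite divr_gt0// !mulr_gt0.
have TT : 0 < (T + 1) ^+ 2 by rewrite exprn_gt0// addr_gt0.
have v0 : 0 < v by rewrite /v divr_gt0// mulr_gt0// mulr_gt0// mulr_gt0 ?expR_gt0.
have a0' : 0 < lam / 2 * expR (- (lam / 2) * (T + 1)) * (2 * e).
  apply: mulr_gt0; last exact: mulr_gt0.
  by apply: mulr_gt0; [exact: divr_gt0|exact: expR_gt0].
have bpos : 0 < b0.
  apply: mulr_gt0; last exact: exprn_gt0.
  by apply: mulr_gt0; [exact: exprn_gt0|exact: expR_gt0].
suff lb : b0 <= fine (\prod_(i < d) mass tau1 lam i (ctr i) e)%E.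
  exists (fine (\prod_(i < d) mass tau1 lam i (ctr i) e)%E); split=> //.
    exact: lt_le_trans lb.
  by rewrite E fineK.
rewrite -lee_fin fineK//.
pose F i : R := if (i < symdim p)%N then
  (if isdiag i then lam / 2 * expR (- (lam / 2) * (T + 1)) * (2 * e)
   else if cst i != 0 then v * expR (- (2 * x)) else expR (- (2 * x))) else 0.
have a0 := ltW a0'.
have F0 i : 0 <= F i.
  rewrite /F; do 3 case: ifP => // _; rewrite ?expR_ge0// mulr_ge0 ?expR_ge0//; exact: ltW.
apply: (@le_trans _ _ (\prod_(i < d) F i)%:E).
  rewrite lee_fin; apply: (@prod_diag_off_ge R p F _ (2 * x) v (fun i => cst i != 0)) => //.
  - by rewrite mulr_ge0 ?(ltW x0).
  - by rewrite v0.
  - by move=> i id; rewrite /F id.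
  apply: leq_trans S0s; apply: leq_trans (card_offdiag_nz S0); apply: subset_leq_card.
  apply/fintype.subsetP => i; rewrite !inE => /andP[nd nz]; rewrite nd /=.
  apply: contra nz => /eqP z; rewrite /cst /symcoord shrunk_off.
    by rewrite -/(symcoord S0 i) z mulr0.
  apply: contra nd => /eqP/(congr1 val) /=.
  by rewrite !inordK ?symdec1_lt ?symdec_lt// /isdiag => ->.
apply: gee_prod_fin => // i; rewrite /F ltn_ord.
have Sb : qbnd Sst tau^-1 tau.
  have SstT : Sst^T = Sst by apply: shrunk_tr; exact: S0b.1.
  have F' : frob2 (Sst - shrunk S0 del) <= (del / 2) ^+ 2.
    rewrite subrr /frob2 big1 ?sqr_ge0// => j _; rewrite big1// => l _.
    by rewrite mxE expr0n.
  by have [] := shrunk_ball tau3 del01 S0b SstT F'.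
have itau0 : 0 < tau^-1 by rewrite invr_gt0.
have cT : `|cst i| <= T by apply: le_trans tauT; exact: (entry_qbnd _ _ itau0 (ltW tau0) Sb).
have e1 : e <= 2^-1.
  rewrite /e ler_pdivrMr ?mulr_gt0//; move: del01 p1 => /andP[? ?] ?; lra.
case: ifP => di; last first.
  rewrite massE_off ?di// /ctr; case: eqP => [->|_] /=.
    apply: le_trans (off_mass0_lb tau10 Bc0 e0); rewrite lee_fin -/x.
    (* This yields [1 - x >= exp (- 2 x)], valid as [x <= 1/2]. *)
    have ex : 1 + 2 * x <= expR (2 * x) by exact: expR_ge1Dx.
    rewrite expRN -[leLHS]mul1r ler_pdivrMr ?expR_gt0//.
    move: x2 x0 ex; move: (expR (2 * x)) => E'; nra.
  (* At a non-zero entry the factor [expR (- (2 * x))] is bounded by 1; it is there to give all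
     off-diagonal bounds a common shape. *)
  apply: (@le_trans _ _ v%:E).
    rewrite lee_fin ler_piMr ?(ltW v0)// -expR0 ler_expR oppr_le0 mulr_ge0// ltW//.
  apply: le_trans (off_mass_lb tau10 Bc0 (ltW e0) _ tauS); first by [].
  rewrite ler_pXn2r ?nnegrE ?addr_ge0 ?(ltW T0) ?(ltW e0)//; lra.
rewrite massE_diag//.
have lam20 : 0 < lam / 2 by rewrite divr_gt0.
apply: (gamma_mass_lb lam20 (ltW e0)).
  have [le _] := symdecP i.
  have ed : e < del.
    rewrite /e ltr_pdivrMr ?mulr_gt0// ltr_pMr//; move: p1; lra.
  rewrite /ctr /cst /symcoord (eqP di) !mxE eqxx mulr1.
  have := diag_qbnd (inord (symdec i).2) S0b.
  move: (S0 _ _) => y ty; have y0 : 0 <= y by exact: le_trans (ltW itau0) ty.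
  rewrite subr_gt0; apply: lt_le_trans ed _; rewrite lerDr mulr_ge0// subr_ge0.
  by case/andP: del01.
rewrite /ctr; have := ler_norm (cst i); lra.
Qed.

Let w (f : {ffun 'I_d -> 'I_(L + L.+1)}) : R := \prod_(i < d) cell_weight sp i (ndist (f i) L).
Let m (f : {ffun 'I_d -> 'I_(L + L.+1)}) : R :=
  \prod_(i < d) cell_bound tau1 lam t i (ndist (f i) L).

Let w0 f : 0 < w f.
Proof. by apply: prodr_gt0 => i _; exact: cell_weight_gt0. Qed.

Let m0 f : 0 <= m f.
Proof. by apply: prodr_ge0 => i _; exact: cell_bound_ge0. Qed.

Let H0 : 0 <= H.
Proof. by rewrite addr_ge0// ln_ge0// ler1n. Qed.

Let q0 : 0 < q.
Proof.
have kc0 : 0 < off_cst R by rewrite /off_cst invr_gt0 mulr_gt0// sqrtr_gt0 mulr_gt0// pi_gt0.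
by rewrite divr_gt0// !mulr_gt0.
Qed.

(** A sum over all cells of a product over coordinates is a product of one-dimensional sums. *)
Let sum_wV : \sum_f w f ^- 2 <= A1.
Proof.
rewrite (eq_bigr (fun f : {ffun 'I_d -> 'I_(L + L.+1)} =>
   \prod_(i < d) cell_weight sp i (ndist (f i) L) ^- 2)); last first.
  by move=> f _; rewrite /w -prodrXl prodfV.
rewrite -(bigA_distr_bigA (fun (i : 'I_d) (j : 'I_(L + L.+1)) =>
   cell_weight sp i (ndist j L) ^- 2)).
apply: (@prod_diag_off_le R p (fun i => \sum_(j < L + L.+1) cell_weight sp i (ndist j L) ^- 2)).
- by [].
- by rewrite mulr_ge0// mulr_ge0// invr_ge0 sqr_ge0.
- by move=> i; apply: sumr_ge0 => j _; rewrite invr_ge0 sqr_ge0.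
- by move=> i; exact: sum_weightV.
Qed.

Let sum_mw : \sum_f m f * w f <= A2.
Proof.
rewrite (eq_bigr (fun f : {ffun 'I_d -> 'I_(L + L.+1)} =>
   \prod_(i < d) (cell_bound tau1 lam t i (ndist (f i) L) * cell_weight sp i (ndist (f i) L)))); last first.
  by move=> f _; rewrite big_split.
rewrite -(bigA_distr_bigA (fun (i : 'I_d) (j : 'I_(L + L.+1)) =>
   cell_bound tau1 lam t i (ndist j L) * cell_weight sp i (ndist j L))).
apply: (@prod_diag_off_le R p (fun i => \sum_(j < L + L.+1)
   cell_bound tau1 lam t i (ndist j L) * cell_weight sp i (ndist j L))).
- by rewrite mulr_ge0// mulr_ge0 ?(ltW t0)// divr_ge0// ltW.
- by rewrite mulr_ge0// mulr_ge0// mulr_ge0// ltW.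
- move=> i; apply: sumr_ge0 => j _; rewrite mulr_ge0 ?(ltW (cell_weight_gt0 _ _ _))//.
  exact: cell_bound_ge0.
- by move=> i; exact: sum_bound_weight.
Qed.

Let U := Ubound p tau.
Let far : set 'M[R]_p := [set S | r2 <= frob2 (S - S0)].
Let hitP f := exists th, [/\ cell f th, U (mxsym p th) & far (mxsym p th)].

(** A cell that misses the far part of [U(tau)] receives [S0] as a dummy, so that every
    representative satisfies the eigenvalue bounds and has positive likelihood. *)
Let rep_ex f : exists S : 'M[R]_p, qbnd S T^-1 T /\
  (hitP f -> far S /\ forall th, cell f th -> frob2 (mxsym p th - S) <= (p%:R * t) ^+ 2).
Proof.
have [[th [ct [[pd eg] ft]]]|nh] := pselect (hitP f); last first.
  by exists S0; split=> //; exact: tau_T.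
exists (mxsym p th); split; first by apply: tau_T; apply: eig_between_qbnd => //; exact: mxsym_tr.
by move=> _; split=> // th' ct'; exact: cell_dist ct' ct.
Qed.

Let rep f := projT1 (cid (rep_ex f)).
Let repb f : qbnd (rep f) T^-1 T. Proof. by have [] := projT2 (cid (rep_ex f)). Qed.
Let rep_hit f : hitP f ->
  far (rep f) /\ forall th, cell f th -> frob2 (mxsym p th - rep f) <= (p%:R * t) ^+ 2.
Proof. by have [] := projT2 (cid (rep_ex f)). Qed.

Let hit f := `[< hitP f >].
Let cells := [seq f <- index_enum {ffun 'I_d -> 'I_(L + L.+1)} | hit f].
Let C f (th : nat -> R) := hit f && cell f th.

Let AU th : \1_far (mxsym p th) * \1_U (mxsym p th) <= \sum_(f <- cells) (C f th)%:R :> R.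
Proof.
rewrite !indicE; case: (boolP (mxsym p th \in far)) => [/set_mem fr|_]; last first.
  by rewrite mul0r sumr_ge0.
case: (boolP (mxsym p th \in U)) => [/set_mem Ut|_]; last by rewrite mulr0 sumr_ge0.
have Sb : qbnd (mxsym p th) tau^-1 tau by apply: eig_between_qbnd; [exact: mxsym_tr|exact: Ut.2].
have itau0 : 0 < tau^-1 by rewrite invr_gt0.
have ex (i : 'I_d) : exists j : 'I_(L + L.+1), box (grid t L j) (t / 2) (th i).
  apply: grid_cover => //; apply: le_trans LT; apply: le_trans tauT.
  rewrite -(mxsymE th (ltn_ord i)); exact: (entry_qbnd _ _ itau0 (ltW tau0) Sb).
pose f : {ffun 'I_d -> 'I_(L + L.+1)} := [ffun i => projT1 (cid (ex i))].
have cf : cell f th by apply/forallP => i; rewrite ffunE; exact: (projT2 (cid (ex i))).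
have hf : hit f by apply/asboolP; exists th.
have fc : f \in cells by rewrite mem_filter hf mem_index_enum.
by rewrite (big_rem f fc) /= /C hf cf mul1r lerDl sumr_ge0.
Qed.

Let likth (th X : nat -> R) := lik (mxsym p th) (dataof n p X).

Let mlik : cmeas2 (fun th X => (likth th X)%:E).
Proof.
move=> disp T' F G mF mG; apply/measurable_EFinP; apply: measurable_lik.
  exact: mxmeas_mxsym.
by move=> i; exact: mxmeas_dataof.
Qed.

Let mlikc (S : 'M[R]_p) : cmeas (fun X => (lik S (dataof n p X))%:E).
Proof.
move=> disp T' F mF; apply/measurable_EFinP; apply: measurable_lik.
  exact: mxmeas_cst.
by move=> i; exact: mxmeas_dataof.
Qed.

Let likc_gt0 (S : 'M[R]_p) X : qbnd S T^-1 T -> 0 < lik S (dataof n p X).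
Proof. by apply: lik_gt0; rewrite invr_gt0. Qed.

Let S0T : qbnd S0 T^-1 T. Proof. exact: tau_T. Qed.

Let chiB th : B th ->
  (intRn (n * p) (fun X => (lik S0 (dataof n p X) ^+ 2 / likth th X)%:E) <= K1%:E)%E.
Proof.
move=> /Bqbnd[Sb SF]; apply: le_trans (lik_chi2 n T1 S0T (tau_T Sb) _) _.
  exact: le_trans SF small1.
rewrite lee_fin lerXn2r ?nnegrE ?expR_ge0// ler_expR ler_wpM2l// exprn_ge0// ltW//.
Qed.

Let TT1 : 1 <= 2 * T. Proof. by move: T1; lra. Qed.

Let cell_qbnd f th : C f th -> qbnd (mxsym p th) (2 * T)^-1 (2 * T).
Proof.
move=> /andP[/asboolP hf cf]; have [_ h] := rep_hit hf.
apply: (qbnd_perturb T1 (repb f) (mxsym_tr p th)).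
exact: le_trans (h _ cf) small2.
Qed.

Let chiC f th : C f th ->
  (intRn (n * p) (fun X => (likth th X ^+ 2 / lik (rep f) (dataof n p X))%:E) <= K3%:E)%E.
Proof.
move=> Ct; have := Ct => /andP[/asboolP hf cf]; have [_ h] := rep_hit hf.
have hh := h _ cf.
apply: le_trans (lik_chi2 n TT1 (cell_qbnd Ct) (T_2T (repb f)) _) _.
  exact: le_trans hh small3.
rewrite lee_fin lerXn2r ?nnegrE ?expR_ge0// ler_expR ler_wpM2l// exprn_ge0//.
by apply: le_trans TT1.
Qed.

Let affC f : f \in cells ->
  (intRn (n * p) (fun X => (Num.sqrt (lik (rep f) (dataof n p X) * lik S0 (dataof n p X)))%:E)
    <= rho%:E)%E.
Proof.
rewrite mem_filter => /andP[/asboolP hf _]; have [h _] := rep_hit hf.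
apply: le_trans (lik_affinity n TT1 (T_2T (repb f)) (T_2T S0T)) _.
rewrite lee_fin lerXn2r ?nnegrE ?expR_ge0// ler_expR lerN2 ler_wpM2r//.
by rewrite invr_ge0 mulr_ge0// exprn_ge0// (le_trans _ TT1).
Qed.

Let massC f : (intRn d (fun th => (C f th)%:R%:E * prd th) <= (m f)%:E)%E.
Proof.
apply: (@le_trans _ _ (intRn d (fun th => (cell f th)%:R%:E * prd th)%E)).
  apply: le_intRn => th; first by rewrite mule_ge0 ?lee_fin.
  by rewrite lee_wpmul2r// lee_fin ler_nat /C; case: (hit f); case: (cell f th).
have -> : intRn d (fun th => (cell f th)%:R%:E * prd th)%E =
    (\prod_(i < d) mass tau1 lam i (grid t L (f i)) (t / 2))%E.
  rewrite -(intRn_boxes tau10 lam0 Bc0 (fun j : 'I_(L + L.+1) => grid t L j) (t / 2) f).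
  by apply: eq_intRn => th; rewrite prdE.
apply: lee_prod_fin => i; first exact: mass_ge0.
exact: cell_mass_le.
Qed.

(** In [posterior_expectation_le] the choice [kap = Num.sqrt rho] makes both [kap * K3] and
    [rho / kap] multiples of the root of [rho], whence the factor [K3 + 1]. *)
Theorem finite_sample_bound :
  (P0 n S0 [set X | (eps <= posterior 2^-1 2^-1 tau1 lam tau X far)%R]
   <= (K1 / k + A1 * rho + k / (b0 * eps) * (A2 * (2^-1 * (K3 + 1) * Num.sqrt rho)))%:E)%E.
Proof.
have [b [b00 b0b bpos bE]] := massB.
have iU0 th : 0 <= (\1_U (mxsym p th) : R) by rewrite indicE.
set Z := intRn (symdim p) (fun th => ((\1_(Ubound p tau) (mxsym p th))%:E
                     * prior_u 2^-1 2^-1 tau1 lam (mxsym p th))%E).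
have Z0 : 0 <= (fine Z)^-1.
  rewrite invr_ge0 fine_ge0//; apply: intRn_ge0 => th.
  by rewrite mule_ge0// ?lee_fin ?iU0//; exact: prd0.
have rho0 : 0 < rho by rewrite exprn_gt0// expR_gt0.
have sr0 : 0 < Num.sqrt rho by rewrite sqrtr_gt0.
have B1 th : B th -> \1_U (mxsym p th) = 1 :> R.
  move=> /Bqbnd[Sb _]; rewrite indicE mem_set//; split; last exact: qbnd_eig_between.
  by apply: qbnd_posdef Sb; rewrite invr_gt0.
have cmC f : cmeas (fun th => (C f th)%:R%:E : \bar R).
  rewrite (_ : (fun th => _) = (fun th => (hit f)%:R%:E * (cell f th)%:R%:E)%E); last first.
    by apply/funext => th; rewrite -EFinM -natrM mulnb.
  by apply: cmeasM; [exact: cmeas_cst|exact: (cmeas_boxes (fun j : 'I_(L + L.+1) => grid t L j) (t / 2) f)].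
have iA01 th : 0 <= (\1_far (mxsym p th) : R) <= 1.
  by rewrite indicE; case: (_ \in _); rewrite /= ?lexx ?ler01.
have := @posterior_expectation_le R d (n * p) prd likth (fun X => lik S0 (dataof n p X))
  _ cells C B (fun f X => lik (rep f) (dataof n p X)) w m
  (fun th => \1_far (mxsym p th)) (fun th => \1_U (mxsym p th)) (fine Z)^-1
  eps k (Num.sqrt rho) b K1 K3 rho prd0 mprd (fun th X => lik_ge0 _ _) mlik
  (fun X => likc_gt0 X S0T) (mlikc S0) cmC
  (cmeas_boxes ctr e [ffun j : 'I_d => j]) (fun f X => likc_gt0 X (repb f))
  (fun f => mlikc (rep f)) (fun th X Bt => likc_gt0 X (tau_T (Bqbnd Bt).1))
  w0 Z0 eps0 k0 sr0 bpos (exprn_ge0 _ (expR_ge0 _)) iA01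
  iU0 B1 AU bE massC chiB chiC affC.
move=> le1; apply: le_trans (le_trans le1 _).
  rewrite le_eqVlt; apply/orP; left; apply/eqP; apply: eq_intRn => X.
  congr (_ * _)%:E; rewrite indicE; congr (nat_of_bool _)%:R.
  by apply/idP/idP => [/set_mem|h]; [|apply/mem_set].
have rV : (Num.sqrt rho)^-1 * rho = Num.sqrt rho.
  by rewrite -{2}[rho](sqr_sqrtr (ltW rho0)) expr2 mulKf// gt_eqF.
(* Adding the cells that are not hit restores the full sum over finite functions, which
   factorises. *)
have sumcells (g : {ffun 'I_d -> 'I_(L + L.+1)} -> R) : (forall f, 0 <= g f) ->
    \sum_(f <- cells) g f <= \sum_f g f.
  move=> g0; rewrite /cells big_filter big_mkcond /=; apply: ler_sum => f _.
  by case: ifP.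
rewrite lee_fin lerD// ?lerD//.
  rewrite -mulr_suml ler_wpM2r ?(ltW rho0)//; apply: le_trans sum_wV.
  by apply: sumcells => f; rewrite invr_ge0 sqr_ge0.
rewrite (eq_bigr (fun f => m f * w f * (2^-1 * (K3 + 1) * Num.sqrt rho))); last first.
  by move=> f _; rewrite rV; ring.
rewrite -mulr_suml; apply: ler_pM.
- by rewrite divr_ge0 ?mulr_ge0// ltW.
- rewrite mulr_ge0 ?mulr_ge0 ?(ltW sr0) ?addr_ge0 ?exprn_ge0 ?expR_ge0//.
  by apply: sumr_ge0 => f _; rewrite mulr_ge0// ltW.
- apply: ler_wpM2l; first exact: ltW.
  have be0 : 0 < b0 * eps by exact: mulr_gt0 b00 eps0.
  have be1 : 0 < b * eps by exact: mulr_gt0.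
  rewrite lef_pV2 ?posrE//; apply: ler_wpM2r b0b; exact: ltW.
rewrite ler_wpM2r ?mulr_ge0 ?(ltW sr0) ?addr_ge0 ?exprn_ge0 ?expR_ge0//.
apply: le_trans sum_mw; apply: sumcells => f; rewrite mulr_ge0//; exact: ltW.
Qed.

End FiniteSample.

(** * Rates *)

Lemma le_expR (R : realType) (x : R) : x <= expR x.
Proof. by apply: le_trans (expR_ge1Dx x); rewrite lerDr. Qed.

Lemma expr_le_expR (R : realType) (y z : R) m : 0 <= y -> y <= expR z -> y ^+ m <= expR (m%:R * z).
Proof. by move=> y0 yz; rewrite expRM_natl lerXn2r// nnegrE ?expR_ge0. Qed.

Lemma addnSn_le m : (0 < m)%N -> (m + m.+1 <= 3 * m)%N.
Proof. by move=> ?; lia. Qed.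

Section Rates.
Variable R : realType.
Variables (n p s0 Tn : nat) (T lam Lam tau1 C K kc : R).
Let P : R := p%:R.
Let N : R := n%:R.
Let l := ln P.
Let W := (p + s0)%:R * l.
(** With the roots [a], [b], [c] of [n], [p] and [ln p] as atoms, [del], [t] and [e] are rational
    expressions on which [field] works. The value of [del] makes the squared radius of the ball of
    order [p ln p / n], that of [t] makes [n (p t)^2 = p ln p]. *)
Let a := Num.sqrt N.
Let b := Num.sqrt P.
Let c := Num.sqrt l.
Let del := c / a.
Let t := c / (a * b).
Let e := del / (2 * P).
Let L := (Tn * n)%N.
Let H := 1 + ln L%:R : R.

Hypotheses (p0 : (0 < p)%N) (n0 : (0 < n)%N) (l1 : 1 <= l) (lnN : ln N <= K * l)
  (K0 : 0 <= K) (Lam0 : 0 < Lam)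
  (T3 : 3 <= T) (TTn : T <= Tn%:R) (lam0 : 0 < lam) (lamL : lam <= Lam) (tau10 : 0 < tau1)
  (C1 : 1 <= C) (kc0 : 0 < kc)
  (tau1u : tau1 ^+ 2 <= C * (N * P ^+ 4)^-1) (tau1l : (N * P ^+ 4)^-1 <= C * tau1 ^+ 2)
  (WN : W / N <= 1) (PC : 256 * kc * C + C + 1 <= P).

Let P1 : 1 <= P. Proof. by rewrite ler1n. Qed.
Let P0 : 0 < P. Proof. exact: lt_le_trans P1. Qed.
Let N0 : 0 < N. Proof. by rewrite ltr0n. Qed.
Let N1 : 1 <= N. Proof. by rewrite ler1n. Qed.
Let l0 : 0 < l. Proof. exact: lt_le_trans l1. Qed.
Let a0 : 0 < a. Proof. by rewrite sqrtr_gt0. Qed.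
Let b0 : 0 < b. Proof. by rewrite sqrtr_gt0. Qed.
Let c0 : 0 < c. Proof. by rewrite sqrtr_gt0. Qed.
Let aa : a ^+ 2 = N. Proof. exact: sqr_sqrtr (ltW N0). Qed.
Let bb : b ^+ 2 = P. Proof. exact: sqr_sqrtr (ltW P0). Qed.
Let cc : c ^+ 2 = l. Proof. exact: sqr_sqrtr (ltW l0). Qed.
Let b1 : 1 <= b. Proof. by rewrite -sqrtr1 ler_wsqrtr. Qed.
Let a1 : 1 <= a. Proof. by rewrite -sqrtr1 ler_wsqrtr. Qed.
Let c1 : 1 <= c. Proof. by rewrite -sqrtr1 ler_wsqrtr. Qed.
Let C0 : 0 < C. Proof. exact: lt_le_trans C1. Qed.
Let Tn3 : 3 <= Tn%:R :> R. Proof. exact: le_trans TTn. Qed.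
Let Tn0 : (0 < Tn)%N. Proof. by rewrite -(ltr0n R); apply: lt_le_trans Tn3. Qed.
Let PE : P = expR l. Proof. by rewrite lnK// posrE. Qed.
Let NE : N <= expR (K * l). Proof. by rewrite -[leLHS]lnK ?posrE// ler_expR. Qed.

Lemma Pl_le : P * l <= W.
Proof. by rewrite ler_wpM2r ?(ltW l0)// ler_nat leq_addr. Qed.
Lemma s0l_le : s0%:R * l <= W.
Proof. by rewrite ler_wpM2r ?(ltW l0)// ler_nat leq_addl. Qed.
Let l_le_N : P * l <= N.
Proof. by apply: le_trans Pl_le _; move: WN; rewrite ler_pdivrMr// mul1r. Qed.

Lemma del_le1 : 0 < del <= 1.
Proof.
rewrite divr_gt0//= ler_pdivrMr// mul1r -(@ler_pXn2r _ 2) ?nnegrE ?(ltW c0) ?(ltW a0)//.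
rewrite aa cc; apply: le_trans l_le_N; rewrite ler_peMl// ltW//.
Qed.

Lemma t_gt0 : 0 < t. Proof. by rewrite divr_gt0// mulr_gt0. Qed.

Lemma L_gt0 : (0 < L)%N. Proof. by rewrite muln_gt0 Tn0. Qed.

(** [L t = Tn * (a * c / b)], and [p <= p ln p <= n] gives [b <= a * c]. *)
Lemma T_le_Lt : T <= L%:R * t.
Proof.
have -> : L%:R * t = Tn%:R * (a * c / b).
  by rewrite natrM -/N -aa /t; field; rewrite !gt_eqF.
apply: le_trans TTn _; rewrite ler_peMr// ler_pdivlMr// mul1r.
rewrite -(@ler_pXn2r _ 2) ?nnegrE ?mulr_ge0 ?(ltW b0) ?(ltW c0) ?(ltW a0)//.
rewrite exprMn aa bb cc; apply: le_trans (le_trans l_le_N _); first by rewrite ler_peMr ?(ltW P0).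
by rewrite ler_peMr ?(ltW N0).
Qed.

Lemma del2 : del ^+ 2 = l / N.
Proof. by rewrite /del expr_div_n aa cc. Qed.

Lemma Pt2 : (P * t) ^+ 2 = P * l / N.
Proof.
by rewrite /t exprMn expr_div_n exprMn aa cc bb; field; rewrite !gt_eqF.
Qed.

Let tau1U : tau1 <= C / (a * b ^+ 4).
Proof.
rewrite -(@ler_pXn2r _ 2) ?nnegrE ?(ltW tau10) ?divr_ge0 ?mulr_ge0 ?exprn_ge0 ?(ltW a0) ?(ltW b0) ?(ltW C0)//.
apply: (le_trans tau1u); rewrite expr_div_n exprMn aa -exprM (exprM b 2 4) bb.
by rewrite ler_wpM2r ?invr_ge0 ?mulr_ge0 ?exprn_ge0 ?(ltW N0) ?(ltW P0)// expr2 ler_peMl// ltW.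
Qed.

Let tau1L : (a * b ^+ 4)^-1 <= C * tau1.
Proof.
rewrite -(@ler_pXn2r _ 2) ?nnegrE ?invr_ge0 ?mulr_ge0 ?exprn_ge0 ?(ltW a0) ?(ltW b0) ?(ltW C0) ?(ltW tau10)//.
rewrite exprVn exprMn aa -exprM (exprM b 2 4) bb; apply: (le_trans tau1l).
by rewrite exprMn ler_wpM2r ?sqr_ge0// expr2 ler_peMl// ltW.
Qed.

(** Each of the off-diagonal entries loses a mass of order [1 / p], in total a factor
    [exp (- O(p))]. The power [p^-4] in the size of [tau1 ^+ 2] is what achieves this. *)
Let x_ : 64 * kc * tau1 / e <= 128 * kc * C / P.
Proof.
rewrite -bb /e /del -bb.
have -> : 64 * kc * tau1 / (c / a / (2 * b ^+ 2)) = 128 * kc * (tau1 * (a * b ^+ 2 / c)).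
  by field; rewrite !gt_eqF.
rewrite -[leRHS]mulrA ler_wpM2l ?mulr_ge0 ?(ltW kc0)//.
apply: le_trans (_ : C / (a * b ^+ 4) * (a * b ^+ 2 / c) <= _).
  by rewrite ler_wpM2r// divr_ge0 ?mulr_ge0 ?exprn_ge0 ?(ltW a0) ?(ltW b0) ?(ltW c0).
have -> : C / (a * b ^+ 4) * (a * b ^+ 2 / c) = C / b ^+ 2 * c^-1.
  by field; rewrite !gt_eqF.
by rewrite ler_piMr ?invf_le1// divr_ge0 ?sqr_ge0// ltW.
Qed.

Let kcC0 : 0 < kc * C. Proof. exact: mulr_gt0. Qed.

Lemma x_half : 64 * kc * tau1 / e <= 2^-1.
Proof.
apply: le_trans x_ _; rewrite ler_pdivrMr//.
by move: PC kcC0 C0; rewrite -!mulrA; move: (kc * C) => y; lra.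
Qed.

Let tau1P : tau1 <= C / P.
Proof.
apply: le_trans tau1U _; rewrite ler_wpM2l ?(ltW C0)// lef_pV2 ?posrE ?mulr_gt0 ?exprn_gt0//.
rewrite -bb (_ : a * b ^+ 4 = (a * b ^+ 2) * b ^+ 2); last by ring.
by rewrite ler_peMl ?sqr_ge0// mulr_ege1// exprn_ege1.
Qed.

Let tau1_1 : tau1 <= 1.
Proof.
apply: le_trans tau1P _; rewrite ler_pdivrMr// mul1r.
by move: PC kcC0 C0; rewrite -!mulrA; move: (kc * C) => y; lra.
Qed.

Lemma tau1_S : 2 * tau1 ^+ 2 <= (T + 1) ^+ 2.
Proof.
have : tau1 ^+ 2 <= 1 by rewrite exprn_ile1// ltW.
move: T3; nra.
Qed.

Let e0 : 0 < e. Proof. by rewrite !divr_gt0 ?mulr_gt0. Qed.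

Lemma v_le1 : kc * expR (-1) * tau1 * e / (T + 1) ^+ 2 <= 1.
Proof.
have e1 : e <= 1.
  rewrite /e ler_pdivrMr ?mulr_gt0// mul1r; have /andP[_ h] := del_le1.
  by apply: le_trans h _; move: P1; lra.
have S1 : 1 <= (T + 1) ^+ 2 by rewrite exprn_ege1//; move: T3; lra.
rewrite ler_pdivrMr ?(lt_le_trans ltr01 S1)// mul1r; apply: le_trans S1.
have ktau : kc * tau1 <= 1.
  apply: le_trans (_ : kc * (C / P) <= _); first by rewrite ler_wpM2l// ltW.
  rewrite mulrA ler_pdivrMr// mul1r.
  by move: PC kcC0 C0; rewrite -!mulrA; move: (kc * C) => y; lra.
have E1 : expR (-1) <= 1 :> R by rewrite -expR0 ler_expR oppr_le0.
rewrite (_ : kc * expR (-1) * tau1 * e = (kc * tau1) * (expR (-1) * e)); last by ring.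
have tk0 := mulr_ge0 (ltW kc0) (ltW tau10).
have ee0 := mulr_ge0 (expR_ge0 (-1)) (ltW e0).
by apply: mulr_ile1 => //; apply: mulr_ile1 => //; exact: ltW.
Qed.

Let LL : (L + L.+1)%:R <= expR ((3 * Tn%:R + K) * l) :> R.
Proof.
rewrite mulrDl expRD.
apply: le_trans (_ : 3 * Tn%:R * N <= _).
  rewrite /N -natrM -natrM ler_nat -mulnA; exact: (addnSn_le L_gt0).
apply: ler_pM => //; rewrite ?mulr_ge0 ?(ltW N0)//.
by apply: le_trans (le_expR _) _; rewrite ler_expR ler_peMr// mulr_ge0.
Qed.

Let H_le : H <= (1 + Tn%:R + K) * l.
Proof.
have lnT : ln Tn%:R <= Tn%:R * l.
  apply: le_trans (_ : Tn%:R <= _); last by rewrite ler_peMr.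
  by rewrite -ler_expR lnK ?posrE ?ltr0n// le_expR.
by rewrite /H natrM lnM ?posrE ?ltr0n// !mulrDl mul1r -addrA lerD// lerD.
Qed.

Let H0 : 0 <= H.
Proof. by rewrite addr_ge0// ln_ge0// ler1n L_gt0. Qed.

(** With weight scale [b], the off-diagonal exponent is [2 p H]; and [L = Tn * n] with
    [ln n <= K ln p] bounds both [H] and the logarithm of the number of diagonal intervals by
    multiples of [ln p]. *)
Lemma A1_le : (L + L.+1)%:R ^+ p * expR (2 * (b ^- 2 * H) * (p * p)%:R)
  <= expR ((5 * Tn%:R + 3 * K + 2) * W).
Proof.
apply: le_trans (_ : expR (P * ((3 * Tn%:R + K) * l)) * expR (2 * P * ((1 + Tn%:R + K) * l)) <= _).
  apply: ler_pM; rewrite ?exprn_ge0 ?expR_ge0 ?expr_le_expR// ler_expR.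
  rewrite natrM -/P bb (_ : _ * (P * P) = 2 * P * H); last by field; rewrite gt_eqF.
  by rewrite ler_wpM2l// mulr_ge0// ltW.
rewrite -expRD ler_expR [leLHS](_ : _ = (5 * Tn%:R + 3 * K + 2) * (P * l)); last by ring.
by rewrite ler_wpM2l ?Pl_le// !addr_ge0// mulr_ge0.
Qed.

(** [G / (n p^3)] is a lower bound for the mass near a non-zero entry. *)
Let G := kc * expR (-1) / (2 * C * (T + 1) ^+ 2).

(** The last group is the cost of the [s0] non-zero entries; the others come from the [p] diagonal
    factors and the off-diagonal product. *)
Definition rate2 : R :=
  3 * Tn%:R + K + 1 + Lam * (T + 1) + 64 * kc * C * (1 + Tn%:R + K) + 256 * kc * C
  + (G^-1 + K + 3).

Let T10 : 0 < T + 1. Proof. by move: T3; lra. Qed.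

Let G0 : 0 < G. Proof. by rewrite divr_gt0// ?mulr_gt0 ?expR_gt0// exprn_gt0. Qed.

Let rate2_fst_ge0 :
  0 <= 3 * Tn%:R + K + 1 + Lam * (T + 1) + 64 * kc * C * (1 + Tn%:R + K) + 256 * kc * C.
Proof.
have k1 : 0 <= kc * C * (1 + Tn%:R + K) by rewrite mulr_ge0 ?(ltW kcC0)// !addr_ge0.
have k2 := mulr_ge0 (ltW Lam0) (ltW T10).
by move: k1 k2 K0 Tn3 kcC0; lra.
Qed.

Let rate2_snd_ge0 : 0 <= G^-1 + K + 3.
Proof. by rewrite !addr_ge0// invr_ge0 ltW. Qed.

(** Cells against ball, factor by factor: the diagonal through [z1], the off-diagonal exponentials
    through [z2], and the power [s0], which has no counterpart on the left, through [z3]. *)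
Lemma A2_le : ((L + L.+1)%:R * (lam / 2 * t)) ^+ p
      * expR (2 * (b * (32 * kc * tau1 / t) * H) * (p * p)%:R)
  <= ((lam / 2 * expR (- (lam / 2) * (T + 1)) * (2 * e)) ^+ p
      * expR (- (2 * (64 * kc * tau1 / e)) * (p * p)%:R)
      * (kc * expR (-1) * tau1 * e / (T + 1) ^+ 2) ^+ s0) * expR (rate2 * W).
Proof.
set z1 := (3 * Tn%:R + K + 1 + Lam * (T + 1)) * l.
set z2 := (64 * kc * C * (1 + Tn%:R + K) + 256 * kc * C) * (P * l).
set z3 := (G^-1 + K + 3) * l.
have X1 : (L + L.+1)%:R * (lam / 2 * t) <=
    (lam / 2 * expR (- (lam / 2) * (T + 1)) * (2 * e)) * expR z1.
  (* Both diagonal masses are proportional to [lam * t], which cancels; the exponential that is left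
     is controlled by [lam <= Lam]. *)
  have -> : 2 * e = t / b by rewrite /e /t /del -bb; field; rewrite !gt_eqF.
  have lt0 : 0 < lam / 2 * t / b by rewrite !divr_gt0// mulr_gt0 ?t_gt0// divr_gt0.
  rewrite (_ : (L + L.+1)%:R * (lam / 2 * t) = (lam / 2 * t / b) * ((L + L.+1)%:R * b)); last first.
    by field; rewrite gt_eqF.
  rewrite (_ : _ * expR z1 = (lam / 2 * t / b) * (expR (- (lam / 2) * (T + 1)) * expR z1)); last by ring.
  rewrite ler_wpM2l ?(ltW lt0)//.
  apply: le_trans (_ : expR ((3 * Tn%:R + K) * l) * expR l <= _).
    apply: ler_pM => //; first exact: ltW.
    by rewrite -PE -bb expr2 ler_peMl// ltW.
  rewrite -!expRD ler_expR.
  have : lam / 2 * (T + 1) <= Lam * (T + 1) * l.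
    apply: le_trans (_ : Lam * (T + 1) <= _).
      rewrite ler_wpM2r ?(ltW T10)//; apply: le_trans lamL.
      by rewrite ler_pdivrMr// ler_peMr ?(ltW lam0)// ler1n.
    by rewrite ler_peMr// mulr_ge0// ltW.
  rewrite /z1 mulNr; move: (lam / 2 * (T + 1)) => y; nra.
have X2 : 2 * (b * (32 * kc * tau1 / t) * H) * (p * p)%:R
    <= - (2 * (64 * kc * tau1 / e)) * (p * p)%:R + z2.
  have h1 : 2 * (64 * kc * tau1 / e) * (p * p)%:R <= 256 * kc * C * (P * l).
    apply: le_trans (_ : 2 * (128 * kc * C / P) * (p * p)%:R <= _).
      by rewrite ler_wpM2r// ler_wpM2l.
    rewrite natrM -/P (_ : _ * (P * P) = 256 * kc * C * P); last by field; rewrite gt_eqF.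
    have kC0 : 0 <= 256 * kc * C by rewrite -mulrA mulr_ge0 ?ler0n ?(ltW kcC0).
    by apply: ler_wpM2l => //; rewrite ler_peMr// ltW.
  have h2 : 2 * (b * (32 * kc * tau1 / t) * H) * (p * p)%:R
      <= 64 * kc * C * (1 + Tn%:R + K) * (P * l).
    apply: le_trans (_ : 64 * kc * C * P * H <= _); last first.
      rewrite (_ : _ * (P * l) = 64 * kc * C * P * ((1 + Tn%:R + K) * l)); last by ring.
      by rewrite ler_wpM2l// !mulr_ge0 ?(ltW kc0) ?(ltW C0) ?(ltW P0).
    rewrite natrM -/P -bb /t.
    rewrite (_ : _ * (b ^+ 2 * b ^+ 2) = 64 * kc * H * (tau1 * (a * b ^+ 6 / c))); last first.
      by field; rewrite !gt_eqF.
    rewrite (_ : 64 * kc * C * b ^+ 2 * H = 64 * kc * H * (C * b ^+ 2)); last by ring.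
    rewrite ler_wpM2l ?mulr_ge0 ?(ltW kc0)//.
    apply: le_trans (_ : C / (a * b ^+ 4) * (a * b ^+ 6 / c) <= _).
      by rewrite ler_wpM2r// divr_ge0 ?mulr_ge0 ?exprn_ge0 ?(ltW a0) ?(ltW b0) ?(ltW c0).
    rewrite (_ : _ * _ = C * b ^+ 2 * c^-1); last by field; rewrite !gt_eqF.
    by rewrite ler_piMr ?invf_le1// mulr_ge0 ?sqr_ge0// ltW.
  rewrite /z2 mulrDl mulNr; move: h1 h2; lra.
(* A non-zero entry costs at most [n p^3 / G]. Here [n p^3 <= exp ((K + 3) l)], and
   [G^-1 <= exp (G^-1 l)] accounts for the constant. *)
have X3 : 1 <= kc * expR (-1) * tau1 * e / (T + 1) ^+ 2 * expR z3.
  have g1 : G / (N * P ^+ 3) <= kc * expR (-1) * tau1 * e / (T + 1) ^+ 2.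
    rewrite /G /e /del.
    rewrite (_ : kc * expR (-1) / (2 * C * (T + 1) ^+ 2) / (N * P ^+ 3) =
       kc * expR (-1) / (2 * (T + 1) ^+ 2) * (C^-1 / (a * b ^+ 4) / (a * b ^+ 2))); last first.
      by rewrite -bb -aa; field; rewrite !gt_eqF.
    rewrite (_ : _ / (T + 1) ^+ 2 =
       kc * expR (-1) / (2 * (T + 1) ^+ 2) * (tau1 * c / (a * b ^+ 2))); last first.
      by rewrite -bb; field; rewrite !gt_eqF.
    rewrite ler_wpM2l//.
      by rewrite divr_ge0 ?mulr_ge0 ?(ltW kc0) ?expR_ge0 ?sqr_ge0 ?(ltW T10).
    apply: ler_wpM2r; first by rewrite invr_ge0 mulr_ge0 ?sqr_ge0 ?(ltW a0).
    have h : C^-1 / (a * b ^+ 4) <= tau1 by rewrite mulrC ler_pdivrMr// [leRHS]mulrC.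
    by apply: (le_trans h); rewrite ler_peMr// ltW.
  apply: le_trans (_ : G / (N * P ^+ 3) * expR z3 <= _); last first.
    by rewrite ler_wpM2r ?expR_ge0.
  rewrite mulrAC ler_pdivlMr ?mulr_gt0 ?exprn_gt0// mul1r.
  have -> : expR z3 = expR (G^-1 * l) * (expR (K * l) * P ^+ 3).
    by rewrite PE -expRM_natl -!expRD; congr expR; rewrite /z3; ring.
  have h : G^-1 <= expR (G^-1 * l).
    by apply: le_trans (le_expR _) _; rewrite ler_expR ler_peMr// invr_ge0 ltW.
  have h1 : 1 <= G * expR (G^-1 * l).
    by have := ler_wpM2l (ltW G0) h; rewrite mulfV ?lt0r_neq0.
  have h0 : 0 <= N * P ^+ 3 by rewrite mulr_ge0 ?exprn_ge0// ltW.
  have h2 : N * P ^+ 3 <= expR (K * l) * P ^+ 3 by rewrite ler_wpM2r// exprn_ge0// ltW.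
  by have := ler_pM ler01 h0 h1 h2; rewrite mul1r -[leRHS]mulrA.
set y1 := (L + L.+1)%:R * _ in X1 *; set y2 := lam / 2 * _ * _ in X1 *.
set v := _ / (T + 1) ^+ 2 in X3 *.
have y10 : 0 <= y1 by rewrite mulr_ge0// mulr_ge0 ?(ltW t_gt0)// divr_ge0// ltW.
have v0 : 0 <= v.
  apply: divr_ge0 (sqr_ge0 _); apply: mulr_ge0 (ltW e0).
  by rewrite !mulr_ge0 ?expR_ge0// ltW.
have y20 : 0 <= y2.
  apply: mulr_ge0; last by apply: mulr_ge0 (ltW e0).
  by apply: mulr_ge0 (expR_ge0 _); rewrite divr_ge0// ltW.
apply: le_trans (_ : (y2 * expR z1) ^+ p *
    (expR (- (2 * (64 * kc * tau1 / e)) * (p * p)%:R) * expR z2) * (v * expR z3) ^+ s0 <= _).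
  rewrite -[leLHS]mulr1; apply: ler_pM; rewrite ?mulr_ge0 ?exprn_ge0 ?expR_ge0//.
    apply: ler_pM; rewrite ?exprn_ge0 ?expR_ge0//.
      by rewrite lerXn2r// nnegrE mulr_ge0 ?expR_ge0.
    by rewrite -expRD ler_expR.
  exact: exprn_ege1.
rewrite (exprMn _ y2) (exprMn _ v) -(expRM_natl p) -(expRM_natl s0).
rewrite [leLHS](_ : _ = (y2 ^+ p * expR (- (2 * (64 * kc * tau1 / e)) * (p * p)%:R) * v ^+ s0)
   * (expR (P * z1) * expR z2 * expR (s0%:R * z3))); last by rewrite /P; ring.
rewrite ler_wpM2l ?mulr_ge0 ?exprn_ge0 ?expR_ge0// -!expRD ler_expR.
have h2 := Pl_le; have h1 := s0l_le.
rewrite [leLHS](_ : _ = (3 * Tn%:R + K + 1 + Lam * (T + 1) + 64 * kc * C * (1 + Tn%:R + K) + 256 * kc * C) * (P * l)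
   + (G^-1 + K + 3) * (s0%:R * l)); last by rewrite /z1 /z2 /z3; ring.
rewrite /rate2 [leRHS]mulrDl; apply: lerD.
  exact: (ler_wpM2l rate2_fst_ge0 h2).
exact: (ler_wpM2l rate2_snd_ge0 h1).
Qed.


(** This is [16 (2 T)^6] times [2 D], so that [rho = exp (- 2 D W)] with root [exp (- D W)]; [D]
    exceeds by at least 1 each exponent that these two factors have to beat. *)
Definition rate_const : R :=
  16 * (2 * T) ^+ 6 * (2 * (1 + (5 * Tn%:R + 3 * K + 2) + (4 * T ^+ 8 + rate2 + 64 * T ^+ 6))).

Let T0 : 0 < T. Proof. exact: lt_le_trans T3. Qed.

Let rate2_ge0 : 0 <= rate2.
Proof.
exact: addr_ge0 rate2_fst_ge0 rate2_snd_ge0.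
Qed.

Lemma rate_const_gt0 : 0 < rate_const.
Proof.
rewrite /rate_const !mulr_gt0 ?exprn_gt0 ?mulr_gt0//.
have := rate2_ge0; have := exprn_ge0 8 (ltW T0); have := exprn_ge0 6 (ltW T0); move: K0 Tn3; lra.
Qed.

Let W_ge0 : 0 <= W. Proof. by rewrite mulr_ge0 ?(ltW l0). Qed.

Lemma total_bound_le eps : 0 < eps ->
  expR (T ^+ 6 * (3 * P * T ^+ 2 * del ^+ 2)) ^+ n / expR (4 * T ^+ 8 * W)
  + (L + L.+1)%:R ^+ p * expR (2 * (b ^- 2 * H) * (p * p)%:R)
    * expR (- (rate_const * (W / N) / (16 * (2 * T) ^+ 6))) ^+ n
  + expR (4 * T ^+ 8 * W)
    / (((lam / 2 * expR (- (lam / 2) * (T + 1)) * (2 * e)) ^+ p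
      * expR (- (2 * (64 * kc * tau1 / e)) * (p * p)%:R)
      * (kc * expR (-1) * tau1 * e / (T + 1) ^+ 2) ^+ s0) * eps)
    * (((L + L.+1)%:R * (lam / 2 * t)) ^+ p
      * expR (2 * (b * (32 * kc * tau1 / t) * H) * (p * p)%:R)
      * (2^-1 * (expR ((2 * T) ^+ 6 * (P * t) ^+ 2) ^+ n + 1)
         * Num.sqrt (expR (- (rate_const * (W / N) / (16 * (2 * T) ^+ 6))) ^+ n)))
  <= (2 + eps^-1) * expR (- W).
Proof.
move=> eps0.
set D := 1 + (5 * Tn%:R + 3 * K + 2) + (4 * T ^+ 8 + rate2 + 64 * T ^+ 6).
have Nu : n%:R * (W / N) = W by rewrite mulrC divfK// gt_eqF.
have rhoE : expR (- (rate_const * (W / N) / (16 * (2 * T) ^+ 6))) ^+ n = expR (- (D * W)) ^+ 2.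
  rewrite -!expRM_natl; congr expR.
  rewrite (_ : n%:R * _ = - (rate_const * (n%:R * (W / N)) / (16 * (2 * T) ^+ 6))); last by ring.
  rewrite Nu /rate_const -/D; field.
  by rewrite gt_eqF.
rewrite rhoE sqrtr_sqr ger0_norm ?expR_ge0//.
have D6 : 0 <= T ^+ 6 by rewrite exprn_ge0// ltW.
have D8 : 0 <= T ^+ 8 by rewrite exprn_ge0// ltW.
have D81 : 1 <= T ^+ 8 by rewrite exprn_ege1//; move: T3; lra.
(* The ball has [K1 <= exp (3 T^8 W)], hence the choice [k = exp (4 T^8 W)]. *)
have K1E : expR (T ^+ 6 * (3 * P * T ^+ 2 * del ^+ 2)) ^+ n / expR (4 * T ^+ 8 * W) <= expR (- W).
  rewrite del2 -expRM_natl -expRN -expRD ler_expR.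
  have -> : n%:R * (T ^+ 6 * (3 * P * T ^+ 2 * (l / N))) = 3 * T ^+ 8 * (P * l).
    by rewrite -/N; field; rewrite gt_eqF.
  apply: le_trans (_ : 3 * T ^+ 8 * W - 4 * T ^+ 8 * W <= _).
    by rewrite lerB// ler_wpM2l ?Pl_le// mulr_ge0.
  by rewrite -mulrBl (_ : _ - _ = - T ^+ 8); [rewrite mulNr lerN2 ler_peMl|ring].
have K3E : 2^-1 * (expR ((2 * T) ^+ 6 * (P * t) ^+ 2) ^+ n + 1) <= expR (64 * T ^+ 6 * W).
  rewrite Pt2 -expRM_natl.
  have -> : n%:R * ((2 * T) ^+ 6 * (P * l / N)) = 64 * T ^+ 6 * (P * l).
    by rewrite -/N; field; rewrite gt_eqF.
  have h1 : expR (64 * T ^+ 6 * (P * l)) <= expR (64 * T ^+ 6 * W).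
    by rewrite ler_expR ler_wpM2l ?Pl_le// mulr_ge0.
  have h2 : 1 <= expR (64 * T ^+ 6 * W) by apply: le_trans (expR_ge1Dx _); rewrite lerDl; apply: mulr_ge0 W_ge0; apply: mulr_ge0.
  by move: h1 h2; lra.
have D1 : 0 <= 5 * Tn%:R + 3 * K + 2 by move: K0 Tn3; lra.
rewrite [leRHS]mulrDl; apply: lerD.
  rewrite [leRHS]mulr_natl mulr2n; apply: lerD K1E _.
  apply: le_trans (_ : expR ((5 * Tn%:R + 3 * K + 2) * W) * expR (- (D * W)) ^+ 2 <= _).
    by rewrite ler_wpM2r ?sqr_ge0 ?A1_le.
  rewrite -expRM_natl -expRD ler_expR
    [leLHS](_ : _ = (5 * Tn%:R + 3 * K + 2 - 2 * D) * W); last by ring.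
  rewrite -[leRHS]mulN1r ler_wpM2r//.
  by rewrite /D; have := rate2_ge0; move: D1 D6 D8; lra.
set b1' := (_ * _ * _ ^+ s0).
set A2 := ((L + L.+1)%:R * _) ^+ p * _.
have b1'0 : 0 < b1'.
  apply: mulr_gt0; last first.
    apply/exprn_gt0/divr_gt0; last exact: exprn_gt0.
    by apply: mulr_gt0 e0; rewrite !mulr_gt0 ?expR_gt0.
  apply: mulr_gt0 (expR_gt0 _); apply/exprn_gt0/mulr_gt0; last exact: mulr_gt0.
  by apply: mulr_gt0 (expR_gt0 _); exact: divr_gt0.
have A2b : A2 <= b1' * expR (rate2 * W) by exact: A2_le.
have A20 : 0 <= A2.
  by rewrite mulr_ge0 ?expR_ge0 ?exprn_ge0// mulr_ge0// mulr_ge0 ?(ltW t_gt0)// divr_ge0// ltW.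
apply: le_trans (_ : expR (4 * T ^+ 8 * W) / (b1' * eps) *
   (b1' * expR (rate2 * W) * (expR (64 * T ^+ 6 * W) * expR (- (D * W)))) <= _).
  have be0 : 0 <= b1' * eps by exact: mulr_ge0 (ltW b1'0) (ltW eps0).
  apply: ler_wpM2l; first exact: divr_ge0 (expR_ge0 _) be0.
  apply: ler_pM A20 _ A2b _; last by apply: ler_wpM2r; [exact: expR_ge0|exact: K3E].
  set Y := expR _ ^+ n.
  have Y0 : 0 <= Y by rewrite exprn_ge0 ?expR_ge0.
  by apply: mulr_ge0 (expR_ge0 _); move: Y0; lra.
rewrite [leLHS](_ : _ = eps^-1 * (expR (4 * T ^+ 8 * W) * expR (rate2 * W) *
   expR (64 * T ^+ 6 * W) * expR (- (D * W)))); last by field; rewrite !gt_eqF.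
rewrite ler_wpM2l ?invr_ge0 ?(ltW eps0)// -!expRD ler_expR.
rewrite [leLHS](_ : _ = (4 * T ^+ 8 + rate2 + 64 * T ^+ 6 - D) * W); last by ring.
rewrite -[leRHS]mulN1r ler_wpM2r//.
by rewrite /D; have := rate2_ge0; move: D1 D6 D8; lra.
Qed.

End Rates.

(** * Choice of the parameters and passage to the limit *)

Lemma posterior_rate (R : realType) (n p s0 Tn : nat) (S0 : 'M[R]_p)
    (T Lam C K tau lam tau1 eps : R) :
  0 < betaB 2^-1 2^-1 :> R -> 3 <= tau -> tau <= T -> T <= Tn%:R ->
  qbnd S0 tau^-1 tau -> (nsupp S0 <= s0)%N -> 0 < lam -> lam <= Lam -> 0 < tau1 ->
  1 <= C -> 0 < eps -> (0 < n)%N -> (0 < p)%N -> 1 <= ln p%:R :> R ->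
  ln n%:R <= K * ln p%:R -> 0 <= K ->
  tau1 ^+ 2 <= C * (n%:R * p%:R ^+ 4)^-1 -> (n%:R * p%:R ^+ 4)^-1 <= C * tau1 ^+ 2 ->
  (p + s0)%:R * ln p%:R / n%:R <= (256 * T ^+ 8)^-1 ->
  256 * off_cst R * C + C + 1 <= p%:R ->
  (P0 n S0 [set X | (eps <= posterior 2^-1 2^-1 tau1 lam tau X
      [set S | rate_const Tn T Lam C K (off_cst R) * ((p + s0)%:R * ln p%:R / n%:R)
               <= frob2 (S - S0)])%R]
   <= ((2 + eps^-1) * expR (- ((p + s0)%:R * ln p%:R)))%:E)%E.
Proof.
move=> B0 tau3 tauT TTn S0b S0s lam0 lamL tau10 C1 eps0 n0 p0 l1 lnN K0 t1u t1l Weta PC.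
have Lam0 : 0 < Lam by exact: lt_le_trans lamL.
have T3 : 3 <= T by exact: le_trans tauT.
have T1 : 1 <= T by apply: le_trans T3; rewrite ler1n.
have T0 : 0 < T by exact: lt_le_trans T1.
have N0 : 0 < n%:R :> R by rewrite ltr0n.
have kc0 : 0 < off_cst R by rewrite /off_cst invr_gt0 mulr_gt0// sqrtr_gt0 mulr_gt0// pi_gt0.
have T81 : 1 <= T ^+ 8 by exact: exprn_ege1.
have T66 : T ^+ 6 <= T ^+ 8 by rewrite (exprD _ 6 2) ler_peMr ?exprn_ge0 ?(ltW T0)// exprn_ege1.
have T26 : T ^+ 2 <= T ^+ 8 by rewrite (exprD _ 2 6) ler_peMr ?exprn_ge0 ?(ltW T0)// exprn_ege1.
have E0 : 0 < 256 * T ^+ 8 by move: T81; lra.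
have WN : (p + s0)%:R * ln p%:R / n%:R <= 1 :> R.
  by apply: le_trans Weta _; rewrite invf_le1//; move: T81; lra.
have PlW : p%:R * ln p%:R / n%:R <= (256 * T ^+ 8)^-1.
  by apply: le_trans Weta; rewrite ler_wpM2r ?invr_ge0 ?(ltW N0)// Pl_le.
(* The single threshold [256 T^8] covers the three smallness conditions, in which [12 T^8], [4 T^2]
   and [256 T^6] occur. *)
have weak (y : R) : 0 < y -> y <= 256 * T ^+ 8 -> p%:R * ln p%:R / n%:R <= y^-1.
  by move=> y0 yE; apply: le_trans PlW _; rewrite lef_pV2 ?posrE.
case: p => [//|p'] in S0 S0b S0s p0 l1 lnN t1u t1l Weta PC WN PlW weak *.
apply: le_trans (@finite_sample_bound R n p' s0 (Tn * n) S0 T tau lam tau1 eps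
  _ (Num.sqrt (ln p'.+1%:R) / Num.sqrt n%:R)
  (Num.sqrt (ln p'.+1%:R) / (Num.sqrt n%:R * Num.sqrt p'.+1%:R)) (Num.sqrt p'.+1%:R)
  (expR (4 * T ^+ 8 * ((p'.+1 + s0)%:R * ln p'.+1%:R)))
  tau3 tauT S0b S0s lam0 tau10 eps0 B0 _ _ _ _ _ _ _ _ _ _ _ _) _.
- exact: (del_le1 p0 n0 l1 WN).
- exact: t_gt0.
- exact: L_gt0 n0 T3 TTn.
- exact: (T_le_Lt p0 n0 l1 TTn WN).
- by rewrite sqrtr_gt0 ltr0n.
- exact: expR_gt0.
- rewrite del2//.
  have h := weak (12 * T ^+ 8).
  have -> : 3 * p'.+1%:R * T ^+ 2 * (ln p'.+1%:R / n%:R) = 3 * T ^+ 2 * (p'.+1%:R * ln p'.+1%:R / n%:R) by ring.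
  have -> : (4 * T ^+ 6)^-1 = 3 * T ^+ 2 * (12 * T ^+ 8)^-1 by field; rewrite gt_eqF.
  by apply: ler_wpM2l; [rewrite mulr_ge0 ?exprn_ge0 ?(ltW T0)|apply: h; move: T81; lra].
- rewrite Pt2//; rewrite exprVn; apply: weak; first by rewrite exprn_gt0// mulr_gt0.
  rewrite exprMn; move: T26 T81; lra.
- rewrite Pt2//; apply: weak; first by rewrite mulr_gt0// exprn_gt0// mulr_gt0.
  rewrite exprMn; move: T66 T81; lra.
- exact: (x_half p0 n0 l1 tau10 C1 kc0 t1u PC).
- exact: (v_le1 p0 n0 l1 T3 tau10 C1 kc0 t1u WN PC).
- exact: (tau1_S p0 n0 T3 tau10 C1 kc0 t1u PC).
by rewrite lee_fin; exact: total_bound_le.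
Qed.

(* [betaB] is [fine] of an integral; were it the junk value 0, the prior density would
   vanish and the posterior would be 0 / 0 = 0. This avoids proving that [betaB] is finite. *)
Lemma posterior_degenerate (R : realType) (n p : nat) (S0 : 'M[R]_p) (tau lam tau1 eps : R) A :
  betaB 2^-1 2^-1 = 0 :> R -> (1 < p)%N -> 0 < eps ->
  P0 n S0 [set X | (eps <= posterior 2^-1 2^-1 tau1 lam tau X A)%R] = 0%E.
Proof.
move=> B0; case: p S0 A => [|[|p']]// S0 A _ eps0.
have off0 s : offpdf 2^-1 2^-1 tau1 s = 0%E :> \bar R.
  apply: integral0_eq => r _.
  by rewrite /betapdf B0 invr0 mulr0 if_same mulr0.
have pr0 th : prior_u 2^-1 2^-1 tau1 lam (mxsym p'.+2 th) = 0%E :> \bar R.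
  have i1 : (1 < symdim p'.+2)%N by rewrite /symdim; lia.
  rewrite prior_uE (bigD1 (Ordinal i1))//=.
  by rewrite /prior1 /= off0 mul0e.
rewrite /P0 -[RHS](@intRn0 R (n * p'.+2)); apply: eq_intRn => X.
rewrite indicE memNset ?mul0r// => /=.
rewrite /posterior [X in fine X / _](_ : _ = 0%E).
  by rewrite mul0r leNgt eps0.
rewrite -[RHS](@intRn0 R (symdim p'.+2)); apply: eq_intRn => th.
by rewrite /prior pr0 mule0 !mul0e mule0.
Qed.

Lemma P0_ge0 (R : realType) n p (S0 : 'M[R]_p) E : (0 <= P0 n S0 E)%E.
Proof. by apply: intRn_ge0 => X; rewrite lee_fin mulr_ge0 ?lik_ge0// indicE. Qed.

Lemma betaB_ge0 (R : realType) (a b : R) : 0 <= betaB a b.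
Proof. by apply/fine_ge0/integral_ge0 => r _; rewrite lee_fin mulr_ge0 ?powR_ge0. Qed.

Lemma near_pow_ge (R : realType) (be A : R) : 0 < be ->
  \forall n \near \oo, A <= n%:R `^ be.
Proof.
move=> be0; near=> n; have A0 : 0 <= Num.max A 0 by rewrite le_max lexx orbT.
apply: (@le_trans _ _ (Num.max A 0)); first by rewrite le_max lexx.
have -> : Num.max A 0 = (Num.max A 0 `^ be^-1) `^ be.
  by rewrite -powRrM mulVf ?gt_eqF// powRr1.
apply: ge0_ler_powR; rewrite ?(ltW be0) ?nnegrE ?powR_ge0//.
by near: n; exact: nbhs_infty_ger.
Unshelve. all: by end_near. Qed.

Theorem theorem1 (R : realType) (p s0 : nat -> nat) (Sigma0 : forall n, 'M[R]_(p n))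
    (tau0 : R) (tau lam tau1 : nat -> R) :
  (* (A1) *)
  1 < tau0 ->
  (forall n, (0 < s0 n)%N /\ (s0 n < p n * (p n).-1)%N) ->
  (forall n, Usparse (p n) (s0 n) tau0 (Sigma0 n)) ->
  (* (A2) *)
  (exists beta : R, 0 < beta < 1 /\
     seq_asymp (fun n => (p n)%:R : R) (fun n => n%:R `^ beta)) ->
  (* (A3) *)
  (forall n, Num.max 3 tau0 <= tau n) -> seq_bigO tau (fun _ => 1) ->
  (forall n, 0 < lam n) -> seq_bigO lam (fun _ => 1) ->
  (forall n, 0 < tau1 n) ->
  seq_asymp (fun n => tau1 n ^+ 2) (fun n => (n%:R * (p n)%:R ^+ 4)^-1) ->
  (* (p + s0) log p = o(n) *)
  (fun n => ((p n + s0 n)%:R * ln ((p n)%:R : R)) / n%:R : R) @ \oo --> (0 : R) ->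
  exists M : R, 0 < M /\
    forall eps : R, 0 < eps ->
      (fun n => P0 n (Sigma0 n)
         [set X | eps <= posterior (2^-1) (2^-1) (tau1 n) (lam n) (tau n) X
            [set S | M * (((p n + s0 n)%:R * ln (p n)%:R) / n%:R)
                     <= frob2 (S - Sigma0 n)]])
      @ \oo --> 0%E.
Proof.
move=> tau01 s0p US [be [/andP[be0 _] [_ [Cp [Cp0 pn]]]]] tauge [Ct [_ taule]]
  lam0 [Cl [Cl0 lamle]] tau10 [[C1 [_ t1u]] [C2 [_ t1l]]] Wlim.
(* [0 < s0 < p (p - 1)] forces [p >= 2], so that an off-diagonal entry exists, as the degenerate
   case requires. *)
have p2 n : (1 < p n)%N.
  by have [s1 s2] := s0p n; case: (p n) s2 => [|[|]]//=; rewrite ?muln0 ltn0.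
have [B0|Bn0] := eqVneq (betaB 2^-1 2^-1 : R) 0.
  exists 1; split => // eps eps0.
  rewrite (_ : (fun n => _) = cst 0%E); first exact: cvg_cst.
  by apply/funext => n; exact: posterior_degenerate.
have B0 : 0 < betaB 2^-1 2^-1 :> R by rewrite lt0r Bn0 betaB_ge0.
have pinf (A : R) : \forall n \near \oo, A <= (p n)%:R.
  near=> n; rewrite -(ler_pM2l Cp0); apply: (@le_trans _ _ (n%:R `^ be)).
    by near: n; exact: near_pow_ge.
  by near: n.
(* [T] bounds [tau n] for large [n]; the integer [Tn] above it determines the extent of the grid. *)
pose T := Num.max 3 Ct; pose Tn := Num.bound T.
have T3 : 3 <= T by rewrite le_max lexx.
have T0 : 0 < T by exact: lt_le_trans T3.
have TTn : T <= Tn%:R by apply/ltW/archi_boundP/ltW.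
pose C := Num.max 1 (Num.max C1 C2).
have C1C : C1 <= C by rewrite !le_max lexx orbT.
have C2C : C2 <= C by rewrite !le_max lexx !orbT.
have Cge1 : 1 <= C by rewrite le_max lexx.
(* From [n^be <= Cp p] follows [be ln n <= ln Cp + ln p <= (Cp + 1) ln p], by [ln Cp <= Cp] and
   [1 <= ln p]. *)
pose K := (Cp + 1) / be.
(* [M] is chosen before [eps], which enters the bound only through the factor [2 + eps^-1]. *)
pose M := rate_const Tn T Cl C K (off_cst R).
have kc0 : 0 < off_cst R by rewrite /off_cst invr_gt0 mulr_gt0// sqrtr_gt0 mulr_gt0// pi_gt0.
have K0 : 0 <= K by rewrite divr_ge0 ?addr_ge0// ltW.
have M0 : 0 < M by exact: rate_const_gt0.
have eta0 : 0 < (256 * T ^+ 8)^-1.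
  by rewrite invr_gt0; apply: mulr_gt0; [rewrite ltr0n|exact: exprn_gt0].
have Weta : \forall n \near \oo,
    (p n + s0 n)%:R * ln (p n)%:R / n%:R <= (256 * T ^+ 8)^-1.
  by apply: filterS (cvgr_lt _ Wlim _ eta0) => n /ltW.
exists M; split=> // eps eps0.
have eps20 : 0 < 2 + eps^-1 by rewrite addr_gt0 ?invr_gt0.
(* [exp (- W) <= 1 / p] because [p + s0 >= 1], and [p] tends to infinity by (A2). *)
apply: (@squeeze_cvge _ _ _ _ (fun=> 0%E) _ (fun n => ((2 + eps^-1) * (p n)%:R^-1)%:E)).
- near=> n; rewrite P0_ge0/=.
  have n0 : (0 < n)%N by near: n; exact: nbhs_infty_gt.
  have p0 : (0 < p n)%N by exact: ltnW.
  have Pe : expR 1 <= (p n)%:R :> R by near: n; exact: pinf.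
  have P0' : 0 < (p n)%:R :> R by rewrite ltr0n.
  have l1 : 1 <= ln (p n)%:R :> R by rewrite -ler_expR lnK.
  have S0q : qbnd (Sigma0 n) (tau n)^-1 (tau n).
    have [[sy _] [_ eg]] := US n.
    have tt : tau0 <= tau n by apply: le_trans (tauge n); rewrite le_max lexx orbT.
    have tau00 : 0 < tau0 by exact: lt_trans tau01.
    apply: (qbnd_sub _ tt (eig_between_qbnd sy eg)).
    by rewrite lef_pV2 ?posrE ?(lt_le_trans tau00 tt).
  apply: le_trans (@posterior_rate R n (p n) (s0 n) Tn (Sigma0 n) T Cl C K (tau n)
    (lam n) (tau1 n) eps B0 _ _ TTn S0q (US n).2.1 (lam0 n) _ (tau10 n) Cge1 eps0 n0 p0 l1
    _ K0 _ _ _ _) _.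
  + by apply: le_trans (tauge n); rewrite le_max lexx.
  + apply: (@le_trans _ _ Ct); last by rewrite le_max lexx orbT.
    by rewrite -[leRHS]mulr1; near: n.
  + by rewrite -[leRHS]mulr1; near: n.
  + rewrite /K mulrAC ler_pdivlMr// mulrC -ln_powR.
    apply: (@le_trans _ _ (ln (Cp * (p n)%:R))).
      rewrite ler_ln ?posrE ?powR_gt0 ?mulr_gt0 ?ltr0n//.
      by near: n.
    rewrite lnM ?posrE// mulrDl mul1r lerD2r.
    apply: (@le_trans _ _ Cp); last by rewrite ler_peMr// ltW.
    by rewrite -ler_expR lnK ?posrE// le_expR.
  + apply: (@le_trans _ _ (C1 * (n%:R * (p n)%:R ^+ 4)^-1)); first by near: n.
    by rewrite ler_wpM2r// invr_ge0 mulr_ge0// exprn_ge0.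
  + apply: (@le_trans _ _ (C2 * tau1 n ^+ 2)); first by near: n.
    by rewrite ler_wpM2r// sqr_ge0.
  + by near: n.
  + by near: n; exact: pinf.
  rewrite lee_fin ler_wpM2l ?(ltW eps20)// -[in leRHS](lnK P0') -expRN ler_expR lerN2.
  rewrite ler_peMl ?(le_trans ler01 l1)//.
  by rewrite ler1n addn_gt0 p0.
- exact: cvg_cst.
- apply: cvg_EFin; first by near=> n.
  apply/cvgrPdist_le => e e0; near=> n.
  rewrite sub0r normrN /= ger0_norm ?divr_ge0 ?(ltW eps20)//.
  rewrite ler_pdivrMr ?ltr0n ?(ltnW (p2 n))// mulrC -ler_pdivrMr//.
  by near: n; exact: pinf.
Unshelve. all: by end_near.
Qed.
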